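(* For every positive integer $n$, \begin{align*} s_{24}(n) &= \frac{6552}{73\times 691}\sigma_{11}^*(n) + \frac{29824}{691} \tau(n) + \frac{240\times 1186848}{50443} \sum_{\substack{a,b\in \mathbb{N}_0\\ a+b=n}} \sigma_3(a)\, \tau_{8,3}(b)\\ &\quad - \frac{504\times 261344}{50443} \sum_{\substack{a,b\in \mathbb{N}_0\\ a+b=n}} \sigma_5(a)\, \tau_{6,3}(b) \end{align*} and \begin{align*} s_{28}(n) & = \frac{12}{1093} \sigma_{13}^*(n) + \frac{107264}{1093} \tau(n) + \frac{107264 \times 12}{1093} \left(\sum_{\substack{a,b\in \mathbb{N}\\ a+b=n}}\sigma(a) \tau(b) - 3 \sum_{\substack{a,b\in \mathbb{N}\\ 3a+b=n}}\sigma(a)\tau(b)\right)\\ & \quad + \frac{12448\times 504}{1093}\sum_{\substack{a,b\in \mathbb{N}_0\\ a+b=n}} \sigma_5(a)\, \tau_{8,3}(b) - \frac{3016\times 480}{1093} \sum_{\substack{a,b \in \mathbb{N}_0\\ a+b=n}} \sigma_7(a)\, \tau_{6,3}(b). \end{align*}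
   Context: For a positive integer $k$, let $F_k(x_1,\ldots,x_{2k}) = \sum_{j=1}^k \left(x_{2j-1}^2 + x_{2j-1}x_{2j} + x_{2j}^2\right)$ and let $s_{2k}(n) = \mathrm{card}\{(x_1,\ldots,x_{2k})\in\mathbb{Z}^{2k} : F_k(x_1,\ldots,x_{2k}) = n\}$. $\mathbb{N}=\{1,2,3,\ldots\}$ and $\mathbb{N}_0=\mathbb{N}\cup\{0\}$. For $n\ge1$, $\sigma_r(n)=\sum_{d\mid n}d^r$ and $\sigma=\sigma_1$; $\sigma_r(n/3)=0$ if $3\nmid n$. By convention $\sigma_3(0)=1/240$, $\sigma_5(0)=-1/504$, $\sigma_7(0)=1/480$. Define $\sigma_\ell^*(n) = \sigma_\ell(n)+(-3)^{(\ell+1)/2}\sigma_\ell(n/3)$. Let $q=e^{2\pi i z}$ with $\mathrm{Im}(z)>0$ and $\eta(z) = q^{1/24}\prod_{n\ge 1}(1-q^n)$. The Ramanujan tau function $\tau(n)$ is given by $\sum_{n\ge1}\tau(n)q^n=\eta^{24}(z)$. For $k=6,8$, $\tau_{k,3}(n)$ is the $n$-th Fourier coefficient of $\Delta_{k,3}(z)$, the normalized newform of weight $k$, level $3$ with trivial character; explicitly $$\Delta_{6,3}(z)=\sum_{n\ge1}\tau_{6,3}(n)q^n=\eta^6(z)\eta^6(3z),$$ $$\Delta_{8,3}(z)=\sum_{n\ge1}\tau_{8,3}(n)q^n=\eta^{12}(z)\eta^4(3z)+81\,\eta^6(z)\eta^4(3z)\eta^6(9z)+18\,\eta^9(z)\eta^4(3z)\eta^3(9z).$$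 By convention $\tau_{6,3}(0)=\tau_{8,3}(0)=0$. *)

(* Defs.v *)
From mathcomp Require Import all_boot all_order all_algebra.
From mathcomp Require Import finmap complex.
From mathcomp Require Import all_classical all_reals all_analysis.
Import Order.TTheory GRing.Theory Num.Theory.
Import numFieldNormedType.Exports.
Set Implicit Arguments.
Unset Strict Implicit.
Unset Printing Implicit Defensive.
Local Open Scope ring_scope.
Local Open Scope complex_scope.
Local Open Scope classical_set_scope.

(* The type R[i], read as a [numFieldType]: MathComp-Analysis attaches the norm
   topology to the carriers of that structure, not to [complex R] itself. *)
Notation cplx R := (Num.NumField.sort R[i]).

(* F_k; the variables x_1, ..., x_{2k} are stored at positions 0, ..., 2k-1. *)
Definition qform (k : nat) (x : (2 * k).-tuple int) : int :=
  \sum_(0 <= j < k)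
     (x`_(2 * j) ^+ 2 + x`_(2 * j) * x`_(2 * j + 1) + x`_(2 * j + 1) ^+ 2).

(* [rep_count k] is s_{2k}: the index k is half the number of variables.
   [fset_set] is empty on infinite sets, but the set below is finite because
   F_k is positive definite. *)
Definition rep_count (k n : nat) : nat :=
  #|` fset_set [set x : (2 * k).-tuple int | qform x = n%:Z] |.

(* The values at n = 0 are - B_{r+1} / (2 (r+1)), with B the Bernoulli numbers.
   Only r = 3, 5, 7 are used at n = 0; the last 0 is a placeholder. *)
Definition sigma (K : fieldType) (r n : nat) : K :=
  if n == 0%N then
    if r == 3%N then 240%:R^-1
    else if r == 5%N then - 504%:R^-1
    else if r == 7%N then 480%:R^-1
    else 0
  else \sum_(d <- divisors n) d%:R ^+ r.

(* Meant for odd l and n >= 1. *)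
Definition sigma_star (K : fieldType) (l n : nat) : K :=
  sigma K l n
  + (- 3%:R) ^+ (l.+1 %/ 2) * (if (3 %| n)%N then sigma K l (n %/ 3) else 0).

Definition cexp (R : realType) (w : cplx R) : cplx R :=
  (expR (complex.Re w) * cos (complex.Im w))
  +i* (expR (complex.Re w) * sin (complex.Im w)).

(* q^c = e^{2 pi i c z}. *)
Definition qpow (R : realType) (c : R) (z : cplx R) : cplx R :=
  cexp ((2%:R * pi * c)%:C * 'i%C * z).

Definition eta (R : realType) (z : cplx R) : cplx R :=
  qpow 24%:R^-1 z *
  lim ((fun N : nat => \prod_(1 <= n < N.+1) (1 - qpow 1 z ^+ n)) @ \oo).

Definition delta_6_3 (R : realType) (z : cplx R) : cplx R :=
  eta z ^+ 6 * eta (3%:R * z) ^+ 6.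

Definition delta_8_3 (R : realType) (z : cplx R) : cplx R :=
  eta z ^+ 12 * eta (3%:R * z) ^+ 4
  + 81%:R * eta z ^+ 6 * eta (3%:R * z) ^+ 4 * eta (9%:R * z) ^+ 6
  + 18%:R * eta z ^+ 9 * eta (3%:R * z) ^+ 4 * eta (9%:R * z) ^+ 3.

(* f(z) = sum_{n >= 1} a(n) q^n on the upper half-plane; a(0) is unconstrained. *)
Definition q_expansion (R : realType) (a : nat -> cplx R) (f : cplx R -> cplx R)
    : Prop :=
  forall z : cplx R, 0 < complex.Im z ->
    (fun N : nat => \sum_(1 <= n < N.+1) a n * qpow 1 z ^+ n) @ \oo --> f z.

(* Main.v *)
(* The proof works with formal power series in q. The substitution
   (a, b, x, y) -> (a - b, b, x, x + y) preserves a x + b y; following Liouville,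
   it turns sums of f (a - b) +- f (a + b) over the solutions of
   a x + b y = n into divisor sums. With f a power this gives the relations
   between the Eisenstein series of level 1, and with f a power times
   cos (2 pi a / 3) or the character mod 3 it gives the relations and the
   differential equations of the cubic functions
     A = 1 + 6 sum (d/3) q^(d e),  B = 1 - 9 sum (d/3) d^2 q^(d e),  C = A^3 - B,
   for instance E_4 = A^4 + 8 A C and E_6 = A^6 - 20 A^3 C - 8 C^2.
   Uniqueness for linear differential equations then identifies the eta quotients
     B = e1^9 / e3^3,  C = 27 q e3^9 / e1^3,  A e3 = e1^3 + 9 q e9^3,
   where em = prod (1 - q^(m i)). Multiplying three finite q-binomial products
   twisted by the cube roots of unity shows that A is the theta series of
   x^2 + x y + y^2, so that s_{2k} is the coefficient sequence of A^k. The cusp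
   forms are Delta = C B^3 / 27, Delta_{6,3} = C B / 27, Delta_{8,3} = A^2 C B / 27,
   and both formulas become polynomial identities in A and C. The
   hypotheses on the Fourier coefficients are only used for z on the positive
   imaginary axis, where a real power series is determined by its sum. *)
From HB Require Import structures.
Require Import Defs.
From mathcomp Require Import all_boot all_order all_algebra.
From mathcomp Require Import finmap complex.
From mathcomp Require Import all_classical all_reals all_analysis.
From mathcomp Require Import ring lra zify.
Import Order.TTheory GRing.Theory Num.Theory.
Import numFieldNormedType.Exports.
Set Implicit Arguments.
Unset Strict Implicit.
Unset Printing Implicit Defensive.
Local Open Scope ring_scope.

(** * Formal power series *)

(** In weight 12 there are five monomials A^12, A^9 C, A^6 C^2, A^3 C^3, C^4, and as many in weight
    14; two Eisenstein series and three cusp forms face them, and the coefficients of the theorem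
    solve this linear system. The denominators come from constant terms: 691 (E_12(q) + 3^6
    E_12(q^3)) starts with 691 * 730 = 10 * 50443, where 50443 = 73 * 691, and 3^7 E_14(q^3) -
    E_14(q) starts with 2186 = 2 * 1093. The values at 0 make sigma_3, sigma_5, sigma_7 the
    coefficients of E_4 / 240, - E_6 / 504, E_8 / 480. In the second formula the term in tau and the
    sums of sigma against tau form together A^2 Delta, since A^2 = 1 + 12 (sum sigma(n) q^n - 3 sum
    sigma(n) q^(3 n)); hence the factor 12 and the repeated 107264. *)

Record fps (K : Type) := Fps { coefs :> nat -> K }.

Lemma fpsP (K : Type) (f g : fps K) : (forall n, f n = g n) -> f = g.
Proof. by case: f g => [f] [g] /= /funext ->. Qed.

HB.instance Definition _ (K : Type) := gen_eqMixin (fps K).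
HB.instance Definition _ (K : Type) := gen_choiceMixin (fps K).

Section Ring.
Variable K : comNzRingType.
Implicit Types f g h : fps K.

Definition fps0 : fps K := Fps (fun=> 0).
Definition fps1 : fps K := Fps (fun n => (n == 0%N)%:R).
Definition fpsD f g : fps K := Fps (fun n => f n + g n).
Definition fpsN f : fps K := Fps (fun n => - f n).
Definition fpsM f g : fps K := Fps (fun n => \sum_(i < n.+1) f i * g (n - i)%N).

Definition trunc m f : {poly K} := \poly_(i < m.+1) f i.

Lemma coef_trunc m f n : (n <= m)%N -> (trunc m f)`_n = f n.
Proof. by move=> le_nm; rewrite coef_poly ltnS le_nm. Qed.

Lemma eq_coefM (p p' r r' : {poly K}) n :
  (forall i, (i <= n)%N -> p`_i = p'`_i) ->
  (forall i, (i <= n)%N -> r`_i = r'`_i) -> (p * r)`_n = (p' * r')`_n.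
Proof.
move=> ep er; rewrite !coefM; apply: eq_bigr => i _.
by rewrite ep ?er ?leq_subr // -ltnS.
Qed.

(** A coefficient of a product involves finitely many coefficients of the factors, so associativity
    and commutativity can be inherited from polynomials. *)
Lemma fpsM_trunc m f g n : (n <= m)%N -> fpsM f g n = (trunc m f * trunc m g)`_n.
Proof.
move=> le_nm; rewrite coefM; apply: eq_bigr => i _.
by rewrite !coef_trunc //; apply: leq_trans le_nm; rewrite ?leq_subr // -ltnS.
Qed.

Fact fpsDA : associative fpsD.
Proof. by move=> f g h; apply: fpsP => n /=; rewrite addrA. Qed.
Fact fpsDC : commutative fpsD.
Proof. by move=> f g; apply: fpsP => n /=; rewrite addrC. Qed.
Fact fpsD0 : left_id fps0 fpsD.
Proof. by move=> f; apply: fpsP => n /=; rewrite add0r. Qed.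
Fact fpsDN : left_inverse fps0 fpsN fpsD.
Proof. by move=> f; apply: fpsP => n /=; rewrite addNr. Qed.
HB.instance Definition _ :=
  GRing.isZmodule.Build (fps K) fpsDA fpsDC fpsD0 fpsDN.

Fact fpsMA : associative fpsM.
Proof.
move=> f g h; apply: fpsP => n; rewrite !(@fpsM_trunc n) //.
rewrite (@eq_coefM _ (trunc n f) _ (trunc n g * trunc n h)) //; last first.
  by move=> i le_in; rewrite coef_trunc // (@fpsM_trunc n).
rewrite mulrA; apply: eq_coefM => // i le_in.
by rewrite coef_trunc // (@fpsM_trunc n).
Qed.
Fact fpsMC : commutative fpsM.
Proof. by move=> f g; apply: fpsP => n; rewrite !(@fpsM_trunc n) // mulrC. Qed.
Fact fpsM1 : left_id fps1 fpsM.
Proof.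
move=> f; apply: fpsP => n /=; rewrite big_ord_recl /= mul1r subn0.
by rewrite big1 ?addr0 // => i _; rewrite mul0r.
Qed.
Fact fpsMDl : left_distributive fpsM fpsD.
Proof.
move=> f g h; apply: fpsP => n /=; rewrite -big_split; apply: eq_bigr => i _.
by rewrite mulrDl.
Qed.
Fact fps1_neq0 : fps1 != fps0.
Proof. by apply/eqP => /(congr1 (fun f : fps K => f 0%N)) /= /eqP; rewrite oner_eq0. Qed.
HB.instance Definition _ :=
  GRing.Zmodule_isComNzRing.Build (fps K) fpsMA fpsMC fpsM1 fpsMDl fps1_neq0.

Lemma coefs0 n : (0 : fps K) n = 0. Proof. by []. Qed.
Lemma coefs1 n : (1 : fps K) n = (n == 0%N)%:R. Proof. by []. Qed.
Lemma coefsD f g n : (f + g) n = f n + g n. Proof. by []. Qed.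
Lemma coefsN f n : (- f) n = - f n. Proof. by []. Qed.
Lemma coefsB f g n : (f - g) n = f n - g n. Proof. by []. Qed.
Lemma coefsM f g n : (f * g) n = \sum_(i < n.+1) f i * g (n - i)%N.
Proof. by []. Qed.
Lemma coefsMn f k n : (f *+ k) n = f n *+ k.
Proof. by elim: k => [//|k IHk]; rewrite !mulrS coefsD IHk. Qed.
Lemma coefs_nat k n : (k%:R : fps K) n = k%:R * (n == 0%N)%:R.
Proof. by rewrite coefsMn coefs1 mulr_natl. Qed.
Lemma coefs_sum (I : Type) (r : seq I) (P : pred I) (F : I -> fps K) n :
  (\sum_(i <- r | P i) F i) n = \sum_(i <- r | P i) F i n.
Proof. exact: (big_morph (fun f : fps K => f n) (fun f g => coefsD f g n) (coefs0 n)). Qed.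

Lemma coefsM0 f g : (f * g) 0%N = f 0%N * g 0%N.
Proof. by rewrite coefsM big_ord1. Qed.
Lemma coefsX0 f k : (f ^+ k) 0%N = f 0%N ^+ k.
Proof. by elim: k => [//|k IHk]; rewrite !exprS coefsM0 IHk. Qed.
Lemma coefs_natM k f n : (k%:R * f) n = k%:R * f n.
Proof. by rewrite !mulr_natl coefsMn. Qed.

Definition fpsC (c : K) : fps K := Fps (fun n => c * (n == 0%N)%:R).

Lemma coefs_fpsCM c f n : (fpsC c * f) n = c * f n.
Proof.
rewrite coefsM big_ord_recl big1 => [|i _] /=; first by rewrite mulr1 subn0 addr0.
by rewrite mulr0 mul0r.
Qed.

Lemma fpsCM c d : fpsC (c * d) = fpsC c * fpsC d.
Proof. by apply: fpsP => n; rewrite coefs_fpsCM /= mulrA. Qed.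

Lemma fpsC1 : fpsC 1 = 1.
Proof. by apply: fpsP => n /=; rewrite mul1r. Qed.

Lemma fpsCX c k : fpsC (c ^+ k) = fpsC c ^+ k.
Proof. by elim: k => [|k IHk]; rewrite ?fpsC1 // !exprS fpsCM IHk. Qed.

Lemma fpsCD c d : fpsC (c + d) = fpsC c + fpsC d.
Proof. by apply: fpsP => n; rewrite /= mulrDl. Qed.

Lemma fpsC0 : fpsC 0 = 0.
Proof. by apply: fpsP => n; rewrite /= mul0r. Qed.

Definition fpsX : fps K := Fps (fun n => (n == 1%N)%:R).

Lemma coefs_XM f n : (fpsX * f) n = if n is n'.+1 then f n' else 0.
Proof.
rewrite coefsM; case: n => [|n]; first by rewrite big_ord1 mul0r.
rewrite 2!big_ord_recl big1 => [|i _] /=; last by rewrite mul0r.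
by rewrite mul0r mul1r add0r addr0 subn1.
Qed.

Lemma coefs_XnM k f n :
  (fpsX ^+ k * f) n = if (k <= n)%N then f (n - k)%N else 0.
Proof.
elim: k n => [|k IHk] n; first by rewrite mul1r subn0.
rewrite exprS -mulrA coefs_XM; case: n => [//|n].
by rewrite IHk ltnS subSS.
Qed.

Lemma coefs_Xn k n : (fpsX ^+ k) n = (n == k)%:R.
Proof.
rewrite -[fpsX ^+ k]mulr1 coefs_XnM coefs1.
case: leqP => [le_kn|lt_nk]; last by rewrite ltn_eqF.
by rewrite subn_eq0 eqn_leq le_kn andbT.
Qed.

(* q d/dq *)
Definition fpsder f : fps K := Fps (fun n => n%:R * f n).

Lemma coefs_der f n : fpsder f n = n%:R * f n. Proof. by []. Qed.

Fact fpsder_additive : {morph fpsder : f g / f - g >-> f - g}.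
Proof. by move=> f g; apply: fpsP => n; rewrite /= mulrBr. Qed.
HB.instance Definition _ :=
  GRing.isZmodMorphism.Build (fps K) (fps K) fpsder fpsder_additive.

Lemma fpsderM f g : fpsder (f * g) = fpsder f * g + f * fpsder g.
Proof.
apply: fpsP => n; rewrite coefsD /= mulr_sumr -big_split; apply: eq_bigr => i _.
have /= -> : n%:R = i%:R + (n - i)%:R :> K by rewrite -natrD subnKC // -ltnS.
by rewrite mulrDl mulrA [in X in _ + X]mulrCA.
Qed.

Lemma fpsder1 : fpsder 1 = 0.
Proof. by apply: fpsP => -[|n]; rewrite /= ?mul0r ?mulr0. Qed.

Lemma fpsder_nat k : fpsder k%:R = 0.
Proof. by rewrite raddfMn /= fpsder1 mul0rn. Qed.

Lemma fpsder_natM k f : fpsder (k%:R * f) = k%:R * fpsder f.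
Proof. by rewrite fpsderM fpsder_nat mul0r add0r. Qed.

Lemma fpsderX f k : fpsder (f ^+ k.+1) = k.+1%:R * f ^+ k * fpsder f.
Proof.
elim: k => [|k IHk]; first by rewrite expr1 expr0 !mul1r.
rewrite exprS fpsderM IHk [in RHS]mulrSr exprS.
by move: (f ^+ k) (k.+1%:R : fps K) => fk c; ring.
Qed.

Lemma fpsderXf : fpsder fpsX = fpsX.
Proof. by apply: fpsP => -[|[|n]]; rewrite /= ?mul0r ?mulr1 ?mulr0. Qed.

Definition dilate m f : fps K :=
  Fps (fun n => if (m %| n)%N then f (n %/ m)%N else 0).

Lemma coefs_dilate m f n :
  dilate m f n = if (m %| n)%N then f (n %/ m)%N else 0.
Proof. by []. Qed.

Fact dilate_additive m : {morph dilate m : f g / f - g >-> f - g}.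
Proof.
by move=> f g; apply: fpsP => n; rewrite coefsB /=; case: ifP; rewrite ?subrr.
Qed.
HB.instance Definition _ m :=
  GRing.isZmodMorphism.Build (fps K) (fps K) (dilate m) (@dilate_additive m).

Lemma dilate_der m f : fpsder (dilate m f) = m%:R * dilate m (fpsder f).
Proof.
apply: fpsP => n; rewrite coefs_natM /=; case: ifP => [dvd|_].
  by rewrite mulrA -natrM mulnC divnK.
by rewrite !mulr0.
Qed.

Section Dilate.
Variables (m : nat) (m_gt0 : (0 < m)%N).

(** On truncations, f(q^m) is composition with 'X^m; multiplicativity of [dilate] is thereby
    inherited from [comp_polyM]. *)
Lemma dilate_trunc N f n : (n <= N)%N -> dilate m f n = (trunc N f \Po 'X^m)`_n.
Proof.
move=> le_nN; rewrite coef_comp_poly_Xn //=; case: ifP => // _.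
by rewrite coef_trunc // (leq_trans _ le_nN) // leq_div.
Qed.

Fact dilateM f g : dilate m (f * g) = dilate m f * dilate m g.
Proof.
apply: fpsP => n; rewrite (@fpsM_trunc n) //.
rewrite (@eq_coefM _ (trunc n f \Po 'X^m) _ (trunc n g \Po 'X^m)); last 2 first.
- by move=> i le_in; rewrite coef_trunc // (dilate_trunc _ le_in).
- by move=> i le_in; rewrite coef_trunc // (dilate_trunc _ le_in).
rewrite -comp_polyM coef_comp_poly_Xn //=; case: ifP => // _.
by rewrite -fpsM_trunc // leq_div.
Qed.

Lemma dilate1 : dilate m 1 = 1.
Proof.
apply: fpsP => n; rewrite coefs_dilate !coefs1; case: ifP => [/dvdnP[k ->]|ndvd].
  by rewrite mulnK // muln_eq0 [m == _]eqn0Ngt m_gt0 orbF.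
by case: eqP ndvd => // ->; rewrite dvdn0.
Qed.

Lemma dilate_nat k : dilate m k%:R = k%:R.
Proof. by rewrite raddfMn /= dilate1. Qed.

Lemma dilate_natM k f : dilate m (k%:R * f) = k%:R * dilate m f.
Proof. by rewrite dilateM dilate_nat. Qed.

Lemma dilateX f k : dilate m (f ^+ k) = dilate m f ^+ k.
Proof. by elim: k => [|k IHk]; rewrite ?dilate1 // !exprS dilateM IHk. Qed.

Lemma dilate_dilate k f : (0 < k)%N -> dilate m (dilate k f) = dilate (m * k) f.
Proof.
move=> k_gt0; apply: fpsP => n /=.
case: (boolP (m %| n)%N) => [/dvdnP[j ->]|ndvd].
  by rewrite mulnK // [(m * k)%N]mulnC dvdn_pmul2r // divnMr.
by case: ifP => // /(dvdn_trans (dvdn_mulr k (dvdnn m))); rewrite (negPf ndvd).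
Qed.

Lemma dilateXf : dilate m fpsX = fpsX ^+ m.
Proof.
apply: fpsP => n; rewrite coefs_Xn /=; case: ifP => [/dvdnP[k ->]|ndvd].
  by rewrite mulnK //; rewrite -{2}[m]mul1n eqn_pmul2r.
by case: eqP ndvd => // ->; rewrite dvdnn.
Qed.

End Dilate.

End Ring.

Arguments fpsX {K}.

(** * Liouville's bijections *)

Notation quadruple := ((nat * nat) * (nat * nat))%type.

(** A quadruple ((a, b), (x, y)) stands for a solution of a x + b y = n in positive integers. *)
Definition is_quad (n : nat) (t : quadruple) : bool :=
  [&& (0 < t.1.1)%N, (0 < t.1.2)%N, (0 < t.2.1)%N, (0 < t.2.2)%N
    & (t.1.1 * t.2.1 + t.1.2 * t.2.2 == n)%N].

Definition quads (n : nat) : seq quadruple :=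
  [seq t <- [seq ((val t.1.1, val t.1.2), (val t.2.1, val t.2.2))
            | t : ('I_n.+1 * 'I_n.+1) * ('I_n.+1 * 'I_n.+1)] | is_quad n t].

Lemma quads_uniq n : uniq (quads n).
Proof.
apply: filter_uniq; rewrite map_inj_uniq ?enum_uniq //.
by move=> [[a b] [x y]] [[a' b'] [x' y']] /= [] /val_inj-> /val_inj-> /val_inj-> /val_inj->.
Qed.

Lemma mem_quads n t : (t \in quads n) = is_quad n t.
Proof.
case: t => [[a b] [x y]]; rewrite mem_filter.
case: (boolP (is_quad n _)) => //= /and5P[/= a0 b0 x0 y0 /eqP e].
have [ha hb hx hy] : [/\ a < n.+1, b < n.+1, x < n.+1 & y < n.+1]%N.
  have := leq_pmulr a x0; have := leq_pmulr b y0.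
  have := leq_pmull x a0; have := leq_pmull y b0.
  by split; lia.
by apply/mapP; exists ((Ordinal ha, Ordinal hb), (Ordinal hx, Ordinal hy)); rewrite ?mem_enum.
Qed.

Lemma mem_filter_quads n (P : pred quadruple) t :
  (t \in [seq u <- quads n | P u]) = P t && is_quad n t.
Proof. by rewrite mem_filter mem_quads. Qed.

Section Quad.
Variable K : comNzRingType.
Implicit Types (G : quadruple -> K) (P : pred quadruple).

Lemma quads_bij n P P' (phi psi : quadruple -> quadruple) G :
  (forall t, is_quad n t -> P t -> [/\ is_quad n (phi t), P' (phi t) & psi (phi t) = t]) ->
  (forall t, is_quad n t -> P' t -> [/\ is_quad n (psi t), P (psi t) & phi (psi t) = t]) ->
  \sum_(t <- quads n | P t) G (phi t) = \sum_(t <- quads n | P' t) G t.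
Proof.
move=> h1 h2; rewrite -big_filter -[RHS]big_filter -(big_map phi xpredT).
apply: perm_big; apply: uniq_perm.
- rewrite map_inj_in_uniq => [|t u]; first exact/filter_uniq/quads_uniq.
  rewrite !mem_filter_quads => /andP[Pt qt] /andP[Pu qu] e.
  by have [_ _ <-] := h1 _ qt Pt; have [_ _ <-] := h1 _ qu Pu; rewrite e.
- exact/filter_uniq/quads_uniq.
- move=> t; rewrite mem_filter_quads; apply/mapP/andP => [[u]|[Pt qt]].
    rewrite mem_filter_quads => /andP[Pu qu] ->.
    by have [? ? _] := h1 _ qu Pu.
  have [q p e] := h2 _ qt Pt.
  by exists (psi t); rewrite // mem_filter_quads p q.
Qed.

Lemma quads_swap n P G :
  \sum_(t <- quads n | P (t.1.2, t.1.1, (t.2.2, t.2.1))) G (t.1.2, t.1.1, (t.2.2, t.2.1))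
  = \sum_(t <- quads n | P t) G t.
Proof.
apply: (@quads_bij _ _ _ _ (fun t => (t.1.2, t.1.1, (t.2.2, t.2.1)))).
- move=> [[a b] [x y]]; rewrite /is_quad /= => /and5P[-> -> -> -> /eqP e] ->.
  by split => //; rewrite addnC e eqxx.
- move=> [[a b] [x y]]; rewrite /is_quad /= => /and5P[-> -> -> -> /eqP e] ->.
  by split => //; rewrite addnC e eqxx.
Qed.

(* ax + by = (a - b) x + b (x + y) *)
Lemma quads_shear n G :
  \sum_(t <- quads n | (t.1.2 < t.1.1)%N)
     G (t.1.1 - t.1.2, t.1.2, (t.2.1, t.2.1 + t.2.2))%N
  = \sum_(t <- quads n | (t.2.1 < t.2.2)%N) G t.
Proof.
apply: (@quads_bij _ _ _ _ (fun t => (t.1.1 + t.1.2, t.1.2, (t.2.1, t.2.2 - t.2.1))%N)).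
- move=> [[a b] [x y]]; rewrite /is_quad /= => /and5P[a0 b0 x0 y0 /eqP e] lt_ba.
  split; first by apply/and5P; split => //; rewrite ?subn_gt0 //; [lia | apply/eqP; nia].
    by rewrite -[X in (X < _)%N]addn0 ltn_add2l.
  by rewrite subnK ?(ltnW lt_ba) // addKn.
- move=> [[a b] [x y]]; rewrite /is_quad /= => /and5P[a0 b0 x0 y0 /eqP e] lt_xy.
  split; first by apply/and5P; split => //; rewrite ?subn_gt0 //; [lia | apply/eqP; nia].
    by rewrite -[X in (X < _)%N]add0n ltn_add2r.
  by rewrite addnK subnKC ?(ltnW lt_xy).
Qed.

Lemma quads_shear' n G :
  \sum_(t <- quads n | (t.1.1 < t.1.2)%N)
     G (t.1.1, t.1.2 - t.1.1, (t.2.1 + t.2.2, t.2.2))%N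
  = \sum_(t <- quads n | (t.2.2 < t.2.1)%N) G t.
Proof.
rewrite -quads_swap -[RHS]quads_swap -quads_shear /=.
by apply: eq_bigr => t _; rewrite addnC.
Qed.

Lemma quads_trichotomy n (u v : quadruple -> nat) G :
  \sum_(t <- quads n) G t =
  \sum_(t <- quads n | (u t < v t)%N) G t + \sum_(t <- quads n | (v t < u t)%N) G t
  + \sum_(t <- quads n | u t == v t) G t.
Proof.
rewrite (bigID (fun t => (u t < v t)%N)) /= -addrA; congr (_ + _).
rewrite (bigID (fun t => (v t < u t)%N)) /=; congr (_ + _); apply: eq_bigl => t.
  by rewrite -leqNgt; case: ltngtP.
by rewrite -!leqNgt eqn_leq andbC.
Qed.

(* Liouville's identity for an even function f; |a - b| is (a - b) + (b - a),
   both differences being truncated. *)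
Lemma liouville_even n (f : nat -> K) :
  \sum_(t <- quads n) (f (t.1.1 - t.1.2 + (t.1.2 - t.1.1))%N - f (t.1.1 + t.1.2)%N)
  = \sum_(t <- quads n | t.1.1 == t.1.2) (2%:R * f t.1.1 + f 0%N)
    - \sum_(t <- quads n | t.2.1 == t.2.2) (2%:R * f t.1.1 + f (t.1.1 + t.1.2)%N).
Proof.
pose A := \sum_(t <- quads n | (t.2.1 < t.2.2)%N) f t.1.1.
pose B := \sum_(t <- quads n | (t.1.2 < t.1.1)%N) f t.1.1.
pose C := \sum_(t <- quads n | (t.1.1 < t.1.2)%N) f t.1.1.
pose D1 := \sum_(t <- quads n | t.1.1 == t.1.2) f t.1.1.
pose D2 := \sum_(t <- quads n | t.2.1 == t.2.2) f t.1.1.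
have CE : C = \sum_(t <- quads n | (t.2.2 < t.2.1)%N) f t.1.1.
  by rewrite -(quads_shear' n (fun t => f t.1.1)).
(* Both sides are the sum of f(a) over all solutions, split by comparing x with y on the left and a
   with b on the right. The part C is common to the two splittings, so A - B = D1 - D2. *)
have AE : A + C + D2 = C + B + D1.
  rewrite [in LHS]CE -(quads_trichotomy n (fun t => t.2.1) (fun t => t.2.2) (fun t => f t.1.1)).
  by rewrite (quads_trichotomy n (fun t => t.1.1) (fun t => t.1.2)).
(* For a > b the shear turns f (a - b) into f(a) on x < y; the case a < b is its mirror image. *)
have mE : \sum_(t <- quads n) f (t.1.1 - t.1.2 + (t.1.2 - t.1.1))%N
    = 2%:R * A + \sum_(t <- quads n | t.1.1 == t.1.2) f 0%N.
  rewrite (quads_trichotomy n (fun t => t.1.1) (fun t => t.1.2)).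
  rewrite -[X in X + _ + _]quads_swap /= mulr_natl mulr2n; congr (_ + _ + _).
  - rewrite /A -quads_shear; apply: eq_bigr => t /= lt.
    by rewrite (eqP (ltnW lt : (_ - _ == 0)%N)) add0n.
  - rewrite /A -quads_shear; apply: eq_bigr => t /= lt.
    by rewrite (eqP (ltnW lt : (_ - _ == 0)%N)) addn0.
  - by apply: eq_bigr => t /eqP ->; rewrite subnn.
have pE : \sum_(t <- quads n) f (t.1.1 + t.1.2)%N
    = 2%:R * B + \sum_(t <- quads n | t.2.1 == t.2.2) f (t.1.1 + t.1.2)%N.
  have BE : B = \sum_(t <- quads n | (t.2.1 < t.2.2)%N) f (t.1.1 + t.1.2)%N.
    rewrite -(quads_shear n (fun t => f (t.1.1 + t.1.2)%N)).
    by apply: eq_bigr => t /= lt; rewrite subnK // ltnW.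
  rewrite (quads_trichotomy n (fun t => t.2.1) (fun t => t.2.2)).
  rewrite -[X in _ + X + _]quads_swap /= mulr_natl mulr2n [in RHS]BE; congr (_ + _ + _).
  by apply: eq_bigr => t _; rewrite addnC.
rewrite sumrB mE pE big_split [X in _ = _ - X]big_split /= -!mulr_sumr -/D1 -/D2.
have -> : A = C + B + D1 - C - D2 by rewrite -AE; ring.
ring.
Qed.

(** The weight a b is not invariant under the shear: a b f(a - b) becomes (a + b) b f(a), that is g
    + h, and a b f(a + b) becomes (a - b) b f(a), that is g - h. The sums that survive add up to
    four times the sum of g over all solutions, which is the term subtracted; only diagonal sums
    remain. *)
Lemma liouville_weighted n (f : nat -> K) :
  \sum_(t <- quads n) t.1.1%:R * t.1.2%:R
     * (f (t.1.1 - t.1.2 + (t.1.2 - t.1.1))%N + f (t.1.1 + t.1.2)%N)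
  - 4%:R * \sum_(t <- quads n) t.1.1%:R * t.1.2%:R * f t.1.1
  = \sum_(t <- quads n | t.1.1 == t.1.2) t.1.1%:R ^+ 2 * f 0%N
    + \sum_(t <- quads n | t.2.1 == t.2.2)
        (t.1.1%:R * t.1.2%:R * f (t.1.1 + t.1.2)%N
         - 2%:R * (t.1.1%:R * t.1.2%:R + t.1.2%:R ^+ 2) * f t.1.1).
Proof.
pose g (t : quadruple) : K := t.1.1%:R * t.1.2%:R * f t.1.1.
pose h (t : quadruple) : K := t.1.2%:R ^+ 2 * f t.1.1.
pose A (k : quadruple -> K) := \sum_(t <- quads n | (t.2.1 < t.2.2)%N) k t.
pose A' (k : quadruple -> K) := \sum_(t <- quads n | (t.2.2 < t.2.1)%N) k t.
pose B (k : quadruple -> K) := \sum_(t <- quads n | (t.1.2 < t.1.1)%N) k t.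
pose B' (k : quadruple -> K) := \sum_(t <- quads n | (t.1.1 < t.1.2)%N) k t.
pose D1 (k : quadruple -> K) := \sum_(t <- quads n | t.1.1 == t.1.2) k t.
pose D2 (k : quadruple -> K) := \sum_(t <- quads n | t.2.1 == t.2.2) k t.
have tri1 k : \sum_(t <- quads n) k t = B' k + B k + D1 k.
  exact: (quads_trichotomy n (fun t => t.1.1) (fun t => t.1.2)).
have tri2 k : \sum_(t <- quads n) k t = A k + A' k + D2 k.
  exact: (quads_trichotomy n (fun t => t.2.1) (fun t => t.2.2)).
have mE : \sum_(t <- quads n) t.1.1%:R * t.1.2%:R * f (t.1.1 - t.1.2 + (t.1.2 - t.1.1))%N
    = 2%:R * (A g + A h) + \sum_(t <- quads n | t.1.1 == t.1.2) t.1.1%:R ^+ 2 * f 0%N.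
  have AE : A g + A h = \sum_(t <- quads n | (t.1.2 < t.1.1)%N)
      t.1.1%:R * t.1.2%:R * f (t.1.1 - t.1.2 + (t.1.2 - t.1.1))%N.
    rewrite /A -big_split -quads_shear; apply: eq_bigr => t /= lt.
    rewrite (eqP (ltnW lt : (_ - _ == 0)%N)) addn0 /g /h /= natrB ?(ltnW lt) //; ring.
  rewrite tri1 -[B' _]quads_swap /= mulr_natl mulr2n [in RHS]AE; congr (_ + _ + _).
  - by apply: eq_bigr => t _; rewrite addnC [_%:R * _]mulrC.
  - by apply: eq_bigr => t /eqP ->; rewrite subnn addn0 expr2.
have pE : \sum_(t <- quads n) t.1.1%:R * t.1.2%:R * f (t.1.1 + t.1.2)%N
    = 2%:R * (B g - B h)
      + \sum_(t <- quads n | t.2.1 == t.2.2) t.1.1%:R * t.1.2%:R * f (t.1.1 + t.1.2)%N.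
  have BE : B g - B h
      = \sum_(t <- quads n | (t.2.1 < t.2.2)%N) t.1.1%:R * t.1.2%:R * f (t.1.1 + t.1.2)%N.
    rewrite -quads_shear -sumrB; apply: eq_bigr => t /= lt.
    rewrite subnK ?(ltnW lt) // natrB ?(ltnW lt) // /g /h; ring.
  rewrite tri2 -[A' _]quads_swap /= mulr_natl mulr2n [in RHS]BE; congr (_ + _ + _).
  by apply: eq_bigr => t _; rewrite addnC [_%:R * _]mulrC.
have A'E : A' g + A' h = B' h - B' g.
  rewrite /A' -big_split -quads_shear' -sumrB; apply: eq_bigr => t /= lt.
  rewrite /g /h /= natrB ?(ltnW lt) //; ring.
have D1E : D1 h = D1 g by apply: eq_bigr => t /eqP; rewrite /h /g => ->.
have AE : A g + A h = (B' g + B g + D1 g) + (B' h + B h + D1 h) - (A' g + A' h) - D2 g - D2 h.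
  by rewrite -!tri1 !tri2; ring.
have -> : \sum_(t <- quads n) t.1.1%:R * t.1.2%:R * f t.1.1 = B' g + B g + D1 g.
  exact: tri1.
under eq_bigr do rewrite mulrDr.
rewrite big_split /= mE pE AE A'E D1E sumrB.
have -> : \sum_(t <- quads n | t.2.1 == t.2.2)
    2%:R * (t.1.1%:R * t.1.2%:R + t.1.2%:R ^+ 2) * f t.1.1 = 2%:R * (D2 g + D2 h).
  by rewrite /D2 -big_split mulr_sumr; apply: eq_bigr => t _; rewrite /g /h /=; ring.
ring.
Qed.

End Quad.

(** * Lambert series *)

Lemma quads0 : quads 0 = [::].
Proof.
case E: (quads 0) => [//|[[a b] [x y]] s].
have : (a, b, (x, y)) \in quads 0 by rewrite E mem_head.
by rewrite mem_quads /is_quad => /and5P[]; case: a {E} => [//|a]; case: x.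
Qed.

Section Lambert.
Variable K : comNzRingType.
Implicit Types (h k : nat -> K).

(* The sum over d, e >= 1 of (h d e) q^(d e). *)
Definition lam (h : nat -> nat -> K) : fps K :=
  Fps (fun n => if n == 0%N then 0 else \sum_(d <- divisors n) h d (n %/ d)%N).

Definition lambert h : fps K := lam (fun d _ => h d).

(* The sum over a, b, x, y >= 1 of (G a b) q^(a x + b y). *)
Definition conv2 (G : nat -> nat -> K) : fps K :=
  Fps (fun n => \sum_(t <- quads n) G t.1.1 t.1.2).

Lemma coefs_lam (h : nat -> nat -> K) n :
  (0 < n)%N -> lam h n = \sum_(d <- divisors n) h d (n %/ d)%N.
Proof. by rewrite /lam /= lt0n => /negPf ->. Qed.

Lemma eq_lam (h k : nat -> nat -> K) :
  (forall d e, (0 < d)%N -> (0 < e)%N -> h d e = k d e) -> lam h = lam k.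
Proof.
move=> e; apply: fpsP => n /=; case: posnP => // n_gt0.
rewrite [LHS]big_seq [RHS]big_seq; apply: eq_bigr => d; rewrite -dvdn_divisors // => dn.
by apply: e; rewrite ?divn_gt0 ?(dvdn_gt0 n_gt0 dn) // dvdn_leq.
Qed.

Lemma lamD (h k : nat -> nat -> K) : lam h + lam k = lam (fun d e => h d e + k d e).
Proof.
apply: fpsP => n; rewrite coefsD /=; case: ifP => _; first by rewrite addr0.
by rewrite -big_split.
Qed.

Lemma lamN (h : nat -> nat -> K) : - lam h = lam (fun d e => - h d e).
Proof.
apply: fpsP => n; rewrite coefsN /=; case: ifP => _; first by rewrite oppr0.
by rewrite sumrN.
Qed.

Lemma lam_nat m (h : nat -> nat -> K) : m%:R * lam h = lam (fun d e => m%:R * h d e).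
Proof.
apply: fpsP => n; rewrite coefs_natM /=; case: ifP => _; first by rewrite mulr0.
by rewrite mulr_sumr.
Qed.

Lemma lam_der (h : nat -> nat -> K) :
  fpsder (lam h) = lam (fun d e => (d * e)%:R * h d e).
Proof.
apply: fpsP => n; rewrite coefs_der /=; case: posnP => n0; first by rewrite mulr0.
rewrite mulr_sumr big_seq [RHS]big_seq; apply: eq_bigr => d.
by rewrite -dvdn_divisors // mulnC => /divnK ->.
Qed.

Lemma perm_divisors_compl n : (0 < n)%N ->
  perm_eq (divisors n) [seq (n %/ d)%N | d <- divisors n].
Proof.
move=> n_gt0; apply: uniq_perm; rewrite ?divisors_uniq //.
  rewrite map_inj_in_uniq ?divisors_uniq // => d e.
  rewrite -!dvdn_divisors // => dn en eq; apply/eqP.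
  have q_gt0 : (0 < n %/ e)%N by rewrite divn_gt0 ?(dvdn_gt0 n_gt0 en) // dvdn_leq.
  by rewrite -(eqn_pmul2l q_gt0) -[in X in X == _]eq !divnK.
move=> d; rewrite -dvdn_divisors //; apply/idP/mapP => [dn|[e]].
  exists (n %/ d)%N; rewrite -?dvdn_divisors ?dvdn_div //.
  by rewrite divnA // mulKn.
by rewrite -dvdn_divisors // => en ->; apply: dvdn_div.
Qed.

Lemma lam_swap (h : nat -> nat -> K) : lam h = lam (fun d e => h e d).
Proof.
apply: fpsP => n /=; case: posnP => // n_gt0.
rewrite (perm_big _ (perm_divisors_compl n_gt0)) /= big_map.
rewrite [LHS]big_seq [RHS]big_seq; apply: eq_bigr => d; rewrite -dvdn_divisors // => dn.
by rewrite divnA // mulKn.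
Qed.

Lemma dilate_lam m (h : nat -> nat -> K) : (0 < m)%N ->
  dilate m (lam h) = lam (fun d e => if (m %| d)%N then h (d %/ m)%N e else 0).
Proof.
move=> m_gt0; apply: fpsP => n /=; case: (posnP n) => [->|n_gt0].
  by rewrite dvdn0 div0n.
rewrite -[RHS]big_mkcond /= -[RHS]big_filter; case: ifP => mn; last first.
  rewrite big_seq big1 // => d; rewrite mem_filter -dvdn_divisors // => /andP[md dn].
  by rewrite (dvdn_trans md dn) in mn.
have nm_gt0 : (0 < n %/ m)%N by rewrite divn_gt0 // dvdn_leq.
rewrite eqn0Ngt nm_gt0 /=.
rewrite [RHS](perm_big [seq (m * d)%N | d <- divisors (n %/ m)]); last first.
  apply: uniq_perm; first exact/filter_uniq/divisors_uniq.
    rewrite map_inj_uniq ?divisors_uniq // => d e /eqP.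
    by rewrite eqn_pmul2l // => /eqP.
  move=> d; rewrite mem_filter -dvdn_divisors //; apply/andP/mapP.
    move=> [/dvdnP[k ->] dn]; exists k; rewrite 1?mulnC // -dvdn_divisors //.
    by rewrite dvdn_divRL // mulnC.
  move=> [k]; rewrite -dvdn_divisors // dvdn_divRL // => kn ->.
  by rewrite dvdn_mulr // mulnC.
rewrite big_map; apply: eq_bigr => d _.
by rewrite mulKn // divnMA.
Qed.

Lemma conv2D G H : conv2 (fun a b => G a b + H a b) = conv2 G + conv2 H.
Proof. by apply: fpsP => n; rewrite coefsD /= big_split. Qed.

Lemma conv2N G : conv2 (fun a b => - G a b) = - conv2 G.
Proof. by apply: fpsP => n; rewrite coefsN /= sumrN. Qed.

Lemma conv2_nat m G : conv2 (fun a b => m%:R * G a b) = m%:R * conv2 G.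
Proof. by apply: fpsP => n; rewrite coefs_natM /= mulr_sumr. Qed.

(** The solutions are grouped by i = a x: then a runs over the divisors of i and b over those of n -
    i, while x and y are the cofactors. *)
Lemma conv2M h k : conv2 (fun a b => h a * k b) = lambert h * lambert k.
Proof.
apply: fpsP => n; rewrite coefsM /=.
case: (posnP n) => [->|n_gt0].
  by rewrite quads0 big_nil big_ord1 mul0r.
rewrite big_seq (partition_big (fun t => inord (t.1.1 * t.2.1) : 'I_n.+1) xpredT) //=.
apply: eq_bigr => i _; rewrite -big_seq_cond.
have tE t : t \in quads n -> (inord (t.1.1 * t.2.1) == i) = (t.1.1 * t.2.1 == i)%N.
  move=> tq; rewrite -val_eqE /= inordK // ltnS.
  by move: tq; rewrite mem_quads => /and5P[_ _ _ _ /eqP <-]; apply: leq_addr.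
(* The extreme values i = 0 and i = n are treated apart: no solution has a x = 0 or b y = 0, and
   Lambert series vanish at 0. *)
case: eqP => [i0|/eqP i0].
  rewrite big_seq_cond big1 ?mul0r // => t /andP[tq].
  rewrite tE // i0 => /eqP e; move: tq; rewrite mem_quads => /and5P[].
  by case: t e => [[[|a] b] [[|x] y]].
case: eqP => [ni0|/eqP ni0].
  rewrite mulr0 big_seq_cond big1 // => t /andP[tq].
  rewrite tE // => /eqP e; move: tq; rewrite mem_quads => /and5P[_ b0 _ y0 /eqP].
  have := ltn_ord i; move: (muln_gt0 t.1.2 t.2.2); rewrite b0 y0 e /=; lia.
rewrite -!lt0n in i0 ni0.
have li : (i <= n)%N by rewrite -ltnS.
rewrite big_distrlr /= -big_filter.
rewrite (perm_big [seq ((d, e), (i %/ d, (n - i) %/ e))%N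
                  | d <- divisors i, e <- divisors (n - i)]) /=.
  by rewrite big_allpairs_dep.
apply: uniq_perm; first exact/filter_uniq/quads_uniq.
  by apply: allpairs_uniq; rewrite ?divisors_uniq // => -[a b] [c d] _ _ /= [-> ->].
move=> t; rewrite mem_filter_quads.
apply/andP/allpairsP => [[e q]|[[d e] [/= di en ->]]].
  have := q; rewrite -mem_quads => tq; rewrite tE // in e.
  move: q => /and5P[a0 b0 x0 y0 /eqP eq].
  exists (t.1.1, t.1.2); rewrite /= -!dvdn_divisors // -(eqP e).
  rewrite -eq addKn !dvdn_mulr // !mulKn //.
  by case: (t) => [[? ?] [? ?]].
rewrite -!dvdn_divisors // in di en.
have q : is_quad n ((d, e), (i %/ d, (n - i) %/ e))%N.
  have d0 := dvdn_gt0 i0 di; have e0 := dvdn_gt0 ni0 en.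
  apply/and5P; split=> //=; rewrite ?divn_gt0 //; try exact: dvdn_leq.
  by rewrite mulnC divnK // mulnC divnK // subnKC.
split=> //; rewrite tE ?mem_quads //=.
by rewrite mulnC divnK.
Qed.

(** With a = b = d the equation is d (x + y) = n, and x + y = e has e - 1 solutions in positive
    integers. *)
Lemma quads_diag1 n h :
  \sum_(t <- quads n | t.1.1 == t.1.2) h t.1.1 = lam (fun d e => e.-1%:R * h d) n.
Proof.
rewrite /=; case: (posnP n) => [->|n_gt0]; first by rewrite quads0 big_nil.
rewrite -big_filter.
rewrite (perm_big [seq ((d, d), (x, n %/ d - x)%N) | d <- divisors n, x <- index_iota 1 (n %/ d)]).
  rewrite big_allpairs_dep /=; apply: eq_bigr => d _.
  by rewrite big_const_nat iter_addr_0 mulr_natl subn1.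
apply: uniq_perm; first exact/filter_uniq/quads_uniq.
  apply: allpairs_uniq_dep; [exact: divisors_uniq | by move=> d _; apply: iota_uniq |].
  by move=> [a b] [c d] _ _ /= [-> _ -> _].
move=> t; rewrite mem_filter_quads; apply/andP/allpairsPdep.
  case: t => [[a b] [x y]] /= [/eqP <-] /and5P[/= a0 _ x0 y0 /eqP e].
  exists a, x; rewrite -dvdn_divisors // mem_index_iota -e -mulnDr dvdn_mulr //.
  by rewrite mulKn // addKn x0 -[X in (X < _)%N]addn0 ltn_add2l y0.
move=> [d [x [dn xn ->]]]; rewrite /= eqxx; split=> //.
rewrite -dvdn_divisors // in dn; move: xn; rewrite mem_index_iota => /andP[x0 lt].
have d0 := dvdn_gt0 n_gt0 dn.
apply/and5P; split=> //=; first by rewrite subn_gt0.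
by rewrite -mulnDr subnKC 1?ltnW // mulnC divnK.
Qed.

(** With x = y the equation is (a + b) x = n, so that d = a + b is a divisor of n. *)
Lemma quads_diag2 n (G : nat -> nat -> K) :
  \sum_(t <- quads n | t.2.1 == t.2.2) G t.1.1 t.1.2
  = lam (fun d _ => \sum_(1 <= a < d) G a (d - a)%N) n.
Proof.
rewrite /=; case: (posnP n) => [->|n_gt0]; first by rewrite quads0 big_nil.
rewrite -big_filter.
rewrite (perm_big [seq ((a, d - a), (n %/ d, n %/ d))%N | d <- divisors n, a <- index_iota 1 d]).
  by rewrite big_allpairs_dep /=.
apply: uniq_perm; first exact/filter_uniq/quads_uniq.
  apply: allpairs_uniq_dep; [exact: divisors_uniq | by move=> d _; apply: iota_uniq |].
  move=> u v /allpairsPdep[d [a [dn ad ->]]] /allpairsPdep[d' [a' [dn' ad' ->]]] /= [ea].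
  move: ad ad'; rewrite !mem_index_iota ea => /andP[_ lt] /andP[_ lt'] eb _.
  by rewrite -(subnKC (ltnW lt)) eb subnKC // ltnW.
move=> t; rewrite mem_filter_quads; apply/andP/allpairsPdep.
  case: t => [[a b] [x y]] /= [/eqP <-] /and5P[/= a0 b0 x0 _ /eqP e].
  exists (a + b)%N, a; rewrite -dvdn_divisors // mem_index_iota -e -mulnDl dvdn_mulr //.
  by rewrite mulKn ?addn_gt0 ?a0 // addKn -[X in (X < _)%N]addn0 ltn_add2l b0.
move=> [d [a [dn ad ->]]]; rewrite /= eqxx; split=> //.
rewrite -dvdn_divisors // in dn; move: ad; rewrite mem_index_iota => /andP[a0 lt].
have d0 := dvdn_gt0 n_gt0 dn; have q0 : (0 < n %/ d)%N by rewrite divn_gt0 // dvdn_leq.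
apply/and5P; split=> //=; first by rewrite subn_gt0.
by rewrite -mulnDl subnKC 1?ltnW // mulnC divnK.
Qed.

(** The factor e.-1 is the source of derivatives: for f(d) = d^(2 j) the term e d^(2 j) = (d e) d^(2
    j - 1) is the summand of q d/dq of [sig (2 j - 1)]. *)
Lemma liouville1 (f : nat -> K) :
  conv2 (fun a b => f (a - b + (b - a))%N - f (a + b)%N)
  = lam (fun d e => e.-1%:R * (2%:R * f d + f 0%N)
           - d.-1%:R * f d - 2%:R * \sum_(1 <= a < d) f a).
Proof.
apply: fpsP => n; rewrite [LHS]liouville_even.
rewrite (quads_diag1 n (fun a => 2%:R * f a + f 0%N)).
rewrite (quads_diag2 n (fun a b => 2%:R * f a + f (a + b)%N)).
rewrite -coefsB lamN lamD; congr (coefs _ n); apply: eq_lam => d e d0 _.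
rewrite -addrA -opprD; congr (_ - _).
rewrite big_split /= -mulr_sumr addrC; congr (_ + _).
rewrite -subn1 mulr_natl -iter_addr_0 -big_const_nat.
by apply: eq_big_nat => a /andP[_ lt]; rewrite subnKC // ltnW.
Qed.

(** The cofactor e occurs only together with f 0: when f 0 = 0 the result is a Lambert series in d
    alone, without derivatives. *)
Lemma liouville2 (f : nat -> K) :
  conv2 (fun a b => a%:R * b%:R * (f (a - b + (b - a))%N + f (a + b)%N)
                    - 4%:R * (a%:R * b%:R * f a))
  = lam (fun d e => e.-1%:R * (d%:R ^+ 2 * f 0%N) +
      (\sum_(1 <= a < d) a%:R * (d%:R - a%:R)) * f d
      - 2%:R * d%:R * \sum_(1 <= a < d) (d%:R - a%:R) * f a).
Proof.
apply: fpsP => n.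
transitivity (\sum_(t <- quads n) t.1.1%:R * t.1.2%:R
     * (f (t.1.1 - t.1.2 + (t.1.2 - t.1.1))%N + f (t.1.1 + t.1.2)%N)
  - 4%:R * \sum_(t <- quads n) t.1.1%:R * t.1.2%:R * f t.1.1).
  by rewrite /= sumrB -mulr_sumr.
rewrite liouville_weighted.
rewrite (quads_diag1 n (fun a => a%:R ^+ 2 * f 0%N)).
rewrite (quads_diag2 n (fun a b => a%:R * b%:R * f (a + b)%N
         - 2%:R * (a%:R * b%:R + b%:R ^+ 2) * f a)).
rewrite -coefsD lamD; congr (coefs _ n); apply: eq_lam => d e d0 _.
rewrite -addrA; congr (_ + _); rewrite mulr_suml mulr_sumr -sumrB.
apply: eq_big_nat => a /andP[_ lt]; rewrite subnKC ?(ltnW lt) // natrB ?(ltnW lt) //.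
ring.
Qed.

End Lambert.

(** * Cancellation, and equations deduced from known ones by linear combination *)

Section Cancel.
Variable K : numFieldType.
Implicit Types f g l r u v : fps K.

Lemma fps_cancel f l r : f 0%N != 0 -> f * l = f * r -> l = r.
Proof.
move=> f0 e; apply: fpsP; elim/ltn_ind => n IHn.
move/(congr1 (fun h : fps K => h n)): e; rewrite !coefsM !big_ord_recl subn0 /=.
under eq_bigr => i _ do rewrite IHn ?ltn_subrL ?(leq_ltn_trans _ (ltn_ord i)) //.
by move/addIr/(mulfI f0).
Qed.

Lemma fps_nat_cancel n l r : n.+1%:R * l = n.+1%:R * r -> l = r.
Proof. by apply: fps_cancel; rewrite coefs_nat mulr1 pnatr_eq0. Qed.

(* These reduce an equation to a ring identity expressing it as a combination,
   with given coefficients, of known equations. *)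
Lemma lin1 (c : fps K) l r u v : u = v -> l - r = c * (u - v) -> l = r.
Proof. by move=> ->; rewrite subrr mulr0 => /subr0_eq. Qed.

Lemma lin2 (c c' : fps K) l r u v u' v' : u = v -> u' = v' ->
  l - r = c * (u - v) + c' * (u' - v') -> l = r.
Proof. by move=> -> ->; rewrite !subrr !mulr0 addr0 => /subr0_eq. Qed.

Lemma lin3 (c c' c'' : fps K) l r u v u' v' u'' v'' :
  u = v -> u' = v' -> u'' = v'' ->
  l - r = c * (u - v) + c' * (u' - v') + c'' * (u'' - v'') -> l = r.
Proof. by move=> -> -> ->; rewrite !subrr !mulr0 !addr0 => /subr0_eq. Qed.

End Cancel.

(** * Closed forms of power sums *)

Section PowerSums.
Variable K : numFieldType.
Local Notation S k m := (\sum_(1 <= a < m.+1) a%:R ^+ k : K).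

Ltac power_sum :=
  let m := fresh "m" in let IHm := fresh "IHm" in
  elim=> [|m IHm]; [by rewrite big_geq //; ring
                   | by rewrite big_nat_recr //= IHm -natr1; field].

Lemma power_sum1 m : S 1 m = m%:R * (m%:R + 1) / 2%:R.
Proof. move: m; power_sum. Qed.

Lemma power_sum2 m : S 2 m
  = (2%:R * m%:R ^+ 3 + 3%:R * m%:R ^+ 2 + m%:R) / 6%:R.
Proof. move: m; power_sum. Qed.

Lemma power_sum4 m : S 4 m
  = (6%:R * m%:R ^+ 5 + 15%:R * m%:R ^+ 4 + 10%:R * m%:R ^+ 3 - m%:R) / 30%:R.
Proof. move: m; power_sum. Qed.

Lemma power_sum5 m : S 5 m
  = (2%:R * m%:R ^+ 6 + 6%:R * m%:R ^+ 5 + 5%:R * m%:R ^+ 4 - m%:R ^+ 2) / 12%:R.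
Proof. move: m; power_sum. Qed.

Lemma power_sum6 m : S 6 m
  = (6%:R * m%:R ^+ 7 + 21%:R * m%:R ^+ 6 + 21%:R * m%:R ^+ 5 - 7%:R * m%:R ^+ 3 + m%:R) / 42%:R.
Proof. move: m; power_sum. Qed.

Lemma power_sum7 m : S 7 m
  = (3%:R * m%:R ^+ 8 + 12%:R * m%:R ^+ 7 + 14%:R * m%:R ^+ 6 - 7%:R * m%:R ^+ 4 + 2%:R * m%:R ^+ 2) / 24%:R.
Proof. move: m; power_sum. Qed.

Lemma power_sum8 m : S 8 m
  = (10%:R * m%:R ^+ 9 + 45%:R * m%:R ^+ 8 + 60%:R * m%:R ^+ 7 - 42%:R * m%:R ^+ 5 + 20%:R * m%:R ^+ 3 - 3%:R * m%:R) / 90%:R.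
Proof. move: m; power_sum. Qed.

Lemma power_sum9 m : S 9 m
  = (2%:R * m%:R ^+ 10 + 10%:R * m%:R ^+ 9 + 15%:R * m%:R ^+ 8 - 14%:R * m%:R ^+ 6 + 10%:R * m%:R ^+ 4 - 3%:R * m%:R ^+ 2) / 20%:R.
Proof. move: m; power_sum. Qed.

Lemma power_sum10 m : S 10 m
  = (6%:R * m%:R ^+ 11 + 33%:R * m%:R ^+ 10 + 55%:R * m%:R ^+ 9 - 66%:R * m%:R ^+ 7 + 66%:R * m%:R ^+ 5 - 33%:R * m%:R ^+ 3 + 5%:R * m%:R) / 66%:R.
Proof. move: m; power_sum. Qed.

Lemma power_sum11 m : S 11 m
  = (2%:R * m%:R ^+ 12 + 12%:R * m%:R ^+ 11 + 22%:R * m%:R ^+ 10 - 33%:R * m%:R ^+ 8 + 44%:R * m%:R ^+ 6 - 33%:R * m%:R ^+ 4 + 10%:R * m%:R ^+ 2) / 24%:R.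
Proof. move: m; power_sum. Qed.

End PowerSums.

(** * Eisenstein series of level 1 *)

Section LambertLinear.
Variable K : numFieldType.

Definition sig k : fps K := lambert (fun d => d%:R ^+ k).

Lemma absdiffX_even a b j :
  (a - b + (b - a))%N%:R ^+ (2 * j) = (a%:R - b%:R) ^+ (2 * j) :> K.
Proof.
case: (leqP a b) => [le_ab|/ltnW le_ba].
  rewrite (eqP (le_ab : (_ - _ == 0)%N)) add0n natrB //.
  by rewrite -opprB exprM sqrrN -exprM.
by rewrite (eqP (le_ba : (_ - _ == 0)%N)) addn0 natrB.
Qed.

Lemma eq_conv2 (G H : nat -> nat -> K) : G =2 H -> conv2 G = conv2 H.
Proof. by move=> e; congr conv2; apply/funext => a; apply/funext => b. Qed.

Lemma liouville1_pow j : (0 < j)%N ->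
  conv2 (fun a b => (a%:R - b%:R) ^+ (2 * j) - (a%:R + b%:R) ^+ (2 * j) : K)
  = lam (fun d e => 2%:R * (e%:R - 1) * d%:R ^+ (2 * j)
           - (d%:R - 1) * d%:R ^+ (2 * j) - 2%:R * \sum_(1 <= a < d) a%:R ^+ (2 * j)).
Proof.
move=> j0; have := liouville1 (fun k => k%:R ^+ (2 * j) : K).
under eq_conv2 => a b do rewrite absdiffX_even natrD.
move=> ->; apply: eq_lam => -[//|d] [//|e] _ _ /=.
have -> : 0 ^+ (2 * j) = 0 :> K by case: (j) j0 => [//|k] _; rewrite expr0n muln_eq0.
by rewrite -![_.+1%:R]natr1; ring.
Qed.

Lemma liouville2_pow j : (0 < j)%N ->
  conv2 (fun a b => a%:R * b%:R * ((a%:R - b%:R) ^+ (2 * j) + (a%:R + b%:R) ^+ (2 * j))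
                    - 4%:R * (a%:R * b%:R * a%:R ^+ (2 * j)) : K)
  = lam (fun d _ => (d%:R * \sum_(1 <= a < d) a%:R ^+ 1 - \sum_(1 <= a < d) a%:R ^+ 2)
           * d%:R ^+ (2 * j)
         - 2%:R * d%:R * (d%:R * \sum_(1 <= a < d) a%:R ^+ (2 * j)
                          - \sum_(1 <= a < d) a%:R ^+ (2 * j).+1)).
Proof.
move=> j0; have := liouville2 (fun k => k%:R ^+ (2 * j) : K).
under eq_conv2 => a b do rewrite absdiffX_even natrD.
move=> ->; apply: eq_lam => d e _ _ /=.
have -> : 0 ^+ (2 * j) = 0 :> K by case: (j) j0 => [//|k] _; rewrite expr0n muln_eq0.
rewrite !mulr0 add0r; congr (_ * _ - _ * _).
  by rewrite mulr_sumr -sumrB; apply: eq_bigr => a _; ring.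
by rewrite mulr_sumr -sumrB; apply: eq_bigr => a _; rewrite exprS mulrBl.
Qed.

Lemma lam_of_add f g F G : f = lam F -> g = lam G -> f + g = lam (fun d e => F d e + G d e : K).
Proof. by move=> -> ->; rewrite lamD. Qed.

Lemma lam_of_opp f F : f = lam F -> - f = lam (fun d e => - F d e : K).
Proof. by move=> ->; rewrite lamN. Qed.

Lemma lam_of_nat m f F : f = lam F -> m%:R * f = lam (fun d e => m%:R * F d e : K).
Proof. by move=> ->; rewrite lam_nat. Qed.

Lemma lam_of_der f F : f = lam F -> fpsder f = lam (fun d e => (d * e)%:R * F d e : K).
Proof. by move=> ->; rewrite lam_der. Qed.

Lemma lam_ext f g F G : f = lam F -> g = lam G ->
  (forall d e, F d.+1 e.+1 = G d.+1 e.+1 :> K) -> f = g.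
Proof. by move=> -> -> h; apply: eq_lam => -[//|d] [//|e] _ _; apply: h. Qed.

Lemma conv2_of_add f g G H :
  f = conv2 G -> g = conv2 H -> f + g = conv2 (fun a b => G a b + H a b : K).
Proof. by move=> -> ->; rewrite conv2D. Qed.

Lemma conv2_of_opp f G : f = conv2 G -> - f = conv2 (fun a b => - G a b : K).
Proof. by move=> ->; rewrite conv2N. Qed.

Lemma conv2_of_nat m f G : f = conv2 G -> m%:R * f = conv2 (fun a b => m%:R * G a b : K).
Proof. by move=> ->; rewrite conv2_nat. Qed.

Lemma conv2_ext f (G H : nat -> nat -> K) : f = conv2 G -> G =2 H -> f = conv2 H.
Proof. by move=> -> /eq_conv2. Qed.

End LambertLinear.

(** Collects a linear combination of Lambert series into one [lam], whose summand is an existential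
    variable filled along the way. An identity between two combinations then reduces to a rational
    identity in d and e. *)
Ltac to_lam := lazymatch goal with
  | |- (_ + _)%R = _ => apply: lam_of_add; to_lam
  | |- (- _)%R = _ => apply: lam_of_opp; to_lam
  | |- (_ * _)%R = _ => apply: lam_of_nat; to_lam
  | |- fpsder _ = _ => apply: lam_of_der; to_lam
  | |- _ => reflexivity
  end.

Ltac lam_identity := apply: lam_ext; [to_lam | to_lam | move=> d e; cbv beta].

Ltac to_conv2 := lazymatch goal with
  | |- (_ + _)%R = _ => apply: conv2_of_add; to_conv2
  | |- (- _)%R = _ => apply: conv2_of_opp; to_conv2
  | |- (_%:R * _)%R = _ => apply: conv2_of_nat; to_conv2
  | |- _ => symmetry; apply: conv2M
  end.

Ltac conv2_identity := apply: conv2_ext; [to_conv2 | move=> a b; cbv beta].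

Section Eisenstein.
Variable K : numFieldType.
Local Notation sig := (@sig K).

(** From (a - b)^2 - (a + b)^2 = - 4 a b. This is Ramanujan's equation for the derivative of E_2. *)
Lemma sig_sqr1 :
  12%:R * sig 1 ^+ 2 = 5%:R * sig 3 + sig 1 - 6%:R * fpsder (sig 1).
Proof.
have e : 3%:R * (- (4%:R * (sig 1 * sig 1)))
    = 6%:R * fpsder (sig 1) - 5%:R * sig 3 - sig 1.
  have -> : - (4%:R * (sig 1 * sig 1))
      = conv2 (fun a b => (a%:R - b%:R) ^+ (2 * 1) - (a%:R + b%:R) ^+ (2 * 1)).
    by conv2_identity; ring.
  rewrite liouville1_pow //; lam_identity.
  by rewrite ?natrM power_sum2 -!natr1; field.
by apply: (lin1 (c := -1) e); ring.
Qed.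

(** From the fourth powers, where a^3 b and a b^3 both give [sig 1 * sig 3]. This is Ramanujan's
    equation for the derivative of E_4. *)
Lemma sig1M3 :
  240%:R * (sig 1 * sig 3) = 21%:R * sig 5 + 10%:R * sig 3 - sig 1 - 30%:R * fpsder (sig 3).
Proof.
have e : 15%:R * (- (8%:R * (sig 1 * sig 3)) + - (8%:R * (sig 3 * sig 1)))
    = 30%:R * fpsder (sig 3) - 21%:R * sig 5 - 10%:R * sig 3 + sig 1.
  have -> : - (8%:R * (sig 1 * sig 3)) + - (8%:R * (sig 3 * sig 1))
      = conv2 (fun a b => (a%:R - b%:R) ^+ (2 * 2) - (a%:R + b%:R) ^+ (2 * 2)).
    by conv2_identity; ring.
  rewrite liouville1_pow //; lam_identity.
  by rewrite ?natrM power_sum4 -!natr1; field.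
by apply: (lin1 (c := -1) e); ring.
Qed.

(** The weighted identity with exponent 4 yields 2 a b^5 + 12 a^3 b^3 - 2 a^5 b: the two products
    with [sig 1] cancel by commutativity, and with them every quasimodular term. The same happens
    for the exponents 6, 8 and 10 below. *)
Lemma sig_sqr3 :
  120%:R * sig 3 ^+ 2 = sig 7 - sig 3.
Proof.
have e : 10%:R * (2%:R * (sig 1 * sig 5) + 12%:R * (sig 3 * sig 3) + - (2%:R * (sig 5 * sig 1)))
    = sig 7 - sig 3.
  have -> : 2%:R * (sig 1 * sig 5) + 12%:R * (sig 3 * sig 3) + - (2%:R * (sig 5 * sig 1))
      = conv2 (fun a b =>
      a%:R * b%:R * ((a%:R - b%:R) ^+ (2 * 2) + (a%:R + b%:R) ^+ (2 * 2))
      - 4%:R * (a%:R * b%:R * a%:R ^+ (2 * 2))).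
    by conv2_identity; ring.
  rewrite liouville2_pow //; lam_identity.
  by rewrite ?natrM power_sum1 power_sum2 power_sum4 power_sum5 -!natr1; field.
by apply: (lin1 (c := 1) e); ring.
Qed.

Lemma sig3M5 :
  5040%:R * (sig 3 * sig 5) = 11%:R * sig 9 - 21%:R * sig 5 + 10%:R * sig 3.
Proof.
have e : 84%:R * (2%:R * (sig 1 * sig 7) + 30%:R * (sig 3 * sig 5) + 30%:R * (sig 5 * sig 3) + - (2%:R * (sig 7 * sig 1)))
    = 11%:R * sig 9 - 21%:R * sig 5 + 10%:R * sig 3.
  have -> : 2%:R * (sig 1 * sig 7) + 30%:R * (sig 3 * sig 5) + 30%:R * (sig 5 * sig 3) + - (2%:R * (sig 7 * sig 1))
      = conv2 (fun a b =>
      a%:R * b%:R * ((a%:R - b%:R) ^+ (2 * 3) + (a%:R + b%:R) ^+ (2 * 3))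
      - 4%:R * (a%:R * b%:R * a%:R ^+ (2 * 3))).
    by conv2_identity; ring.
  rewrite liouville2_pow //; lam_identity.
  by rewrite ?natrM power_sum1 power_sum2 power_sum6 power_sum7 -!natr1; field.
by apply: (lin1 (c := 1) e); ring.
Qed.

Lemma sig_weight12 :
  10080%:R * (sig 3 * sig 7) + 12600%:R * sig 5 ^+ 2
  = 13%:R * sig 11 - 42%:R * sig 7 + 50%:R * sig 5 - 21%:R * sig 3.
Proof.
have e : 90%:R * (2%:R * (sig 1 * sig 9) + 56%:R * (sig 3 * sig 7) + 140%:R * (sig 5 * sig 5) + 56%:R * (sig 7 * sig 3) + - (2%:R * (sig 9 * sig 1)))
    = 13%:R * sig 11 - 42%:R * sig 7 + 50%:R * sig 5 - 21%:R * sig 3.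
  have -> : 2%:R * (sig 1 * sig 9) + 56%:R * (sig 3 * sig 7) + 140%:R * (sig 5 * sig 5) + 56%:R * (sig 7 * sig 3) + - (2%:R * (sig 9 * sig 1))
      = conv2 (fun a b =>
      a%:R * b%:R * ((a%:R - b%:R) ^+ (2 * 4) + (a%:R + b%:R) ^+ (2 * 4))
      - 4%:R * (a%:R * b%:R * a%:R ^+ (2 * 4))).
    by conv2_identity; ring.
  rewrite liouville2_pow //; lam_identity.
  by rewrite ?natrM power_sum1 power_sum2 power_sum8 power_sum9 -!natr1; field.
by apply: (lin1 (c := 1) e); ring.
Qed.

Lemma sig_weight14 :
  23760%:R * (sig 3 * sig 9) + 110880%:R * (sig 5 * sig 7)
  = 20%:R * sig 13 - 99%:R * sig 9 + 220%:R * sig 7 - 231%:R * sig 5 + 90%:R * sig 3.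
Proof.
have e : 132%:R * (2%:R * (sig 1 * sig 11) + 90%:R * (sig 3 * sig 9) + 420%:R * (sig 5 * sig 7) + 420%:R * (sig 7 * sig 5) + 90%:R * (sig 9 * sig 3) + - (2%:R * (sig 11 * sig 1)))
    = 20%:R * sig 13 - 99%:R * sig 9 + 220%:R * sig 7 - 231%:R * sig 5 + 90%:R * sig 3.
  have -> : 2%:R * (sig 1 * sig 11) + 90%:R * (sig 3 * sig 9) + 420%:R * (sig 5 * sig 7) + 420%:R * (sig 7 * sig 5) + 90%:R * (sig 9 * sig 3) + - (2%:R * (sig 11 * sig 1))
      = conv2 (fun a b =>
      a%:R * b%:R * ((a%:R - b%:R) ^+ (2 * 5) + (a%:R + b%:R) ^+ (2 * 5))
      - 4%:R * (a%:R * b%:R * a%:R ^+ (2 * 5))).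
    by conv2_identity; ring.
  rewrite liouville2_pow //; lam_identity.
  by rewrite ?natrM power_sum1 power_sum2 power_sum10 power_sum11 -!natr1; field.
by apply: (lin1 (c := 1) e); ring.
Qed.

End Eisenstein.

(** * The cubic character *)

Section Cubic.
Variable K : numFieldType.

(* 2 sin (2 pi d / 3) / sqrt 3 and 2 cos (2 pi d / 3) *)
Definition chi3 (d : nat) : K := nth 0 [:: 0; 1; -1] (d %% 3).
Definition cos3 (d : nat) : K := nth 0 [:: 2%:R; -1; -1] (d %% 3).

Lemma mod3_cases d : [\/ d %% 3 = 0 /\ d.+1 %% 3 = 1, d %% 3 = 1 /\ d.+1 %% 3 = 2
  | d %% 3 = 2 /\ d.+1 %% 3 = 0]%N.
Proof.
rewrite -(addn1 d) -modnDml; have := ltn_pmod d (isT : 0 < 3)%N.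
by case: (d %% 3)%N => [|[|[|]]] // _; [apply: Or31 | apply: Or32 | apply: Or33].
Qed.

Lemma chi3D a b : chi3 (a + b) = (chi3 a * cos3 b + cos3 a * chi3 b) / 2%:R.
Proof.
rewrite /chi3 /cos3 -modnDm.
by case: (mod3_cases a) => -[-> _]; case: (mod3_cases b) => -[-> _] /=; field.
Qed.

Lemma cos3D a b : cos3 (a + b) = (cos3 a * cos3 b - 3%:R * (chi3 a * chi3 b)) / 2%:R.
Proof.
rewrite /chi3 /cos3 -modnDm.
by case: (mod3_cases a) => -[-> _]; case: (mod3_cases b) => -[-> _] /=; field.
Qed.

Lemma cos3_chi3_sqr a : cos3 a ^+ 2 + 3%:R * chi3 a ^+ 2 = 4%:R.
Proof. by rewrite /chi3 /cos3; case: (mod3_cases a) => -[-> _] /=; ring. Qed.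

(** Liouville's identities require even functions of a - b. As [chi3] is odd, it is paired with an
    odd power, here the first. *)
Lemma chi3_absdiff a b : (a - b + (b - a))%N%:R * chi3 (a - b + (b - a))%N
  = (a%:R - b%:R) * (chi3 a * cos3 b - cos3 a * chi3 b) / 2%:R.
Proof.
wlog le_ba : a b / (b <= a)%N.
  move=> H; case: (leqP b a) => [|/ltnW] le; first exact: H.
  by rewrite addnC H //; ring.
rewrite (eqP (le_ba : (_ - _ == 0)%N)) addn0.
have [c ->] : exists c, a = (c + b)%N by exists (a - b)%N; rewrite subnK.
rewrite addnK natrD chi3D cos3D.
have := cos3_chi3_sqr b; move: (chi3 c) (cos3 c) (chi3 b) (cos3 b) => x y z t e.
(* After the substitution a = c + b the two sides differ by the factor (t^2 + 3 z^2) / 4, which is 1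
   because [cos3] and [chi3] are a scaled cosine and sine. *)
transitivity (c%:R * (x * (t ^+ 2 + 3%:R * z ^+ 2) / 4%:R)); first by rewrite e; field.
by field.
Qed.

Lemma cos3_absdiff a b :
  cos3 (a - b + (b - a))%N = (cos3 a * cos3 b + 3%:R * (chi3 a * chi3 b)) / 2%:R.
Proof.
wlog le_ba : a b / (b <= a)%N.
  move=> H; case: (leqP b a) => [|/ltnW] le; first exact: H.
  by rewrite addnC H //; ring.
rewrite (eqP (le_ba : (_ - _ == 0)%N)) addn0.
have [c ->] : exists c, a = (c + b)%N by exists (a - b)%N; rewrite subnK.
rewrite addnK chi3D cos3D.
have := cos3_chi3_sqr b; move: (chi3 c) (cos3 c) (chi3 b) (cos3 b) => x y z t e.
transitivity (y * (t ^+ 2 + 3%:R * z ^+ 2) / 4%:R); first by rewrite e; field.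
by field.
Qed.

(** The sums are polynomials in d on each residue class mod 3. They are expressed through the values
    at d.+1 because the summand of a Lambert series at d.+1 contains a sum over a < d.+1. *)
Ltac cubic_sum :=
  let d := fresh "d" in let IHd := fresh "IHd" in
  elim=> [|d IHd]; [by rewrite big_geq //= /chi3 /cos3 /=; field
    | rewrite big_nat_recr //= IHd /chi3 /cos3 -![_.+2%:R]natr1;
      by case: (mod3_cases d.+1) => -[-> ->] /=; field].

Lemma sum_cos3 d : \sum_(1 <= a < d.+1) cos3 a = (chi3 d.+1 - cos3 d.+1 - 2%:R) / 2%:R.
Proof. move: d; cubic_sum. Qed.

Lemma sum_id_cos3 d : \sum_(1 <= a < d.+1) a%:R * cos3 a
  = (2%:R * cos3 d.+1 - 4%:R + 3%:R * d.+1%:R * (chi3 d.+1 - cos3 d.+1)) / 6%:R.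
Proof. move: d; cubic_sum. Qed.

Lemma sum_id_chi3 d : \sum_(1 <= a < d.+1) a%:R * chi3 a
  = (2%:R * chi3 d.+1 - d.+1%:R * cos3 d.+1 - 3%:R * d.+1%:R * chi3 d.+1) / 6%:R.
Proof. move: d; cubic_sum. Qed.

Lemma sum_sqr_chi3 d : \sum_(1 <= a < d.+1) a%:R ^+ 2 * chi3 a
  = (2%:R * cos3 d.+1 - 4%:R + 12%:R * d.+1%:R * chi3 d.+1
     - 3%:R * d.+1%:R ^+ 2 * cos3 d.+1 - 9%:R * d.+1%:R ^+ 2 * chi3 d.+1) / 18%:R.
Proof. move: d; cubic_sum. Qed.

Lemma sum_cube_chi3 d : \sum_(1 <= a < d.+1) a%:R ^+ 3 * chi3 a
  = (2%:R * d.+1%:R * cos3 d.+1 - 2%:R * chi3 d.+1 + 6%:R * d.+1%:R ^+ 2 * chi3 d.+1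
     - d.+1%:R ^+ 3 * cos3 d.+1 - 3%:R * d.+1%:R ^+ 3 * chi3 d.+1) / 6%:R.
Proof. move: d; cubic_sum. Qed.

End Cubic.

(** * Liouville's identities with trigonometric functions of period 3 *)

Section Level3.
Variable K : numFieldType.
Local Notation chi3 := (@chi3 K).
Local Notation cos3 := (@cos3 K).
Local Notation sig := (@sig K).
Local Notation sig' k := (dilate 3 (sig k)).

Definition lchi k : fps K := lambert (fun d => d%:R ^+ k * chi3 d).
Definition lcos k : fps K := lambert (fun d => d%:R ^+ k * cos3 d).

Lemma cos3_0 : cos3 0 = 2%:R. Proof. by []. Qed.
Lemma chi3_0 : chi3 0 = 0. Proof. by []. Qed.

Lemma cos3_dvd d : (cos3 d + 1) / 3%:R = (3 %| d)%N%:R.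
Proof. by rewrite /cos3 /dvdn; case: (mod3_cases d) => -[-> _] /=; field. Qed.

(** The condition 3 | d is detected by ([cos3] d + 1) / 3, which puts dilated series in the same
    form as those twisted by [cos3]. *)
Lemma dilate_sigE k :
  sig' k = lam (fun d _ => (cos3 d + 1) / 3%:R * (d%:R / 3%:R) ^+ k).
Proof.
rewrite dilate_lam //; apply: eq_lam => d e _ _; rewrite cos3_dvd.
case: ifP => [d3|_]; last by rewrite mul0r.
by rewrite -[in RHS](divnK d3) natrM mulfK ?mul1r // pnatr_eq0.
Qed.

Lemma dilate_sig_swap k : sig' k = lam (fun d e => (cos3 d + 1) / 3%:R * e%:R ^+ k).
Proof.
rewrite /sig /lambert lam_swap dilate_lam //; apply: eq_lam => d e _ _; rewrite cos3_dvd.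
by case: ifP => _; rewrite ?mul1r ?mul0r.
Qed.

Lemma lcos1 : lcos 1 = 9%:R * sig' 1 - sig 1.
Proof.
apply: lam_ext; [reflexivity | rewrite dilate_sigE; to_lam | move=> d e; cbv beta].
by field.
Qed.

Lemma lcos3 : lcos 3 = 81%:R * sig' 3 - sig 3.
Proof.
apply: lam_ext; [reflexivity | rewrite dilate_sigE; to_lam | move=> d e; cbv beta].
by field.
Qed.

(** The unweighted identity for f = [cos3]: the difference of two cosines is a product of sines. *)
Lemma lchi0_sqr : 3%:R * lchi 0 ^+ 2 = sig 1 - 3%:R * sig' 1 - lchi 0.
Proof.
have e : 3%:R * (lchi 0 * lchi 0) = 6%:R * sig' 1 - lcos 1 - lchi 0.
  have -> : 3%:R * (lchi 0 * lchi 0) = conv2 (fun a b =>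
      cos3 (a - b + (b - a))%N - cos3 (a + b)%N).
    by conv2_identity; rewrite cos3_absdiff cos3D; field.
  rewrite liouville1 dilate_sig_swap; lam_identity.
  by rewrite sum_cos3 ![_.+1.-1]/= cos3_0 -?[d.+1%:R]natr1 -?[e.+1%:R]natr1; field.
by apply: (lin1 (c := 1) e); rewrite lcos1; ring.
Qed.

(** The weighted identity for f = [cos3]: the sum of two cosines is a product of cosines. Since
    [cos3 0] is 2 and not 0, a derivative of [sig 1] remains. *)
Lemma lcos1_sqr :
  6%:R * lcos 1 ^+ 2 - 24%:R * (lcos 1 * sig 1)
  = 12%:R * fpsder (sig 1) - 8%:R * sig 1 + 3%:R * lcos 1 + lcos 3.
Proof.
have e : 6%:R * (lcos 1 * lcos 1 - 4%:R * (lcos 1 * sig 1))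
    = 12%:R * fpsder (sig 1) - 8%:R * sig 1 + 3%:R * lcos 1 + lcos 3.
  have -> : lcos 1 * lcos 1 - 4%:R * (lcos 1 * sig 1) = conv2 (fun a b =>
      a%:R * b%:R * (cos3 (a - b + (b - a))%N + cos3 (a + b)%N)
      - 4%:R * (a%:R * b%:R * cos3 a)).
    by conv2_identity; rewrite cos3_absdiff cos3D; field.
  rewrite liouville2; lam_identity.
  rewrite natrM.
  have -> : \sum_(1 <= a < d.+1) a%:R * (d.+1%:R - a%:R)
      = d.+1%:R * (\sum_(1 <= a < d.+1) a%:R ^+ 1) - \sum_(1 <= a < d.+1) a%:R ^+ 2 :> K.
    by rewrite mulr_sumr -sumrB; apply: eq_bigr => a _; ring.
  have -> : \sum_(1 <= a < d.+1) (d.+1%:R - a%:R) * cos3 a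
      = d.+1%:R * (\sum_(1 <= a < d.+1) cos3 a) - \sum_(1 <= a < d.+1) a%:R * cos3 a.
    by rewrite mulr_sumr -sumrB; apply: eq_bigr => a _; ring.
  rewrite power_sum1 power_sum2 sum_cos3 sum_id_cos3.
  by rewrite ![_.+1.-1]/= cos3_0 -?[d.+1%:R]natr1 -?[e.+1%:R]natr1; field.
by rewrite -e; ring.
Qed.

(** The unweighted identity for the even function k [chi3] k. *)
Lemma lcos1_lchi0 :
  3%:R * lchi 2 = 6%:R * fpsder (lchi 0) - 2%:R * lchi 0 + lcos 1
                  + 6%:R * (lcos 1 * lchi 0).
Proof.
have e : 3%:R * (- (lcos 1 * lchi 0) - lchi 0 * lcos 1)
    = 6%:R * fpsder (lchi 0) - 2%:R * lchi 0 + lcos 1 - 3%:R * lchi 2.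
  have -> : - (lcos 1 * lchi 0) - lchi 0 * lcos 1 = conv2 (fun a b =>
      (a - b + (b - a))%N%:R * chi3 (a - b + (b - a))%N - (a + b)%N%:R * chi3 (a + b)%N).
    by conv2_identity; rewrite chi3_absdiff chi3D natrD; field.
  rewrite (liouville1 (fun k => k%:R * chi3 k)); lam_identity.
  rewrite natrM sum_id_chi3.
  by rewrite ![_.+1.-1]/= chi3_0 -?[d.+1%:R]natr1 -?[e.+1%:R]natr1; field.
by apply: (lin1 (c := 1) e); ring.
Qed.

(** The unweighted identity for k^3 [chi3] k. Its term in [lchi 4] has weight 5 and is eliminated
    with the help of [lchi2_sig]. *)
Lemma lchi2_lcos :
  - 6%:R * (lcos 3 * lchi 0 + 3%:R * (lcos 1 * lchi 2))
  = 6%:R * fpsder (lchi 2) + 2%:R * lchi 0 - 2%:R * lcos 1 - 6%:R * lchi 2 + lcos 3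
    - 3%:R * lchi 4.
Proof.
have e : 3%:R * (- (lcos 3 * lchi 0) - 3%:R * (lcos 1 * lchi 2)
                 - lchi 0 * lcos 3 - 3%:R * (lchi 2 * lcos 1))
    = 6%:R * fpsder (lchi 2) + 2%:R * lchi 0 - 2%:R * lcos 1 - 6%:R * lchi 2 + lcos 3
    - 3%:R * lchi 4.
  have -> : - (lcos 3 * lchi 0) - 3%:R * (lcos 1 * lchi 2)
            - lchi 0 * lcos 3 - 3%:R * (lchi 2 * lcos 1) = conv2 (fun a b =>
      (a - b + (b - a))%N%:R ^+ (2 * 1) *
        ((a - b + (b - a))%N%:R * chi3 (a - b + (b - a))%N)
      - (a + b)%N%:R ^+ (2 * 1) * ((a + b)%N%:R * chi3 (a + b)%N)).
    by conv2_identity; rewrite absdiffX_even chi3_absdiff chi3D natrD; field.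
  rewrite (liouville1 (fun k => k%:R ^+ (2 * 1) * (k%:R * chi3 k))); lam_identity.
  have -> : \sum_(1 <= a < d.+1) a%:R ^+ (2 * 1) * (a%:R * chi3 a)
      = \sum_(1 <= a < d.+1) a%:R ^+ 3 * chi3 a.
    by apply: eq_bigr => a _; ring.
  rewrite natrM sum_cube_chi3.
  by rewrite ![_.+1.-1]/= chi3_0 -?[d.+1%:R]natr1 -?[e.+1%:R]natr1; field.
by rewrite -e; ring.
Qed.

(** The weighted identity for k [chi3] k, which supplies a second equation containing [lchi 4]. *)
Lemma lchi2_sig :
  36%:R * (lchi 2 * lcos 1) - 72%:R * (lchi 2 * sig 1)
  = - 8%:R * sig 1 + 4%:R * lcos 1 + 9%:R * lchi 2 + 3%:R * lchi 4.
Proof.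
have e : 18%:R * (lchi 2 * lcos 1 + lcos 1 * lchi 2 - 4%:R * (lchi 2 * sig 1))
    = - (8%:R * sig 1) + 4%:R * lcos 1 + 9%:R * lchi 2 + 3%:R * lchi 4.
  have -> : lchi 2 * lcos 1 + lcos 1 * lchi 2 - 4%:R * (lchi 2 * sig 1) = conv2 (fun a b =>
      a%:R * b%:R * ((a - b + (b - a))%N%:R * chi3 (a - b + (b - a))%N
                     + (a + b)%N%:R * chi3 (a + b)%N)
      - 4%:R * (a%:R * b%:R * (a%:R * chi3 a))).
    by conv2_identity; rewrite chi3_absdiff chi3D natrD; field.
  rewrite (liouville2 (fun k => k%:R * chi3 k)); lam_identity.
  have -> : \sum_(1 <= a < d.+1) a%:R * (d.+1%:R - a%:R)
      = d.+1%:R * (\sum_(1 <= a < d.+1) a%:R ^+ 1) - \sum_(1 <= a < d.+1) a%:R ^+ 2 :> K.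
    by rewrite mulr_sumr -sumrB; apply: eq_bigr => a _; ring.
  have -> : \sum_(1 <= a < d.+1) (d.+1%:R - a%:R) * (a%:R * chi3 a)
      = d.+1%:R * (\sum_(1 <= a < d.+1) a%:R * chi3 a)
        - \sum_(1 <= a < d.+1) a%:R ^+ 2 * chi3 a.
    by rewrite mulr_sumr -sumrB; apply: eq_bigr => a _; ring.
  rewrite power_sum1 power_sum2 sum_id_chi3 sum_sqr_chi3.
  by rewrite ![_.+1.-1]/= chi3_0 -?[d.+1%:R]natr1 -?[e.+1%:R]natr1; field.
by rewrite mulNr -e; ring.
Qed.

End Level3.

(** * The Borweins' cubic functions *)

Section Borwein.
Variable K : numFieldType.
Local Notation sig := (@sig K).
Local Notation sig' k := (dilate 3 (sig k)).

Definition eisP : fps K := 1 - 24%:R * sig 1.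
Definition eisQ : fps K := 1 + 240%:R * sig 3.
Definition eisR : fps K := 1 - 504%:R * sig 5.
(* In the Borweins' notation: a, b^3 and c^3. *)
Definition borA : fps K := 1 + 6%:R * lchi K 0.
Definition borB : fps K := 1 - 9%:R * lchi K 2.
Definition borC : fps K := borA ^+ 3 - borB.

Local Notation P := eisP.
Local Notation Q := eisQ.
Local Notation R := eisR.
Local Notation P3 := (dilate 3 eisP).
Local Notation Q3 := (dilate 3 eisQ).
Local Notation R3 := (dilate 3 eisR).
Local Notation A := borA.
Local Notation B := borB.
Local Notation C := borC.

Lemma dilate_eisP : P3 = 1 - 24%:R * sig' 1.
Proof. by rewrite /P raddfB /= dilate1 // dilate_natM. Qed.

Lemma dilate_eisQ : Q3 = 1 + 240%:R * sig' 3.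
Proof. by rewrite /Q raddfD /= dilate1 // dilate_natM. Qed.

Lemma der_eisQ : 3%:R * fpsder Q = P * Q - R.
Proof.
rewrite /Q raddfD /= fpsder1 fpsder_natM.
by apply: (lin1 (c := 24%:R) (sig1M3 K)); rewrite /R /P; ring.
Qed.

Lemma eis8 : 1 + 480%:R * sig 7 = Q ^+ 2.
Proof. by apply: (lin1 (c := - 480%:R) (sig_sqr3 K)); rewrite /Q; ring. Qed.

Lemma eis10 : 1 - 264%:R * sig 9 = Q * R.
Proof. by apply: (lin1 (c := 24%:R) (sig3M5 K)); rewrite /Q /R; ring. Qed.

Lemma eis12 : 691%:R + 65520%:R * sig 11 = 441%:R * Q ^+ 3 + 250%:R * R ^+ 2.
Proof.
apply: (@fps_nat_cancel _ 12).
apply: (lin2 (c := - 65520%:R) (c' := 5733%:R * Q) (sig_weight12 K) eis8).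
by rewrite /Q /R; ring.
Qed.

Lemma eis14 : 1 - 24%:R * sig 13 = Q ^+ 2 * R.
Proof.
apply: (@fps_nat_cancel _ 19).
apply: (lin3 (c := 24%:R) (c' := 11%:R * R) (c'' := 9%:R * Q) (sig_weight14 K) eis8 eis10).
by rewrite /Q /R; ring.
Qed.

Lemma borA_sqr : A ^+ 2 = 1 + 12%:R * sig 1 - 36%:R * sig' 1.
Proof. by apply: (lin1 (c := 12%:R) (lchi0_sqr K)); rewrite /A; ring. Qed.

Lemma borA_sqr_eisP : 3%:R * P3 = P + 2%:R * A ^+ 2.
Proof. by rewrite borA_sqr dilate_eisP /P; ring. Qed.

Lemma sig_sqr1' : 12%:R * sig' 1 ^+ 2 = 5%:R * sig' 3 + sig' 1 - 6%:R * dilate 3 (fpsder (sig 1)).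
Proof.
have := congr1 (dilate 3) (sig_sqr1 K).
by rewrite raddfB raddfD /= !dilate_natM // dilateX.
Qed.

(** The square of A^2 involves [sig 1] and its dilation quadratically; [lcos1_sqr] and [sig_sqr1]
    are combined so that the derivatives of [sig 1] cancel. *)
Lemma borA_pow4 : 10%:R * A ^+ 4 = Q + 9%:R * Q3.
Proof.
apply: (@fps_nat_cancel _ 2).
have -> : A ^+ 4 = (1 + 12%:R * sig 1 - 36%:R * sig' 1) ^+ 2 by rewrite -borA_sqr -exprM.
apply: (lin2 (c := 80%:R) (c' := 160%:R) (lcos1_sqr K) (sig_sqr1 K)).
by rewrite dilate_eisQ /Q lcos1 lcos3; ring.
Qed.

(** A level 3 analogue of Ramanujan's equations. With B = A^3 - C it reads 12 A' = A P - A^3 + 4 C,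
    where A' is q dA/dq; this is the form used for [eisRE]. *)
Lemma der_borA : 12%:R * fpsder A = A * P + 3%:R * A ^+ 3 - 4%:R * B.
Proof.
have -> : A ^+ 3 = A * A ^+ 2 by ring.
rewrite borA_sqr {1}/A raddfD /= fpsder1 fpsder_natM.
by apply: (lin1 (c := -12%:R) (lcos1_lchi0 K)); rewrite /P /A /B lcos1; ring.
Qed.

(** The product A A' is computed twice: by differentiating A^2, a combination of [sig 1] and its
    dilation, and by multiplying by A the equation that expresses A' through B. The derivatives of
    [sig 1] and of its dilation are then removed with [sig_sqr1]. *)
Lemma borAB : 8%:R * A * B = 9%:R * A ^+ 4 - Q.
Proof.
have dA : 12%:R * A * fpsder (lchi K 0)
    = 12%:R * fpsder (sig 1) - 108%:R * dilate 3 (fpsder (sig 1)).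
  have e := congr1 (@fpsder K) borA_sqr.
  have dA : fpsder A = 6%:R * fpsder (lchi K 0).
    by rewrite /A raddfD /= fpsder1 fpsder_natM add0r.
  rewrite fpsderX expr1 dA raddfB raddfD /= fpsder1 !fpsder_natM dilate_der in e.
  by apply: (lin1 (c := 1) e); ring.
have h : 8%:R * A * B = 8%:R * A ^+ 2 - 24%:R * A ^+ 2 * lcos K 1
    - 144%:R * fpsder (sig 1) + 1296%:R * dilate 3 (fpsder (sig 1)).
  apply: (lin2 (c := - 24%:R * A) (c' := - 12%:R) (lcos1_lchi0 K) dA).
  by rewrite /B /A; ring.
have {}h : 8%:R * A * B = 8%:R * A ^+ 2 - 24%:R * A ^+ 2 * lcos K 1
    - 24%:R * (5%:R * sig 3 + sig 1 - 12%:R * sig 1 ^+ 2)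
    + 216%:R * (5%:R * sig' 3 + sig' 1 - 12%:R * sig' 1 ^+ 2).
  by apply: (lin3 (c := 1) (c' := - 24%:R) (c'' := 216%:R) h (sig_sqr1 K) sig_sqr1'); ring.
have h4 := borA_pow4; have e4 : A ^+ 4 = (A ^+ 2) ^+ 2 by rewrite -exprM.
rewrite e4 borA_sqr in h4 *; rewrite borA_sqr in h; apply: (@fps_nat_cancel _ 1).
apply: (lin2 (c := 2%:R) (c' := - 1) h h4).
by rewrite dilate_eisQ /Q lcos1; ring.
Qed.

Lemma der_borB : 4%:R * fpsder B = B * (P - A ^+ 2).
Proof.
(* By [lcos3], 80 (1 + 3 lcos 3) = 81 Q3 - Q, and the preceding identities turn this into 90 A^4 -
   10 Q = 80 A B. *)
have Y3 : 3%:R * lcos K 3 = A * B - 1.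
  apply: (@fps_nat_cancel _ 79).
  apply: (lin2 (c := - 10%:R) (c' := - 9%:R) borAB borA_pow4).
  by rewrite lcos3 dilate_eisQ /Q; ring.
rewrite {1}/B raddfB /= fpsder1 fpsder_natM.
(* The two equations are added with equal coefficients, so that [lchi 4] disappears. *)
have h : - 36%:R * fpsder (lchi K 2) = 36%:R * lcos K 3 * lchi K 0 + 6%:R * lcos K 3
    + 12%:R * lchi K 0 + 12%:R * lcos K 1 - 48%:R * sig 1
    + lchi K 2 * (18%:R - 108%:R * lcos K 1 + 432%:R * sig 1).
  by apply: (lin2 (c := 6%:R) (c' := 6%:R) (lchi2_lcos K) (lchi2_sig K)); ring.
rewrite borA_sqr.
have e : A * A * B = (1 + 12%:R * sig 1 - 36%:R * sig' 1) * B.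
  by rewrite -borA_sqr expr2.
apply: (lin3 (c := 1) (c' := 2%:R * A) (c'' := 2%:R) h Y3 e).
by rewrite /B /A /P lcos1; ring.
Qed.

Lemma eisQE : Q = A ^+ 4 + 8%:R * A * C.
Proof. by apply: (lin1 (c := 1) borAB); rewrite /C; ring. Qed.

Lemma dilate_eisQE : 9%:R * Q3 = 9%:R * A ^+ 4 - 8%:R * A * C.
Proof. by apply: (lin2 (c := - 1) (c' := - 1) eisQE borA_pow4); ring. Qed.

Lemma der_borC : 4%:R * fpsder C = C * (P + 3%:R * A ^+ 2).
Proof.
rewrite {1}/C raddfB /= fpsderX.
apply: (lin2 (c := A ^+ 2) (c' := - 1) der_borA der_borB).
by rewrite /C; ring.
Qed.

(** Ramanujan's equation 3 Q' = P Q - R is compared with the derivative of Q = A^4 + 8 A C. In the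
    latter the terms in P amount to P Q, so P cancels and R becomes a polynomial in A and C. *)
Lemma eisRE : R = A ^+ 6 - 20%:R * A ^+ 3 * C - 8%:R * C ^+ 2.
Proof.
have e : fpsder Q = 4%:R * A ^+ 3 * fpsder A + 8%:R * (fpsder A * C + A * fpsder C).
  by rewrite eisQE raddfD /= fpsderX fpsderM fpsder_natM; ring.
have {}e : R = P * Q - 3%:R * (4%:R * A ^+ 3 * fpsder A
    + 8%:R * (fpsder A * C + A * fpsder C)).
  by apply: (lin2 (c := 1) (c' := - 3%:R) der_eisQ e); ring.
have dA : 12%:R * fpsder A = A * P - A ^+ 3 + 4%:R * C.
  by rewrite der_borA /C; ring.
apply: (@fps_nat_cancel _ 1); rewrite eisQE in e.
apply: (lin3 (c := 2%:R) (c' := - 2%:R * (A ^+ 3 + 2%:R * C)) (c'' := - 12%:R * A)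
  e dA der_borC).
by ring.
Qed.

(** The same computation in q^3, where the derivative of the dilated Q absorbs the factor 3 and 3 P3
    = P + 2 A^2 brings the dilated P back to P. *)
Lemma dilate_eisRE :
  27%:R * R3 = 27%:R * A ^+ 6 - 36%:R * A ^+ 3 * C + 8%:R * C ^+ 2.
Proof.
have e := congr1 (dilate 3) der_eisQ.
rewrite dilate_natM // raddfB /= dilateM // -dilate_der in e.
have {}e : 27%:R * R3 = (3%:R * P3) * (9%:R * Q3) - 27%:R * fpsder Q3.
  by apply: (lin1 (c := 27%:R) e); ring.
have e' : 9%:R * fpsder Q3
    = 36%:R * A ^+ 3 * fpsder A - 8%:R * (fpsder A * C + A * fpsder C).
  rewrite -fpsder_natM dilate_eisQE raddfB /= fpsder_natM fpsderX fpsderM fpsder_natM; ring.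
rewrite borA_sqr_eisP dilate_eisQE in e.
have dA : 12%:R * fpsder A = A * P - A ^+ 3 + 4%:R * C.
  by rewrite der_borA /C; ring.
have {}e : 27%:R * R3 = (P + 2%:R * A ^+ 2) * (9%:R * A ^+ 4 - 8%:R * A * C)
    - 3%:R * (36%:R * A ^+ 3 * fpsder A - 8%:R * (fpsder A * C + A * fpsder C)).
  by apply: (lin2 (c := 1) (c' := - 3%:R) e e'); ring.
apply: (lin3 (c := 1) (c' := - (9%:R * A ^+ 3 - 2%:R * C)) (c'' := 6%:R * A) e dA der_borC).
by ring.
Qed.

End Borwein.

(** * Eta quotients *)

Lemma sum_divisors (V : nmodType) (F : nat -> V) m N : (0 < m)%N -> (m <= N)%N ->
  \sum_(d <- divisors m) F d = \sum_(1 <= d < N.+1 | (d %| m)%N) F d.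
Proof.
move=> m_gt0 le_mN; rewrite -[RHS]big_filter; apply: perm_big; apply: uniq_perm.
- exact: divisors_uniq.
- exact/filter_uniq/iota_uniq.
move=> d; rewrite mem_filter mem_index_iota -dvdn_divisors // ltnS.
case: (boolP (d %| m)%N) => //= dm.
by rewrite (dvdn_gt0 m_gt0 dm) (leq_trans (dvdn_leq m_gt0 dm)).
Qed.

Section Truncation.
Variable K : comNzRingType.
Implicit Types f g h : fps K.

Definition eqt N f g := forall n, (n < N)%N -> f n = g n.

Lemma eqtM N f f' g g' : eqt N f f' -> eqt N g g' -> eqt N (f * g) (f' * g').
Proof.
move=> ef eg n lt_nN; rewrite !coefsM; apply: eq_bigr => i _.
rewrite ef ?eg //; first by apply: leq_ltn_trans lt_nN; rewrite leq_subr.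
by apply: leq_trans lt_nN; rewrite ltn_ord.
Qed.

Lemma coefs_expr_small f n k : f 0%N = 0 -> (n < k)%N -> (f ^+ k) n = 0.
Proof.
move=> f0; elim: k n => [//|k IHk] n lt_nk; rewrite exprS coefsM big1 // => i _.
case: (posnP i) => [->|i0]; first by rewrite f0 mul0r.
by rewrite IHk ?mulr0 //; have := ltn_ord i; lia.
Qed.

(** The geometric series in 1 - f; for f 0 = 1, powers beyond the n-th do not reach q^n. *)
Definition fpsinv f : fps K := Fps (fun n => (\sum_(k < n.+1) (1 - f) ^+ k) n).

Lemma fpsmulV f : f 0%N = 1 -> f * fpsinv f = 1.
Proof.
move=> f0; apply: fpsP => n.
have e : eqt n.+1 (fpsinv f) (\sum_(k < n.+1) (1 - f) ^+ k).
  move=> m lt_mn; rewrite /fpsinv /= !coefs_sum.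
  rewrite (big_ord_widen n.+1 (fun k => ((1 - f) ^+ k) m)) // big_mkcond /=.
  apply: eq_bigr => i _; case: ltnP => // le_mi.
  by rewrite coefs_expr_small // coefsB f0 subrr.
rewrite (@eqtM n.+1 _ f _ _ (fun _ _ => erefl) e) //.
have -> : f * (\sum_(k < n.+1) (1 - f) ^+ k) = 1 - (1 - f) ^+ n.+1.
  by rewrite -[RHS]opprB subrX1 -mulNr; congr (_ * _); ring.
by rewrite coefsB coefs_expr_small ?subr0 // coefsB f0 subrr.
Qed.

End Truncation.

(** * Euler's product and linear differential equations *)

Section Euler.
Variable K : numFieldType.
Implicit Types f g h u v : fps K.
Local Notation sig := (@sig K).

Definition euler_part N : fps K := \prod_(1 <= i < N.+1) (1 - fpsX ^+ i).
(** A diagonal definition: the n-th coefficient of the partial products is stationary from the n-th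
    product on, which spares a formal limit. *)
Definition euler : fps K := Fps (fun n => euler_part n n).

Lemma euler_partS N : euler_part N.+1 = euler_part N * (1 - fpsX ^+ N.+1).
Proof. by rewrite /euler_part big_nat_recr. Qed.

Lemma euler_part_eqt N : eqt N.+1 euler (euler_part N).
Proof.
move=> n; rewrite ltnS /= => le_nN; rewrite -(subnKC le_nN).
elim: (N - n)%N => [|k IHk]; first by rewrite addn0.
rewrite addnS euler_partS mulrBr mulr1 coefsB mulrC coefs_XnM -IHk.
by rewrite leqNgt ltnS leq_addr subr0.
Qed.

(** The expansion of i q^i / (1 - q^i), minus the logarithmic derivative of 1 - q^i; over all i
    these add up to [sig 1]. *)
Definition multiples i : fps K :=
  Fps (fun n => if (0 < n)%N && (i %| n)%N then i%:R else 0).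

Lemma multiplesE i : (0 < i)%N -> (1 - fpsX ^+ i) * multiples i = i%:R * fpsX ^+ i.
Proof.
move=> i0; apply: fpsP => n; rewrite mulrBl mul1r coefsB coefs_XnM coefs_natM coefs_Xn /=.
case: (ltngtP n i) => [lt_ni|lt_in|->].
- rewrite subr0 mulr0; case: posnP => //= n0; case: ifP => // /(dvdn_leq n0).
  by rewrite leqNgt lt_ni.
- rewrite (leq_ltn_trans _ lt_in) //= subn_gt0 lt_in /= mulr0.
  by rewrite dvdn_subl ?dvdnn ?subrr // ltnW.
- by rewrite i0 dvdnn subnn subr0 mulr1.
Qed.

Lemma fpsder_Xn k : fpsder (fpsX ^+ k) = k%:R * fpsX ^+ k :> fps K.
Proof.
apply: fpsP => n; rewrite coefs_natM coefs_der !coefs_Xn.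
by case: eqP => [->|]; rewrite ?mulr0.
Qed.

Lemma der_euler_part N :
  fpsder (euler_part N) = - (euler_part N * \sum_(1 <= i < N.+1) multiples i).
Proof.
elim: N => [|N IHN].
  by rewrite /euler_part !big_geq // fpsder1 mulr0 oppr0.
rewrite big_nat_recr //= euler_partS fpsderM IHN raddfB /= fpsder1 fpsder_Xn.
have := multiplesE (ltn0Sn N).
move: (fpsX ^+ _) (N.+1%:R : fps K) (multiples _) (bigop _ _ _) => x c m s e.
by apply: (lin1 (c := euler_part N) e); ring.
Qed.

Lemma der_euler : fpsder euler = - (euler * sig 1).
Proof.
apply: fpsP => n; rewrite coefs_der [euler n]/(euler_part n n) -coefs_der.
rewrite der_euler_part !coefsN; congr (- _).
apply: (@eqtM _ n.+1) => // i; first by move=> lt_in; rewrite (euler_part_eqt lt_in).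
rewrite ltnS coefs_sum /= => le_in; case: posnP => [->|i0] /=; first by rewrite big1.
rewrite (sum_divisors _ i0 le_in) big_mkcond [RHS]big_mkcond /=.
by apply: eq_bigr => d _; case: ifP.
Qed.

Lemma euler0 : euler 0%N = 1.
Proof. by rewrite /= /euler_part big_geq. Qed.

Lemma euler1 : euler 1%N = -1.
Proof. by rewrite /= /euler_part big_nat1 coefsB coefs_Xn /= sub0r. Qed.

Definition fps_eta m : fps K := dilate m euler.

Lemma coefs_eta0 m : fps_eta m 0%N = 1.
Proof. by rewrite coefs_dilate dvdn0 div0n euler0. Qed.

Lemma der_eta m : (0 < m)%N -> fpsder (fps_eta m) = - (m%:R * fps_eta m * dilate m (sig 1)).
Proof.
by move=> m0; rewrite dilate_der der_euler raddfN /= dilateM // mulrN mulrA.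
Qed.

Lemma coefsM1 f g : (f * g) 1%N = f 0%N * g 1%N + f 1%N * g 0%N.
Proof. by rewrite coefsM big_ord_recl big_ord1. Qed.

Lemma coefsX1 f k : f 0%N = 1 -> (f ^+ k) 1%N = k%:R * f 1%N.
Proof.
move=> f0; elim: k => [|k IHk]; first by rewrite mul0r.
by rewrite exprS coefsM1 IHk coefsX0 f0 expr1n mulr1 mul1r -natr1 mulrDl mul1r.
Qed.

(* At q^n the equation reads c.+1 (n - k) f_n = (terms in f_0, ..., f_(n-1)). *)
Lemma linear_ode c k f h g : g 0%N = c.+1%:R * k%:R ->
  (forall i, (i <= k)%N -> f i = h i) ->
  c.+1%:R * fpsder f = f * g -> c.+1%:R * fpsder h = h * g -> f = h.
Proof.
move=> g0 fh ef eh; apply: fpsP; elim/ltn_ind => n IHn.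
case: (leqP n k) => [/fh //|lt_kn].
have: (c.+1%:R * fpsder f - f * g) n = (c.+1%:R * fpsder h - h * g) n.
  by rewrite ef eh !subrr.
rewrite !coefsB !coefs_natM !coefs_der !coefsM !big_ord_recr /= subnn.
rewrite (eq_bigr (fun i : 'I_n => h i * g (n - i)%N)) => [|i _]; last by rewrite IHn.
rewrite !opprD !(addrCA _ (- bigop _ _ _)) => /addrI; rewrite g0 => e.
have nk : c.+1%:R * (n%:R - k%:R) != 0 :> K.
  by rewrite mulf_eq0 pnatr_eq0 subr_eq0 eqr_nat (gtn_eqF lt_kn).
by apply: (mulfI nk); apply: etrans (etrans e _); ring.
Qed.

(** Once the lower coefficients vanish, the equations at q^n decouple, because g12 and g21 have no
    constant term: (a n - g11_0) u_n = 0 and (c n - g22_0) v_n = 0. Only v can resonate, and there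
    v_n = 0 is assumed. *)
Lemma linear_ode2 (a c : nat) u v g11 g12 g21 g22 :
  g12 0%N = 0 -> g21 0%N = 0 -> (forall n, a%:R * n%:R != g11 0%N) ->
  (forall n, c%:R * n%:R = g22 0%N -> v n = 0) ->
  a%:R * fpsder u = u * g11 + v * g12 -> c%:R * fpsder v = u * g21 + v * g22 ->
  u = 0 /\ v = 0.
Proof.
move=> g120 g210 ha hc eu ev.
suff H n : u n = 0 /\ v n = 0 by split; apply: fpsP => n; case: (H n).
elim/ltn_ind: n => n IHn.
have big0 (w g : fps K) : (forall i, (i < n)%N -> w i = 0) -> (w * g) n = w n * g 0%N.
  move=> w0; rewrite coefsM big_ord_recr /= subnn big1 ?add0r // => i _.
  by rewrite w0 ?mul0r.
have u0 i : (i < n)%N -> u i = 0 by move/IHn => [].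
have v0 i : (i < n)%N -> v i = 0 by move/IHn => [].
have e1 : (a%:R * fpsder u) n = (u * g11 + v * g12) n by rewrite eu.
have e2 : (c%:R * fpsder v) n = (u * g21 + v * g22) n by rewrite ev.
rewrite coefsD coefs_natM coefs_der !big0 // g120 mulr0 addr0 in e1.
rewrite coefsD coefs_natM coefs_der !big0 // g210 mulr0 add0r in e2.
split; apply/eqP.
  have /eqP : u n * (a%:R * n%:R - g11 0%N) = 0 by rewrite mulrBr -e1; ring.
  by rewrite mulf_eq0 subr_eq0 (negPf (ha n)) orbF.
case: (eqVneq (c%:R * n%:R) (g22 0%N)) => [/hc -> //|ne].
have /eqP : v n * (c%:R * n%:R - g22 0%N) = 0 by rewrite mulrBr -e2; ring.
by rewrite mulf_eq0 subr_eq0 (negPf ne) orbF.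
Qed.

End Euler.

Section EtaQuotients.
Variable K : numFieldType.
Local Notation sig := (@sig K).
Local Notation A := (borA K).
Local Notation B := (borB K).
Local Notation C := (borC K).
Local Notation P := (eisP K).
Local Notation e1 := (fps_eta K 1).
Local Notation e3 := (fps_eta K 3).
Local Notation e9 := (fps_eta K 9).
Local Notation s3 := (dilate 3 (sig 1)).
Local Notation s9 := (dilate 9 (sig 1)).

Lemma dilate_1 (f : fps K) : dilate 1 f = f.
Proof. by apply: fpsP => n; rewrite coefs_dilate dvd1n divn1. Qed.

Lemma der_e1 : fpsder e1 = - (e1 * sig 1).
Proof. by rewrite der_eta // mul1r dilate_1. Qed.

Lemma sig_0 k : sig k 0%N = 0. Proof. by []. Qed.

Lemma borA0 : A 0%N = 1.
Proof. by rewrite coefsD coefs_natM mulr0 addr0. Qed.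

Lemma borA1 : A 1%N = 6%:R.
Proof. by rewrite coefsD coefs_natM coefs1 /= big_seq1 /chi3 /= add0r !mulr1. Qed.

Lemma borB0 : B 0%N = 1.
Proof. by rewrite coefsB coefs_natM mulr0 subr0. Qed.

Lemma borB1 : B 1%N = - 9%:R.
Proof. by rewrite coefsB coefs_natM coefs1 /= big_seq1 /chi3 /= sub0r !mulr1 expr1n mulr1. Qed.

(** Both sides solve 4 f' = - 36 f [sig 1], the dilated terms of B and of e3^3 cancelling. The
    exponent at q = 0 is 0, so the constant term decides. *)
Lemma borB_eta : B * e3 ^+ 3 = e1 ^+ 9.
Proof.
have g0 : (- 36%:R * sig 1) 0%N = 4%:R * 0%:R :> K by rewrite coefsM0 sig_0 !mulr0.
apply: (linear_ode g0).
- by case=> // _; rewrite coefsM0 !coefsX0 !coefs_eta0 borB0 !expr1n mulr1.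
- rewrite fpsderM fpsderX der_eta //.
  apply: (lin2 (c := e3 ^+ 3) (c' := - B * e3 ^+ 3) (der_borB K) (borA_sqr K)).
  by rewrite /eisP; ring.
- by rewrite fpsderX der_e1; ring.
Qed.

(** Both sides solve 4 f' = f (4 - 108 s3), with exponent 1 at q = 0: the coefficient of q must be
    compared as well, and that of A^3 - B is 3 * 6 + 9 = 27. *)
Lemma borC_eta : C * e1 ^+ 3 = 27%:R * fpsX * e3 ^+ 9.
Proof.
have g0 : (4%:R - 108%:R * s3) 0%N = 4%:R * 1%:R :> K.
  by rewrite coefsB coefs_natM coefs_dilate dvdn0 div0n sig_0 mulr0 subr0 coefs_nat.
apply: (linear_ode g0).
- have C0 : C 0%N = 0 by rewrite coefsB coefsX0 borA0 borB0 expr1n subrr.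
  have X0 : (27%:R * fpsX : fps K) 0%N = 0 by rewrite coefs_natM mulr0.
  case=> [|[|//]] _; first by rewrite [LHS]coefsM0 [RHS]coefsM0 C0 X0 !mul0r.
  rewrite [LHS]coefsM1 [RHS]coefsM1 C0 X0 !mul0r !add0r !coefsX0 !coefs_eta0 !expr1n !mulr1.
  by rewrite coefsB coefsX1 ?borA0 // borA1 borB1 coefs_natM mulr1; ring.
- rewrite fpsderM fpsderX der_e1.
  apply: (lin2 (c := e1 ^+ 3) (c' := 3%:R * C * e1 ^+ 3) (der_borC K) (borA_sqr K)).
  by rewrite /eisP; ring.
- by rewrite fpsderM fpsder_natM fpsderXf fpsderX der_eta //; ring.
Qed.

(* The differences u and v between the two sides satisfy a linear differential
   system whose only solution with v_1 = 0 is zero. *)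
Lemma cubic_eta :
  A * e3 = e1 ^+ 3 + 9%:R * fpsX * e9 ^+ 3 /\
  3%:R * dilate 3 A * e3 = A * e3 + 2%:R * e1 ^+ 3.
Proof.
set i3 := fpsinv e3; have i3E : e3 * i3 = 1 by apply: fpsmulV; apply: coefs_eta0.
have di3 : fpsder i3 = 3%:R * i3 * s3.
  have := congr1 (@fpsder K) i3E; rewrite fpsderM fpsder1 der_eta // => e.
  apply: (lin3 (c := i3) (c' := - fpsder i3) (c'' := 3%:R * s3 * i3) e i3E i3E).
  by ring.
(* These are the Borweins' a(q^3), b(q) and c(q^3); the claims read a(q) = b(q) + 3 c(q^3) and 3
   a(q^3) = a(q) + 2 b(q). *)
pose al := dilate 3 A; pose b := e1 ^+ 3 * i3; pose ga := 3%:R * fpsX * e9 ^+ 3 * i3.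
have db : fpsder b = b * (3%:R * s3 - 3%:R * sig 1).
  by rewrite /b fpsderM fpsderX der_e1 di3; ring.
have dga : fpsder ga = ga * (1 - 27%:R * s9 + 3%:R * s3).
  rewrite /ga fpsderM fpsderM fpsder_natM fpsderXf fpsderX der_eta // di3; ring.
have BE : B = b ^+ 3.
  rewrite -[B]mulr1 -(expr1n _ 3) -i3E exprMn mulrA borB_eta /b; ring.
have gaE : ga ^+ 3 = al ^+ 3 - dilate 3 B.
  have e := congr1 (dilate 3) borC_eta.
  rewrite /borC !dilateM // raddfB /= dilate_nat // !dilateX // dilateXf // in e.
  rewrite !dilate_dilate // -/al in e.
  transitivity ((al ^+ 3 - dilate 3 B) * (e3 * i3) ^+ 3); last by rewrite i3E expr1n mulr1.
  by apply: (lin1 (c := - i3 ^+ 3) e); rewrite /ga; ring.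
have a2 : al ^+ 2 = 1 + 12%:R * s3 - 36%:R * s9.
  by rewrite /al -dilateX // borA_sqr raddfB raddfD /= dilate1 // !dilate_natM // dilate_dilate.
have P3 := borA_sqr_eisP K; rewrite dilate_eisP in P3.
have dal : 4%:R * fpsder al = al * (1 - 24%:R * s3) - al ^+ 3 + 4%:R * ga ^+ 3.
  have := congr1 (dilate 3) (der_borA K).
  rewrite dilate_natM // raddfB [X in _ = X - _]raddfD /= !dilate_natM // dilateM // dilateX //.
  rewrite -/al dilate_eisP => e; rewrite gaE /al dilate_der -/al.
  by apply: (lin1 (c := 1) e); ring.
pose u := 3%:R * al - (A + 2%:R * b); pose v := 3%:R * ga - (A - b).
have dA := der_borA K; rewrite BE in dA.
have A2 := borA_sqr K.
(* The nonlinear terms are the differences of cubes (3 al)^3 - (A + 2 b)^3 and (3 ga)^3 - (A - b)^3,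
   which factor through u and v. This makes the system linear in u and v. *)
have du : 36%:R * fpsder u = u * (9%:R * (1 - 24%:R * s3) - (9%:R * al ^+ 2
      + 3%:R * al * (A + 2%:R * b) + (A + 2%:R * b) ^+ 2))
    + v * (4%:R * (9%:R * ga ^+ 2 + 3%:R * ga * (A - b) + (A - b) ^+ 2)).
  have -> : fpsder u = 3%:R * fpsder al - (fpsder A + 2%:R * fpsder b).
    by rewrite /u raddfB [X in _ - X]raddfD /= !fpsder_natM.
  rewrite db; apply: (lin3 (c := 27%:R) (c' := - 3%:R) (c'' := - (6%:R * A + 18%:R * b)) dal dA A2).
  by rewrite /u /v /eisP; ring.
have dv : 12%:R * fpsder v = u * ((A - b) * (3%:R * al + (A + 2%:R * b)))
    + v * (3%:R * (1 - 24%:R * s3) + 9%:R * al ^+ 2).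
  have -> : fpsder v = 3%:R * fpsder ga - (fpsder A - fpsder b).
    by rewrite /v raddfB [X in _ - X]raddfB /= !fpsder_natM.
  rewrite db dga; apply: (lin3 (c := - 1) (c' := - (2%:R * A - 3%:R * b)) (c'' := - 27%:R * ga) dA A2 a2).
  by rewrite /u /v /eisP; ring.
have i30 : i3 0%N = 1.
  by have := congr1 (fun f : fps K => f 0%N) i3E; rewrite coefsM0 coefs_eta0 mul1r.
have i31 : i3 1%N = 0.
  have : (e3 * i3) 1%N = 0 by rewrite i3E.
  by rewrite coefsM1 coefs_eta0 coefs_dilate /= mul0r addr0 mul1r.
have b0 : b 0%N = 1 by rewrite coefsM0 coefsX0 coefs_eta0 expr1n mul1r.
have b1 : b 1%N = - 3%:R.
  rewrite coefsM1 i31 mulr0 add0r i30 mulr1 coefsX1 ?coefs_eta0 //.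
  by rewrite coefs_dilate dvd1n divn1 euler1 mulrN1.
have al0 : al 0%N = 1 by rewrite coefs_dilate dvdn0 div0n borA0.
have ga0 : ga 0%N = 0 by rewrite /ga -!mulrA coefs_natM coefsM0 mul0r mulr0.
have ga1 : ga 1%N = 3%:R.
  by rewrite /ga -!mulrA coefs_natM coefs_XM !coefsM0 !coefs_eta0 i30 !mulr1.
have s30 : s3 0%N = 0 by rewrite coefs_dilate dvdn0 div0n.
have [u0 v0] : u = 0 /\ v = 0.
  have G0 : (A - b) 0%N = 0 by rewrite coefsB borA0 b0 subrr.
  have Y0 : (A + 2%:R * b) 0%N = 3%:R by rewrite coefsD coefs_natM borA0 b0; ring.
  have P0 : (1 - 24%:R * s3) 0%N = 1 by rewrite coefsB coefs_natM s30 mulr0 subr0.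
  clearbody al b ga; apply: (linear_ode2 _ _ _ _ du dv).
  - by rewrite coefs_natM !coefsD !coefsM0 G0 ga0; ring.
  - by rewrite coefsM0 G0 mul0r.
  - move=> n; rewrite coefsB coefs_natM P0 !coefsD !coefsM0 Y0 al0 !coefs_nat /=.
    rewrite -subr_eq0.
    have -> : 36%:R * n%:R - (9 * 1 - (9 * 1%:R * (1 * 1) + 3 * 1%:R * 1 * 3 + 3 * 3))
        = (36 * n + 18)%N%:R :> K by rewrite natrD natrM; ring.
    by rewrite pnatr_eq0; lia.
  (* The equation for v resonates exactly at n = 1, where v_1 = 3 * 3 - (6 + 3) = 0 is verified by
     hand. *)
  - move=> n; rewrite coefsD !coefs_natM P0 coefsX0 al0 => e.
    have : (12 * n)%N%:R = 12%:R :> K by rewrite natrM e; ring.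
    move/eqP; rewrite eqr_nat; case: n {e} => [//|[_|n]]; last by lia.
    by rewrite coefsB coefs_natM ga1 coefsB borA1 b1; ring.
split.
  transitivity (A * e3 - (A - b) * e3 + 3%:R * ga * e3).
    by apply: (lin1 (c := - e3) v0); rewrite /v; ring.
  apply: (lin1 (c := 9%:R * fpsX * e9 ^+ 3 + e1 ^+ 3) i3E); rewrite /ga /b; ring.
apply: (lin2 (c := e3) (c' := 2%:R * e1 ^+ 3) u0 i3E); rewrite /u /b; ring.
Qed.

End EtaQuotients.

(** * The theta series of the hexagonal form *)

Definition hexform (p : int * int) : int := p.1 ^+ 2 + p.1 * p.2 + p.2 ^+ 2.

Definition zbox (N : nat) : seq int := [seq i%:Z - N%:Z | i <- iota 0 (2 * N).+1].

Lemma zbox_uniq N : uniq (zbox N).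
Proof. by rewrite map_inj_uniq ?iota_uniq // => i j /addIr []. Qed.

Lemma mem_zbox N x : (x \in zbox N) = (`|x| <= N)%N.
Proof.
apply/mapP/idP => [[k]|le_xN]; first by rewrite mem_iota => ? ->; lia.
by exists (absz (x + N%:Z)); rewrite ?mem_iota; lia.
Qed.

Definition hexreps (m : nat) : seq (int * int) :=
  [seq p <- [seq (x, y) | x <- zbox (2 * m), y <- zbox (2 * m)] | hexform p == m%:Z].

Lemma hexreps_uniq m : uniq (hexreps m).
Proof.
by apply: filter_uniq; apply: allpairs_uniq; rewrite ?zbox_uniq // => -[? ?] [? ?].
Qed.

(** With z = - (x + y) the form is (x^2 + y^2 + z^2) / 2, hence symmetric in the three variables,
    each of which satisfies 3 u^2 <= 4 m. The bound on x + y serves for the third index of the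
    triple product. *)
Lemma hexform_bound x y (m : nat) : hexform (x, y) <= m%:Z ->
  [/\ `|x| <= 2 * m, `|y| <= 2 * m & `|(x + y)%R| <= 2 * m]%N.
Proof.
rewrite /hexform /= => h.
have sqr_ge (u : int) : u <= u ^+ 2 /\ - u <= u ^+ 2 by split; nia.
have hx : 3 * x ^+ 2 <= 4 * m%:Z by have := sqr_ge0 (2 * y + x); nia.
have hy : 3 * y ^+ 2 <= 4 * m%:Z by have := sqr_ge0 (2 * x + y); nia.
have hz : 3 * (x + y) ^+ 2 <= 4 * m%:Z by have := sqr_ge0 (x - y); nia.
by have [? ?] := sqr_ge x; have [? ?] := sqr_ge y; have [? ?] := sqr_ge (x + y); split; lia.
Qed.

Lemma mem_hexreps m p : (p \in hexreps m) = (hexform p == m%:Z).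
Proof.
rewrite mem_filter; case: eqP => [|//]; rewrite andTb; case: p => x y e.
have [hx hy _] : [/\ `|x| <= 2 * m, `|y| <= 2 * m & `|(x + y)%R| <= 2 * m]%N.
  by apply: hexform_bound; rewrite e.
by apply/allpairsP; exists (x, y); rewrite !mem_zbox.
Qed.

Section Theta.
Variable K : numFieldType.

Definition theta (w : int * int -> K) : fps K :=
  Fps (fun m => \sum_(p <- hexreps m) w p).

Lemma sum_hexreps (s : seq (int * int)) m (w : int * int -> K) : uniq s ->
  (forall p, hexform p = m%:Z -> p \in s) ->
  \sum_(p <- s | hexform p == m%:Z) w p = \sum_(p <- hexreps m) w p.
Proof.
move=> us hs; rewrite -big_filter; apply: perm_big; apply: uniq_perm.
- exact: filter_uniq.
- exact: hexreps_uniq.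
by move=> p; rewrite mem_filter mem_hexreps; case: eqP => // /hs ->.
Qed.

(* (x, y) -> (x + 2 y, x - y) multiplies the form by 3, and its image is
   the sublattice x = y mod 3 *)
Lemma dilate_theta :
  dilate 3 (theta (fun=> 1)) = theta (fun p => (3 %| p.1 - p.2)%Z%:R).
Proof.
apply: fpsP => m; rewrite coefs_dilate.
have -> : theta (fun p => (3 %| p.1 - p.2)%Z%:R) m
    = \sum_(p <- hexreps m | (3 %| p.1 - p.2)%Z) 1.
  by rewrite [RHS]big_mkcond; apply: eq_bigr => p _; case: (_ %| _)%Z.
case: ifP => [/dvdnP[k ->]|nm].
  rewrite mulnK // /= -[RHS]big_filter.
  rewrite [RHS](perm_big [seq (p.1 + 2 * p.2, p.1 - p.2) | p <- hexreps k]).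
    by rewrite big_map.
  apply: uniq_perm; first exact/filter_uniq/hexreps_uniq.
  - by rewrite map_inj_uniq ?hexreps_uniq // => -[x y] [u v] [] /= ? ?; congr pair; lia.
  move=> [x y]; rewrite mem_filter mem_hexreps; apply/andP/mapP => /=.
    move=> [/dvdzP[v ev] /eqP e]; exists (y + v, v); last by congr pair; rewrite /=; lia.
    rewrite mem_hexreps; apply/eqP; move: e; rewrite /hexform /= PoszM.
    have -> : x = y + v * 3 by lia.
    by move=> e; apply: (@mulIf _ 3) => //; rewrite -e; ring.
  move=> [[u v]]; rewrite mem_hexreps /hexform /= => /eqP e [-> ->]; split.
    by apply/dvdzP; exists v; ring.
  by apply/eqP; rewrite PoszM -e; ring.
rewrite big_seq_cond big1 // => -[x y] /andP[]; rewrite mem_hexreps /hexform /=.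
move=> /eqP e /dvdzP[v ev]; move: nm; rewrite -[m]/(absz m%:Z) -e.
have -> : x ^+ 2 + x * y + y ^+ 2 = 3 * (3 * v ^+ 2 + x * y).
  have -> : x = y + v * 3 by lia.
  by ring.
by rewrite abszM dvdn_mulr.
Qed.

Variable w : K.
Hypothesis w_root : w ^+ 2 + w + 1 = 0.

Lemma cubic_root_cube : w ^+ 3 = 1.
Proof.
apply/eqP; rewrite -subr_eq0.
have -> : w ^+ 3 - 1 = (w - 1) * (w ^+ 2 + w + 1) by ring.
by rewrite w_root mulr0.
Qed.

Lemma cubic_root_neq0 : w != 0.
Proof. by apply: contraTneq isT => w0; have := cubic_root_cube; rewrite w0 expr0n => /eqP; rewrite eq_sym oner_eq0. Qed.

(** The Borweins' b(q) as a theta series. *)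
Definition thetab : fps K := theta (fun p => w ^ (p.1 - p.2)).

Lemma cubic_root_exp3 (k : int) : w ^ (k * 3) = 1.
Proof. by rewrite mulrC -exprz_exp -[w ^ 3]/(w ^+ 3) cubic_root_cube exp1rz. Qed.

Lemma cubic_rootD d : w ^ d + w ^ (- d) = 3%:R * (3 %| d)%Z%:R - 1.
Proof.
have wV : w ^ (-1) = w ^+ 2.
  by apply: (mulfI cubic_root_neq0); rewrite -exprS cubic_root_cube -[w ^ (-1)]/(w^-1) mulfV ?cubic_root_neq0.
have wVV : w ^ (- 2) = w by rewrite (_ : -2 = -1 * 2)// -exprz_exp wV -[_ ^ 2]/(_ ^+ 2) -exprM exprS cubic_root_cube mulr1.
have unw : w \is a GRing.unit by rewrite unitfE cubic_root_neq0.
have [k [r [-> -> hr]]] : exists k, exists r,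
    [/\ d = k * 3 + r, (3 %| d)%Z = (r == 0) & [\/ r = 0, r = 1 | r = 2]].
  exists (d %/ 3)%Z, (d %% 3)%Z; split; first exact: divz_eq.
    by apply/dvdz_mod0P/eqP.
  have := ltz_pmod d (isT : 0 < 3%:Z); have := modz_ge0 d (isT : 3%:Z != 0).
  by case: (d %% 3)%Z => [[|[|[|]]]|] // _ _; [apply: Or31|apply: Or32|apply: Or33].
rewrite opprD -mulNr !expfzDr ?cubic_root_neq0 // !cubic_root_exp3 !mul1r.
case: hr => ->; first by rewrite oppr0 expr0z eqxx /=; ring.
  rewrite expr1z wV mulr0 sub0r; apply/eqP.
  by rewrite -subr_eq0 opprK [w + _]addrC w_root.
rewrite wVV -[w ^ 2]/(w ^+ 2) mulr0 sub0r; apply/eqP.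
by rewrite -subr_eq0 opprK w_root.
Qed.

(** Exchanging x and y replaces w^(x - y) by its inverse. The sum of the two is 3 [3 | x - y] - 1,
    and the sublattice 3 | x - y carries the dilated theta series. *)
Lemma thetab_dilate : 2%:R * thetab = 3%:R * dilate 3 (theta (fun=> 1)) - theta (fun=> 1).
Proof.
rewrite dilate_theta; apply: fpsP => m; rewrite coefsB !coefs_natM /=.
rewrite [X in _ = X - _]mulr_sumr -sumrB mulr_natl mulr2n.
have e : \sum_(p <- hexreps m) w ^ (p.1 - p.2) = \sum_(p <- hexreps m) w ^ (- (p.1 - p.2)).
  rewrite (perm_big [seq (p.2, p.1) | p <- hexreps m]).
    by rewrite big_map; apply: eq_bigr => p _; rewrite opprB.
  apply: uniq_perm; first exact: hexreps_uniq.
    by rewrite map_inj_uniq ?hexreps_uniq // => -[x y] [u v] [] /= -> ->.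
  move=> [x y]; rewrite mem_hexreps; apply/eqP/mapP => [h|[[u v]]].
    by exists (y, x); rewrite // mem_hexreps -h /hexform /=; apply/eqP; ring.
  by rewrite mem_hexreps => /eqP <- [-> ->]; rewrite /hexform /=; ring.
rewrite [X in X + _]e -big_split /=; apply: eq_bigr => p _.
by rewrite addrC cubic_rootD.
Qed.

End Theta.

(** * The triple product over cube roots of unity *)

Section QBinomial.
Variable A : comNzRingType.
Implicit Types q c : A.

Fixpoint qbinom q m j : A :=
  match m, j with
  | _, 0 => 1
  | 0, _.+1 => 0
  | m'.+1, j'.+1 => qbinom q m' j'.+1 + q ^+ (m' - j') * qbinom q m' j'
  end.

Arguments qbinom : simpl never.

Lemma qbinomS q m j :
  qbinom q m.+1 j.+1 = qbinom q m j.+1 + q ^+ (m - j) * qbinom q m j.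
Proof. by []. Qed.

Lemma qbinom0 q m : qbinom q m 0 = 1.
Proof. by case: m. Qed.

Lemma qbinom_small q m j : (m < j)%N -> qbinom q m j = 0.
Proof.
elim: m j => [|m IHm] [|j] //; rewrite ltnS => lt_mj.
by rewrite qbinomS !IHm ?mulr0 ?addr0 // ltnW.
Qed.

Definition qfact q m : A := \prod_(1 <= i < m.+1) (1 - q ^+ i).

Lemma qfactS q m : qfact q m.+1 = qfact q m * (1 - q ^+ m.+1).
Proof. by rewrite /qfact big_nat_recr. Qed.

Lemma qbinom_fact q j k : qfact q j * qfact q k * qbinom q (j + k) j = qfact q (j + k).
Proof.
have f0 : qfact q 0 = 1 by rewrite /qfact big_geq.
elim: j k => [|j IHj] k; first by rewrite qbinom0 f0 mul1r mulr1.
elim: k => [|k IHk].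
  have := IHj 0%N; rewrite !addn0 qbinomS (qbinom_small q (ltnSn j)) subnn !qfactS => e.
  by rewrite -[in RHS]e; ring.
have := IHj k.+1; rewrite [(j.+1 + _)%N]addSn qbinomS addKn => e.
rewrite [qfact q (j + k.+1).+1]qfactS -e.
move: IHk; rewrite addSnnS => IHk.
apply/eqP; rewrite -subr_eq0; apply/eqP.
have e' := etrans IHk (esym e).
transitivity ((1 - q ^+ k.+1) * (qfact q j.+1 * qfact q k * qbinom q (j + k.+1) j.+1
   - qfact q j * qfact q k.+1 * qbinom q (j + k.+1) j)); last by rewrite e' subrr mulr0.
have -> : q ^+ (j + k.+1).+1 = q ^+ j.+1 * q ^+ k.+1 by rewrite -exprD addSn.
rewrite !qfactS; move: (q ^+ j.+1) (q ^+ k.+1) => x y; ring.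
Qed.

Definition qprod q c m : {poly A} := \prod_(i < m) (1 - (c * q ^+ i)%:P * 'X).

(** The finite q-binomial theorem. *)
Lemma coef_qprod q c m j :
  (qprod q c m)`_j = (- c) ^+ j * q ^+ 'C(j, 2) * qbinom q m j.
Proof.
elim: m j => [|m IHm] j.
  by rewrite /qprod big_ord0 coef1; case: j => [|j]; rewrite ?mulr0 // expr0 !mul1r.
rewrite /qprod big_ord_recr /= -/(qprod q c m) mulrBr mulr1 coefB mulrCA coefCM coefMX.
case: j => [|j] /=; first by rewrite IHm !qbinom0 mulr0 subr0.
rewrite !IHm qbinomS binS bin1 exprD [(- c) ^+ j.+1]exprS.
case: (leqP j m) => [le_jm|lt_mj]; last first.
  by rewrite (qbinom_small q lt_mj) (qbinom_small q (ltnW lt_mj : m < j.+1)%N) !mulr0 subr0 addr0 mulr0.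
have -> : q ^+ m = q ^+ j * q ^+ (m - j) by rewrite -exprD subnKC.
by move: (q ^+ j) (q ^+ (m - j)) (q ^+ 'C(j, 2)) ((- c) ^+ j) => x y z t; ring.
Qed.

(** Factor by factor this is (1 - t)(1 - w t)(1 - w^2 t) = 1 - t^3. *)
Lemma qprod_cubic q w m : w ^+ 2 + w + 1 = 0 ->
  qprod q 1 m * (qprod q w m * qprod q (w ^+ 2) m) = qprod (q ^+ 3) 1 m \Po 'X^3.
Proof.
move=> hw.
rewrite /qprod -!big_split rmorph_prod /=; apply: eq_bigr => i _.
rewrite rmorphB rmorph1 /= comp_polyM comp_polyC comp_polyX -exprM mulnC exprM.
rewrite !mul1r !polyCM; set t := (q ^+ i)%:P; set v := w%:P.
have v1 : v ^+ 2 + v + 1 = 0 by rewrite -rmorphXn -rmorphD -polyC1 -rmorphD hw rmorph0.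
apply/eqP; rewrite -subr_eq0; apply/eqP.
transitivity ((v ^+ 2 + v + 1) * (v * t ^+ 2 * 'X ^+ 2 - t * 'X - t ^+ 3 * 'X ^+ 3 * (v - 1))).
  by ring.
by rewrite v1 mul0r.
Qed.

End QBinomial.

Lemma fpsX_cancel (K : comNzRingType) k (f g : fps K) : fpsX ^+ k * f = fpsX ^+ k * g -> f = g.
Proof.
move=> e; apply: fpsP => n.
have := congr1 (fun h : fps K => h (k + n)%N) e.
by rewrite !coefs_XnM leq_addr addKn.
Qed.

Lemma bin2_int i : 2 * 'C(i, 2)%:Z = i%:Z ^+ 2 - i%:Z.
Proof.
case: i => [//|i]; have := mul_bin_diag i.+1 1; rewrite /= bin1 => h.
by rewrite -[2]/(2%:Z) -PoszM -h PoszM intS; ring.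
Qed.

Lemma hexform_ge0 p : 0 <= hexform p.
Proof.
case: p => x y; rewrite /hexform /=.
have := sqr_ge0 (2 * y + x); have := sqr_ge0 x; nia.
Qed.

(** With the deviations x, y, z of i, j, k from n, which add up to 0, the left side exceeds 3 'C(n,
    2) by (x^2 + y^2 + z^2) / 2. This is how the hexagonal form enters. *)
Lemma bin2_hexform i j k n : (i + j + k = 3 * n)%N ->
  ('C(i, 2) + ('C(j, 2) + 'C(k, 2)) =
   3 * 'C(n, 2) + absz (hexform (i%:Z - n%:Z, j%:Z - n%:Z)%R))%N.
Proof.
move=> e; have := hexform_ge0 (i%:Z - n%:Z, j%:Z - n%:Z).
have := bin2_int i; have := bin2_int j; have := bin2_int k; have := bin2_int n.
have -> : k%:Z = 3 * n%:Z - i%:Z - j%:Z by lia.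
rewrite /hexform /=; move: ('C(i, 2)) ('C(j, 2)) ('C(k, 2)) ('C(n, 2)) => a b c d.
move=> e1 e2 e3 e4 h.
set H := (X in absz X); rewrite -/H in h.
have : 2 * H = 2 * (a%:Z + (b%:Z + c%:Z) - 3 * d%:Z).
  have -> : 2 * (a%:Z + (b%:Z + c%:Z) - 3 * d%:Z)
      = 2 * a%:Z + (2 * b%:Z + 2 * c%:Z) - 3 * (2 * d%:Z) by ring.
  by rewrite e1 e2 e3 e4 /H; ring.
by clear -h; clearbody H; lia.
Qed.

Lemma coef_mul3 (A : comNzRingType) (p1 p2 p3 : {poly A}) (f1 f2 f3 : nat -> A) N :
  (forall i, p1`_i = f1 i) -> (forall i, p2`_i = f2 i) -> (forall i, p3`_i = f3 i) ->
  (p1 * (p2 * p3))`_N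
  = \sum_(0 <= i < N.+1) \sum_(0 <= j < (N - i).+1) f1 i * f2 j * f3 (N - i - j)%N.
Proof.
move=> e1 e2 e3; rewrite coefM big_mkord; apply: eq_bigr => i _.
rewrite coefM mulr_sumr big_mkord; apply: eq_bigr => j _.
by rewrite e1 e2 e3 mulrA.
Qed.

Section TripleProduct.
Variable K : numFieldType.
Variable w : K.
Hypothesis w_root : w ^+ 2 + w + 1 = 0.
Local Notation qb n j := (qbinom (fpsX : fps K) (2 * n) j).
Local Notation hex n i j := (absz (hexform (i%:Z - n%:Z, j%:Z - n%:Z))).

(* The coefficient of X^(3 n) on both sides of qprod_cubic. *)
Lemma triple_product_cubed n :
  \sum_(0 <= i < (3 * n).+1) \sum_(0 <= j < (3 * n - i).+1)
    fpsC (w ^ (i%:Z - n%:Z - (j%:Z - n%:Z))) * fpsX ^+ hex n i j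
      * (qb n i * qb n j * qb n (3 * n - i - j))
  = qbinom (fpsX ^+ 3) (2 * n) n.
Proof.
have hw : (fpsC w) ^+ 2 + fpsC w + 1 = 0 by rewrite -fpsCX -fpsC1 -!fpsCD w_root fpsC0.
have := congr1 (fun p : {poly fps K} => p`_(3 * n)) (qprod_cubic fpsX (2 * n) hw).
rewrite (coef_mul3 _ (coef_qprod _ _ _) (coef_qprod _ _ _) (coef_qprod _ _ _)).
rewrite coef_comp_poly_Xn // dvdn_mulr // mulKn // coef_qprod => e.
(* By [bin2_hexform] every term carries the factor q^(3 'C(n, 2)), which is also the power of q on
   the right. *)
apply: (@fpsX_cancel _ (3 * 'C(n, 2))).
set S := \sum_(0 <= i < _) _ in e.
transitivity ((-1) ^+ n * S); last first.
  by rewrite e !mulrA -exprMn mulrNN mulr1 expr1n mul1r exprM.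
rewrite /S !mulr_sumr; apply: eq_big_nat => i /andP[_ lt_i].
rewrite !mulr_sumr; apply: eq_big_nat => j /andP[_ lt_j].
set k := (3 * n - i - j)%N.
have ijk : (i + j + k = 3 * n)%N by rewrite /k; lia.
(* The weights of the three products give w^(j + 2 k), and i + j + k = 3 n makes j + 2 k congruent
   to i - j mod 3. *)
have -> : w ^ (i%:Z - n%:Z - (j%:Z - n%:Z)) = w ^+ (j + 2 * k).
  rewrite [RHS]exprnP (_ : (j + 2 * k)%N%:Z = i%:Z - n%:Z - (j%:Z - n%:Z) + (2 * n%:Z - i%:Z) * 3).
    by rewrite [RHS]expfzDr ?cubic_root_neq0 // cubic_root_exp3 // mulr1.
  by rewrite PoszD PoszM (_ : k%:Z = 3 * n%:Z - i%:Z - j%:Z); [ring | lia].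
have sg : (-1) ^+ n * (-1) ^+ i * (-1) ^+ j * (-1) ^+ k = 1 :> fps K.
  rewrite -!exprD (_ : (n + i + j + k = 2 * (2 * n))%N); last by lia.
  by rewrite exprM sqrrN !expr1n.
have ex : fpsX ^+ (3 * 'C(n, 2)) * fpsX ^+ hex n i j
    = fpsX ^+ 'C(i, 2) * (fpsX ^+ 'C(j, 2) * fpsX ^+ 'C(k, 2)) :> fps K.
  by rewrite -!exprD -(bin2_hexform ijk).
rewrite fpsCX exprD [(- fpsC w) ^+ j]exprNn [(- fpsC w ^+ 2) ^+ k]exprNn -exprM.
move: sg ex; move: (qb n i) (qb n j) (qb n k) (fpsC w ^+ j) (fpsC w ^+ (2 * k)).
move: (fpsX ^+ 'C(i, 2)) (fpsX ^+ 'C(j, 2)) (fpsX ^+ 'C(k, 2)).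
move: (fpsX ^+ (3 * 'C(n, 2))) (fpsX ^+ hex n i j).
move: ((-1) ^+ n) ((-1) ^+ i) ((-1) ^+ j) ((-1) ^+ k).
move=> sn si sj sk x h xi xj xk qi qj qk wj wk sg ex.
apply: (lin2 (c := wj * wk * qi * qj * qk)
  (c' := - (xi * xj * xk * wj * wk * qi * qj * qk)) ex sg); ring.
Qed.

End TripleProduct.

(** * Passage to the limit in the triple product, and the theta series *)

Section Lorenz.
Variable K : numFieldType.
Implicit Types f g h : fps K.
Local Notation e1 := (fps_eta K 1).
Local Notation e3 := (fps_eta K 3).

Lemma eqt_trans N f g h : eqt N f g -> eqt N g h -> eqt N f h.
Proof. by move=> fg gh n lt; rewrite fg ?gh. Qed.

Lemma eqt_sym N f g : eqt N f g -> eqt N g f.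
Proof. by move=> fg n lt; rewrite fg. Qed.

Lemma eqt_refl N f : eqt N f f. Proof. by []. Qed.

Lemma eqt_sum N (I : Type) (r : seq I) (P : pred I) (F G : I -> fps K) :
  (forall i, P i -> eqt N (F i) (G i)) ->
  eqt N (\sum_(i <- r | P i) F i) (\sum_(i <- r | P i) G i).
Proof. by move=> h n lt; rewrite !coefs_sum; apply: eq_bigr => i Pi; apply: h. Qed.

(** In [qbinom_fact] the three q-factorials agree with e up to q^N, so e e [qbinom] is e to that
    order and one factor e can be cancelled. *)
Lemma qbinom_eqt (q e : fps K) N j k : e 0%N = 1 ->
  (forall m, (N <= m)%N -> eqt N.+1 e (qfact q m)) -> (N <= j)%N -> (N <= k)%N ->
  eqt N.+1 (e * qbinom q (j + k) j) 1.
Proof.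
move=> e0 he Nj Nk.
have h : eqt N.+1 (e * e * qbinom q (j + k) j) e.
  apply: eqt_trans (_ : eqt _ _ (qfact q (j + k))) _.
    rewrite -(qbinom_fact q j k); apply: eqtM => //.
    by apply: eqtM; apply: he.
  by apply/eqt_sym/he; rewrite (leq_trans Nj) // leq_addr.
have := eqtM (eqt_refl (fpsinv e)) h.
by rewrite -!mulrA mulrA [fpsinv e * e]mulrC fpsmulV // mul1r.
Qed.

Lemma euler_qfact N m : (N <= m)%N -> eqt N.+1 e1 (qfact fpsX m).
Proof.
move=> le_Nm n lt_nN; rewrite /fps_eta dilate_1 -[qfact _ _]/(euler_part K m).
by apply: euler_part_eqt; apply: leq_trans lt_nN _; rewrite ltnS.
Qed.

Lemma eta3_qfact N m : (N <= m)%N -> eqt N.+1 e3 (qfact (fpsX ^+ 3) m).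
Proof.
have -> : qfact (fpsX ^+ 3) m = dilate 3 (euler_part K m).
  rewrite /euler_part (big_morph _ (@dilateM K 3 isT) (@dilate1 K 3 isT)).
  apply: eq_bigr => i _; rewrite dilate_additive.
  by rewrite (@dilate1 K 3 isT) (@dilateX K 3 isT) (@dilateXf K 3 isT).
move=> le_Nm n lt_nN; rewrite !coefs_dilate; case: ifP => // _.
apply: euler_part_eqt; apply: leq_ltn_trans (leq_div _ _) _.
by apply: leq_trans lt_nN _; rewrite ltnS.
Qed.

Variable w : K.
Hypothesis w_root : w ^+ 2 + w + 1 = 0.
Local Notation hex n i j := (absz (hexform (i%:Z - n%:Z, j%:Z - n%:Z))).
Local Notation c n i j := (w ^ (i%:Z - n%:Z - (j%:Z - n%:Z))).

Lemma thetab_eqt m : eqt m.+1 (thetab w)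
  (\sum_(0 <= i < (3 * (3 * m)).+1) \sum_(0 <= j < (3 * (3 * m) - i).+1)
    fpsC (c (3 * m)%N i j) * fpsX ^+ hex (3 * m)%N i j).
Proof.
(* A point with form at most m has |x|, |y|, |x + y| <= 2 m, so n = 3 m puts i, j and k between m
   and 5 m = 2 n - m. The triangle of summation thus contains all these points, and in [thetab_eta]
   each q-binomial keeps a margin m at both ends. *)
set n := (3 * m)%N; move=> p; rewrite ltnS => le_pm.
pose s := [seq (i%:Z - n%:Z, j%:Z - n%:Z)
          | i <- index_iota 0 (3 * n).+1, j <- index_iota 0 (3 * n - i).+1].
transitivity (\sum_(u <- s | hexform u == p%:Z) w ^ (u.1 - u.2)).
  symmetry; apply: sum_hexreps.
    apply: allpairs_uniq_dep; [exact: iota_uniq | by move=> i _; apply: iota_uniq |].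
    move=> u v /allpairsPdep[i [j [_ _ ->]]] /allpairsPdep[i' [j' [_ _ ->]]] /=.
    by case=> /addIr [->] /addIr [->].
  move=> [x y] e; have [hx hy hxy] : [/\ `|x| <= 2 * p, `|y| <= 2 * p & `|(x + y)%R| <= 2 * p]%N.
    by apply: hexform_bound; rewrite e.
  apply/allpairsPdep; exists (absz (x + n%:Z)), (absz (y + n%:Z)).
  by rewrite !mem_index_iota /n; split; [lia | lia | congr pair; lia].
rewrite big_mkcond big_allpairs_dep coefs_sum; apply: eq_bigr => i _.
rewrite coefs_sum; apply: eq_bigr => j _; rewrite coefs_fpsCM coefs_Xn /=.
have := hexform_ge0 (i%:Z - n%:Z, j%:Z - n%:Z).
set H := hexform _ => H0; have -> : (H == p%:Z) = (p == absz H) by lia.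
by case: ifP => _; rewrite ?mulr1 ?mulr0.
Qed.

Lemma thetab_eta : thetab w * e3 = e1 ^+ 3.
Proof.
apply: fpsP => m; set n := (3 * m)%N.
suff h : eqt m.+1 (thetab w * e3) (e1 ^+ 3) by apply: h.
have e10 : e1 0%N = 1 by apply: coefs_eta0.
set T := \sum_(0 <= i < (3 * n).+1) \sum_(0 <= j < (3 * n - i).+1)
    fpsC (c n i j) * fpsX ^+ hex n i j.
have hT : eqt m.+1 T (e1 ^+ 3 * qbinom (fpsX ^+ 3) (2 * n) n).
  rewrite -(triple_product_cubed w_root n) mulr_sumr; rewrite /T.
  rewrite [X in eqt _ X]big_seq_cond [X in eqt _ _ X]big_seq_cond.
  apply: eqt_sum => i; rewrite mem_index_iota andbT => /andP[_ lt_i].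
  rewrite mulr_sumr [X in eqt _ X]big_seq_cond [X in eqt _ _ X]big_seq_cond.
  apply: eqt_sum => j; rewrite mem_index_iota andbT => /andP[_ lt_j].
  set k := (3 * n - i - j)%N; set t := fpsC _ * _.
  (* Terms whose power of q exceeds m do not contribute. In the others the three q-binomials are
     each absorbed by a factor e1. *)
  case: (leqP (hex n i j) m) => hm; last first.
    move=> p; rewrite ltnS => le_pm.
    have t0 f : (t * f) p = 0.
      by rewrite /t -mulrA coefs_fpsCM coefs_XnM leqNgt (leq_ltn_trans le_pm hm) mulr0.
    by rewrite mulrCA t0 -[t]mulr1 t0.
  have [hx hy hxy] : [/\ `|(i%:Z - n%:Z)%R| <= 2 * m, `|(j%:Z - n%:Z)%R| <= 2 * m
      & `|(i%:Z - n%:Z + (j%:Z - n%:Z))%R| <= 2 * m]%N.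
    apply: hexform_bound; have := hexform_ge0 (i%:Z - n%:Z, j%:Z - n%:Z).
    by move: hm; set H := hexform _; lia.
  have qb1 a : (m <= a)%N -> (m + a <= 2 * n)%N -> eqt m.+1 (e1 * qbinom fpsX (2 * n) a) 1.
    move=> h1 h2; rewrite -(subnKC (_ : a <= 2 * n)%N); last by lia.
    by apply: (qbinom_eqt e10) => [b hb||] //; [exact: euler_qfact | lia].
  have -> : e1 ^+ 3 * (t * (qbinom fpsX (2 * n) i * qbinom fpsX (2 * n) j * qbinom fpsX (2 * n) k))
    = t * ((e1 * qbinom fpsX (2 * n) i) * (e1 * qbinom fpsX (2 * n) j) * (e1 * qbinom fpsX (2 * n) k)).
    ring.
  rewrite -[X in eqt _ X]mulr1 -[X in eqt _ (_ * X)]mulr1 -[X in eqt _ (_ * (X * _))]mulr1.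
  apply/eqtM/eqt_sym => //; apply: eqtM; [apply: eqtM |]; apply: qb1; rewrite /n in hx hy hxy *; rewrite /k; lia.
apply: eqt_trans (_ : eqt _ _ (T * e3)) _; first by apply: eqtM => //; apply: thetab_eqt.
apply: eqt_trans (eqtM hT (eqt_refl e3)) _.
rewrite -mulrA -[X in eqt _ _ X]mulr1; apply: eqtM => //.
rewrite mulrC (_ : 2 * n = n + n)%N; last by lia.
apply: qbinom_eqt; rewrite ?coefs_eta0 //; [|rewrite /n; lia | rewrite /n; lia].
by move=> a; apply: eta3_qfact.
Qed.

(* theta (fun=> 1) and the Borwein function satisfy the same relation between
   f and its dilation by 3, which determines f from f_0. *)
Lemma lorenz : theta (fun=> 1) = borA K.
Proof.
set a := theta _; set A := borA K.
have ha : 3%:R * dilate 3 a * e3 = a * e3 + 2%:R * e1 ^+ 3.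
  have e := thetab_dilate w_root; rewrite -/a in e.
  by apply: (lin2 (c := - e3) (c' := 2%:R) e thetab_eta); ring.
have [_ hA] := cubic_eta K; rewrite -/A in hA.
have e30 : e3 0%N != 0 by rewrite coefs_eta0 oner_neq0.
have h : a - A = 3%:R * dilate 3 (a - A).
  apply: (fps_cancel e30); rewrite raddfB /=.
  by apply: (lin2 (c := - 1) (c' := 1) ha hA); ring.
apply/subr0_eq/fpsP; elim/ltn_ind => m IHm.
case: (posnP m) => [->|m0].
  by rewrite coefsB borA0 /= (perm_big [:: (0, 0)]) ?big_seq1 ?subrr.
rewrite h coefs_natM coefs_dilate; case: ifP => m3; last by rewrite mulr0.
by rewrite IHm ?mulr0 // ltn_Pdiv.
Qed.

End Lorenz.

(** * Representation numbers *)

Definition qsum (k : nat) (s : seq int) : int :=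
  \sum_(0 <= j < k) hexform (s`_(2 * j), s`_(2 * j + 1)).

Lemma qsumS k x y s : qsum k.+1 (x :: y :: s) = hexform (x, y) + qsum k s.
Proof.
rewrite /qsum big_nat_recl //; congr (_ + _); apply: eq_bigr => j _.
by rewrite mulnS add2n !addSn.
Qed.

Lemma qsum_ge0 k s : 0 <= qsum k s.
Proof. by apply: sumr_ge0 => j _; apply: hexform_ge0. Qed.

(** An explicit list of the solutions: its recursion mirrors the Cauchy product in the k-th power of
    the theta series, and it supplies the finiteness that [fset_set] requires. *)
Fixpoint qreps (k n : nat) : seq (seq int) :=
  if k is k'.+1 then
    flatten [seq [seq p.1 :: p.2 :: s | p <- hexreps i, s <- qreps k' (n - i)]
            | i <- iota 0 n.+1]
  else if n == 0%N then [:: [::]] else [::].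

Arguments qreps : simpl never.

Lemma qrepsS k n : qreps k.+1 n =
  flatten [seq [seq p.1 :: p.2 :: s | p <- hexreps i, s <- qreps k (n - i)] | i <- iota 0 n.+1].
Proof. by []. Qed.

Lemma mem_qreps k n s :
  (s \in qreps k n) = (size s == 2 * k)%N && (qsum k s == n%:Z).
Proof.
elim: k n s => [|k IHk] n s.
  rewrite /qreps /qsum big_geq // muln0 size_eq0.
  by case: n => [|n]; rewrite ?inE ?andbT // andbF.
rewrite qrepsS; apply/flatten_mapP/andP => [[j]|[/eqP sz /eqP q]].
  rewrite mem_iota ltnS => /andP[_ le_in] /allpairsP[ [ [x y] t] /= [hi]].
  rewrite IHk => /andP[/eqP sz /eqP q] ->; rewrite mem_hexreps in hi.
  by rewrite qsumS (eqP hi) q /= sz mulnS; split=> //; apply/eqP; lia.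
case: s sz q => [|x [|y s]]; rewrite /= mulnS // => -[sz]; rewrite qsumS => q.
have [i ei] : exists i : nat, hexform (x, y) = i%:Z.
  by exists (absz (hexform (x, y))); rewrite gez0_abs // hexform_ge0.
have [j ej] : exists j : nat, qsum k s = j%:Z.
  by exists (absz (qsum k s)); rewrite gez0_abs // qsum_ge0.
move: q; rewrite ei ej -PoszD => -[<-]; exists i.
  by change (i \in iota 0 (i + j).+1); rewrite mem_iota ltnS leq_addr.
by apply/allpairsP; exists ((x, y), s); rewrite mem_hexreps IHk ei addKn ej sz !eqxx.
Qed.

Lemma qreps_uniq k n : uniq (qreps k n).
Proof.
elim: k n => [|k IHk] n; first by rewrite /qreps; case: ifP.
rewrite qrepsS; elim: (iota 0 n.+1) (iota_uniq 0 n.+1) => //= i r IHr /andP[ir ur].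
rewrite cat_uniq IHr // andbT; apply/andP; split.
  apply: allpairs_uniq; rewrite ?hexreps_uniq ?IHk //.
  by move=> [[x y] t] [[x' y'] t'] _ _ /= [-> -> ->].
apply/hasPn => s /flatten_mapP[j jr /allpairsP[ [ [x y] t] /= [hj _ ->]]].
apply/negP => /allpairsP[ [ [x' y'] t'] /= [hi _ [ex ey _]]].
move: hi hj; rewrite !mem_hexreps -ex -ey => /eqP -> /eqP [e].
by rewrite e jr in ir.
Qed.

Lemma size_qreps (K : numFieldType) k n :
  (size (qreps k n))%:R = (theta (fun=> 1 : K) ^+ k) n.
Proof.
elim: k n => [|k IHk] n; first by rewrite coefs1 /qreps; case: n.
rewrite qrepsS exprS coefsM size_flatten sumnE big_map big_map natr_sum.
rewrite -[iota 0 n.+1]/(index_iota 0 n.+1) big_mkord; apply: eq_bigr => i _.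
by rewrite size_allpairs natrM IHk; congr (_ * _); rewrite /= -sum1_size natr_sum.
Qed.

Lemma rep_countE k n : rep_count k n = size (qreps k n).
Proof.
pose X : {fset (2 * k).-tuple int} := [fset x in pmap insub (qreps k n)]%fset.
rewrite /rep_count (_ : [set x | _]%classic = [set` X]%classic); last first.
  apply/seteqP; split => x /=; rewrite in_fset /= mem_pmap_sub mem_qreps size_tuple eqxx /=.
    by move=> h; apply/eqP.
  by move=> /eqP.
rewrite set_fsetK card_fseq undup_id; last first.
  exact/pmap_sub_uniq/qreps_uniq.
rewrite size_pmap_sub; apply/eqP; rewrite -all_count; apply/allP => s.
by rewrite mem_qreps => /andP[].
Qed.

(** * Summation on the open unit interval *)

Section Majorant.
Local Open Scope classical_set_scope.
Variable R : realFieldType.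
Implicit Types (p q : {poly R}) (x r : R).

(** Beyond degree N, x^i <= (x / r)^N r^i. This is the source of all the geometric error terms
    below. *)
Lemma horner_tail p q N x r : 0 <= x -> x < r ->
  (forall n, (n < N)%N -> p`_n = 0) -> (forall n, `|p`_n| <= q`_n) ->
  `|p.[x]| <= (x / r) ^+ N * q.[r].
Proof.
move=> x0 xr p0 pq; have r0 : 0 < r by apply: le_lt_trans xr.
pose K := maxn (size p) (size q).
rewrite (horner_coef_wide x (leq_maxl _ _ : size p <= K)%N).
rewrite (horner_coef_wide r (leq_maxr _ _ : size q <= K)%N).
rewrite mulr_sumr; apply: le_trans (ler_norm_sum _ _ _) _; apply: ler_sum => i _.
case: (ltnP i N) => [/p0 ->|le_Ni].
  rewrite mul0r normr0 mulr_ge0 ?exprn_ge0 ?divr_ge0 // ?(ltW r0) //.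
  by rewrite mulr_ge0 ?exprn_ge0 ?(ltW r0) // (le_trans _ (pq i)).
rewrite normrM (ger0_norm (exprn_ge0 i x0)) mulrCA.
have xr_le : x ^+ i <= (x / r) ^+ N * r ^+ i.
  rewrite -(subnKC le_Ni) !exprD mulrA -exprMn mulfVK ?gt_eqF //.
  apply: ler_wpM2l; first exact: exprn_ge0.
  by apply: lerXn2r; rewrite ?nnegrE ?(ltW r0) ?(ltW xr).
by apply: ler_pM => //; apply: exprn_ge0.
Qed.

Lemma horner_le p q r : 0 <= r -> (forall n, p`_n <= q`_n) -> p.[r] <= q.[r].
Proof.
move=> r0 pq; pose K := maxn (size p) (size q).
rewrite (horner_coef_wide r (leq_maxl _ _ : size p <= K)%N).
rewrite (horner_coef_wide r (leq_maxr _ _ : size q <= K)%N).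
by apply: ler_sum => i _; apply: ler_wpM2r; rewrite ?exprn_ge0.
Qed.

Definition jet N (f : fps R) : {poly R} := \poly_(i < N) f i.
Definition fabs (f : fps R) : fps R := Fps (fun n => `|f n|).

Lemma coef_jet N f n : (jet N f)`_n = if (n < N)%N then f n else 0.
Proof. exact: coef_poly. Qed.

Lemma jet_fabs_ge0 N f n : 0 <= (jet N (fabs f))`_n.
Proof. by rewrite coef_jet; case: ifP => //= _; apply: normr_ge0. Qed.

Lemma coef_jetM_le N f g n :
  `|(jet N f * jet N g)`_n| <= (jet N (fabs f) * jet N (fabs g))`_n.
Proof.
rewrite !coefM; apply: le_trans (ler_norm_sum _ _ _) _; apply: ler_sum => i _.
by rewrite normrM !coef_jet; do 2!case: ifP => _; rewrite ?normr0 ?mulr0 ?mul0r.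
Qed.

Lemma coef_jetM N f g n : (n < N)%N -> (jet N f * jet N g)`_n = (f * g) n.
Proof.
move=> lt_nN; rewrite coefM coefsM; apply: eq_bigr => i _; rewrite !coef_jet.
rewrite (leq_ltn_trans (_ : i <= n)%N lt_nN); last by rewrite -ltnS.
by rewrite (leq_ltn_trans (leq_subr _ _) lt_nN).
Qed.

Lemma fabs_mul_le N f g r : 0 <= r ->
  (jet N (fabs (f * g))).[r] <= (jet N (fabs f)).[r] * (jet N (fabs g)).[r].
Proof.
move=> r0; rewrite -hornerM; apply: horner_le => // n.
rewrite coef_jet; case: ifP => lt_nN; last first.
  by rewrite coefM sumr_ge0 // => i _; rewrite mulr_ge0 ?jet_fabs_ge0.
by rewrite -[fabs _ _]/(`|(f * g) n|) -(coef_jetM f g lt_nN) coef_jetM_le.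
Qed.

(** The product of the truncations and the truncated product differ only from degree N on, where the
    product of the majorants dominates. *)
Lemma jet_mul_diff N f g x r : 0 <= x -> x < r ->
  `|(jet N f).[x] * (jet N g).[x] - (jet N (f * g)).[x]|
  <= (x / r) ^+ N * ((jet N (fabs f)).[r] * (jet N (fabs g)).[r]).
Proof.
move=> x0 xr; rewrite -!hornerM -hornerN -hornerD; apply: horner_tail => // n.
  by move=> lt_nN; rewrite coefB coef_jetM // coef_jet lt_nN subrr.
rewrite coefB [(jet N (f * g))`_n]coef_jet; case: ifP => lt_nN.
  rewrite coef_jetM // subrr normr0 coefM sumr_ge0 // => i _.
  by rewrite mulr_ge0 ?jet_fabs_ge0.
by rewrite subr0 coef_jetM_le.
Qed.

End Majorant.

Section Tame.
Local Open Scope classical_set_scope.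
Variable R : realType.
Implicit Types (f g : fps R) (v u : R -> R) (x r : R).

(* Absolute convergence is required on the whole open unit disk, but the sum v
   is only prescribed on ]0, 1[, which is where q lies when z is on i R_+. *)
Definition tame f v : Prop :=
  (forall r, 0 < r -> r < 1 -> exists M, forall N, (jet N (fabs f)).[r] <= M) /\
  (forall x, 0 < x -> x < 1 -> (fun N => (jet N f).[x]) @ \oo --> v x).

Lemma cvg_squeeze0 (a b e : nat -> R) (l : R) :
  (forall N, `|a N - b N| <= e N) -> e @ \oo --> (0 : R) -> b @ \oo --> l -> a @ \oo --> l.
Proof.
move=> le_e e0 bl.
have ab0 : (fun N => a N - b N) @ \oo --> (0 : R).
  apply: (@squeeze_cvgr _ _ _ _ (fun N => - e N) e); last exact: e0.
    by near=> N; rewrite -ler_norml.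
  by rewrite -oppr0; apply: cvgN.
have -> : a = (fun N => a N - b N) \+ b by apply/funext => N /=; rewrite subrK.
by rewrite -[l]add0r; apply: cvgD.
Unshelve. all: by end_near.
Qed.

Lemma cvg_geometric0 (q C : R) : 0 <= q -> q < 1 -> (fun N => q ^+ N * C) @ \oo --> (0 : R).
Proof.
move=> q0 q1; have -> : (fun N => q ^+ N * C) = geometric C q.
  by apply/funext => N; rewrite mulrC.
by apply: cvg_geometric; rewrite ger0_norm.
Qed.

Lemma tame_mul f g u v : tame f u -> tame g v -> tame (f * g) (fun x => u x * v x).
Proof.
move=> [bf cf] [bg cg]; split=> [r r0 r1|x x0 x1].
  have [M hM] := bf r r0 r1; have [M' hM'] := bg r r0 r1.
  exists (M * M') => N; apply: le_trans (fabs_mul_le _ _ _ (ltW r0)) _.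
  by apply: ler_pM => //; rewrite horner_coef sumr_ge0 // => k _;
    rewrite mulr_ge0 ?exprn_ge0 ?jet_fabs_ge0 ?ltW.
(* An intermediate radius x < r < 1: boundedness at r gives an error decaying like (x / r)^N at
   x. *)
pose r := (x + 1) / 2; have xr : x < r by rewrite /r; lra.
have r0 : 0 < r by rewrite /r; lra. have r1 : r < 1 by rewrite /r; lra.
have [M hM] := bf r r0 r1; have [M' hM'] := bg r r0 r1.
apply: (@cvg_squeeze0 _ (fun N => (jet N f).[x] * (jet N g).[x]) (fun N => (x / r) ^+ N * (M * M'))).
- move=> N; rewrite distrC; apply: le_trans (jet_mul_diff _ _ _ (ltW x0) xr) _.
  apply: ler_wpM2l; first by rewrite exprn_ge0 // divr_ge0 ?ltW.
  by apply: ler_pM => //; rewrite horner_coef sumr_ge0 // => k _;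
    rewrite mulr_ge0 ?exprn_ge0 ?jet_fabs_ge0 ?ltW.
- by apply: cvg_geometric0; [rewrite divr_ge0 ?ltW | rewrite ltr_pdivrMr ?mul1r].
- by apply: cvgM; [apply: cf | apply: cg].
Qed.

Lemma jet_horner N f x : (jet N f).[x] = \sum_(i < N) f i * x ^+ i.
Proof. by rewrite horner_poly. Qed.

Lemma tame_add f g u v : tame f u -> tame g v -> tame (f + g) (fun x => u x + v x).
Proof.
move=> [bf cf] [bg cg]; split=> [r r0 r1|x x0 x1].
  have [M hM] := bf r r0 r1; have [M' hM'] := bg r r0 r1.
  exists (M + M') => N; apply: le_trans (lerD (hM N) (hM' N)).
  rewrite !jet_horner -big_split; apply: ler_sum => k _ /=.
  by rewrite -mulrDl; apply: ler_wpM2r; [rewrite exprn_ge0 ?ltW | apply: ler_normD].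
have -> : (fun N => (jet N (f + g)).[x]) = (fun N => (jet N f).[x]) \+ (fun N => (jet N g).[x]).
  apply/funext => N; rewrite /= !jet_horner -big_split; apply: eq_bigr => k _.
  by rewrite mulrDl.
by apply: cvgD; [apply: cf | apply: cg].
Qed.

Lemma tame_finite f K x : (forall n, (K <= n)%N -> f n = 0) ->
  forall N, (K <= N)%N -> (jet N f).[x] = (jet K f).[x].
Proof.
move=> f0 N le_KN; rewrite !jet_horner.
rewrite (big_ord_widen N (fun i => f i * x ^+ i) le_KN) [RHS]big_mkcond /=.
by apply: eq_bigr => i _; case: ltnP => // /f0 ->; rewrite mul0r.
Qed.

Lemma tame_poly f K : (forall n, (K <= n)%N -> f n = 0) -> tame f (fun x => (jet K f).[x]).
Proof.
move=> f0; split=> [r r0 r1|x x0 x1].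
  exists (jet K (fabs f)).[r] => N; case: (leqP K N) => h.
    by rewrite (@tame_finite (fabs f) K) // => n /f0 /= ->; rewrite normr0.
  apply: horner_le => [|n]; first exact: ltW.
  rewrite !coef_jet; case: ifP => [lt_nN|_]; first by rewrite (ltn_trans lt_nN).
  by case: ifP => //= _; apply: normr_ge0.
have : (fun=> (jet K f).[x]) @ \oo --> (jet K f).[x] by exact: cvg_cst.
apply: cvg_trans; apply: near_eq_cvg.
by near=> N; rewrite (@tame_finite f K) //; near: N; exists K.
Unshelve. all: by end_near.
Qed.

Lemma eq_tame f u v : tame f u -> u =1 v -> tame f v.
Proof. by move=> h /funext <-. Qed.

Lemma tame_Xn k : tame (fpsX ^+ k) (fun x => x ^+ k).
Proof.
apply: (@eq_tame _ _ _ (@tame_poly _ k.+1 _)) => [n lt_kn|x].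
  by rewrite coefs_Xn gtn_eqF.
rewrite jet_horner big_ord_recr /= big1 ?add0r => [|i _].
  by rewrite coefs_Xn eqxx mul1r.
by rewrite coefs_Xn ltn_eqF // mul0r.
Qed.

Lemma tame_nat k : tame k%:R (fun=> k%:R).
Proof.
apply: (@eq_tame _ _ _ (@tame_poly _ 1 _)) => [n n0|x].
  by rewrite coefs_nat eqn0Ngt n0 mulr0.
by rewrite jet_horner big_ord1 coefs_nat !mulr1.
Qed.

Lemma tame_exp f u k : tame f u -> tame (f ^+ k) (fun x => u x ^+ k).
Proof.
move=> h; elim: k => [|k IHk]; first exact: (tame_nat 1).
by rewrite exprS; apply: eq_tame (tame_mul h IHk) _ => x; rewrite exprS.
Qed.

(** The quotient is N / m rounded up, the number of k with k m < N. *)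
Lemma jet_dilate m N f : (0 < m)%N ->
  jet N (dilate m f) = jet ((N + m.-1) %/ m) f \Po 'X^m.
Proof.
move=> m0; apply/polyP => n; rewrite coef_comp_poly_Xn // !coef_jet coefs_dilate.
case: (boolP (m %| n)%N) => [/dvdnP[k ->]|_]; last by case: ifP.
rewrite mulnK //; congr (if _ then _ else _).
by rewrite leq_divRL // mulSn; move: (k * m)%N => q; lia.
Qed.

Lemma tame_dilate m f v : (0 < m)%N -> tame f v -> tame (dilate m f) (fun x => v (x ^+ m)).
Proof.
move=> m0 [bf cf]; have pow01 x : 0 < x -> x < 1 -> 0 < x ^+ m /\ x ^+ m < 1.
  by move=> x0 x1; rewrite exprn_gt0 // exprn_ilt1 ?ltW // -lt0n.
split=> [r r0 r1|x x0 x1].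
  have [rm0 rm1] := pow01 r r0 r1; have [M hM] := bf _ rm0 rm1; exists M => N.
  have -> : fabs (dilate m f) = dilate m (fabs f).
    by apply: fpsP => n /=; case: ifP; rewrite ?normr0.
  by rewrite jet_dilate // horner_comp hornerXn.
have [xm0 xm1] := pow01 x x0 x1.
apply/cvgrPdist_lt => e e0; move/cvgrPdist_lt: (cf _ xm0 xm1) => /(_ e e0)[K _ HK].
exists (m * K)%N => // N /= le_N; rewrite jet_dilate // horner_comp hornerXn.
by apply: HK; rewrite /= leq_divRL // mulnC (leq_trans le_N) // leq_addr.
Qed.

Definition eulerf (x : R) : R := lim ((fun N => \prod_(1 <= n < N.+1) (1 - x ^+ n)) @ \oo).

Lemma tame_one_subXn n : tame (1 - fpsX ^+ n) (fun x => 1 - x ^+ n).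
Proof.
have c k : (n < k)%N -> (1 - fpsX ^+ n : fps R) k = 0.
  by move=> lt; rewrite coefsB coefs1 coefs_Xn !gtn_eqF ?subrr // (leq_ltn_trans _ lt).
apply: eq_tame (tame_poly c) _ => x.
have -> : jet n.+1 (1 - fpsX ^+ n : fps R) = 1 - 'X^n.
  apply/polyP => k; rewrite coef_jet coefB coef1 coefXn; case: ltnP => [_|/c <-].
    by rewrite coefsB coefs1 coefs_Xn.
  by rewrite coefsB coefs1 coefs_Xn.
by rewrite !hornerE.
Qed.

Lemma tame_euler_part N :
  tame (euler_part R N) (fun x => \prod_(1 <= n < N.+1) (1 - x ^+ n)).
Proof.
elim: N => [|N IHN].
  by rewrite /euler_part big_geq //; apply: eq_tame (tame_nat 1) _ => x; rewrite big_geq.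
rewrite euler_partS; apply: (@eq_tame _ (fun x => (\prod_(1 <= n < N.+1) (1 - x ^+ n)) * (1 - x ^+ N.+1))).
  by apply: tame_mul => //; apply: tame_one_subXn.
by move=> x; rewrite [RHS]big_nat_recr.
Qed.

Lemma prod_cvg x : 0 < x -> x < 1 ->
  cvgn (fun N => \prod_(1 <= n < N.+1) (1 - x ^+ n)).
Proof.
move=> x0 x1.
have h n : 0 <= 1 - x ^+ n by rewrite subr_ge0 exprn_ile1 ?ltW.
apply: nonincreasing_is_cvgn.
  apply/nonincreasing_seqP => N; rewrite [X in X <= _]big_nat_recr //=.
  by rewrite ler_piMr ?prodr_ge0 // gerBl exprn_ge0 // ltW.
by exists 0 => _ [N _ <-]; rewrite prodr_ge0.
Qed.

(** Coefficientwise the partial product is dominated by that of the 1 + q^n, and at r this is at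
    most exp of the sum of r^n. The bound does not depend on N. *)
Lemma euler_part_bound N K r : 0 < r -> r < 1 ->
  (jet K (fabs (euler_part R N))).[r] <= expR ((1 - r)^-1).
Proof.
move=> r0 r1; apply: le_trans (_ : expR (\sum_(1 <= n < N.+1) r ^+ n) <= _); last first.
  rewrite ler_expR; rewrite -[leRHS]mul1r ler_pdivlMr ?subr_gt0 //.
  apply: le_trans (_ : (\sum_(i < N.+1) r ^+ i) * (1 - r) <= 1).
    apply: ler_wpM2r; first by rewrite subr_ge0 ltW.
    by rewrite -(big_mkord xpredT (fun k => r ^+ k)) [leRHS]big_ltn // lerDr.
  have -> : (\sum_(i < N.+1) r ^+ i) * (1 - r) = 1 - r ^+ N.+1.
    by rewrite -[RHS]opprB subrX1; ring.
  by rewrite gerBl exprn_ge0 // ltW.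
elim: N => [|N IHN].
  rewrite /euler_part !big_geq // expR0 jet_horner.
  case: K => [|K]; first by rewrite big_ord0.
  rewrite big_ord_recl big1 => [|i _]; last by rewrite /= normr0 mul0r.
  by rewrite /= normr1 mulr1 addr0.
rewrite euler_partS big_nat_recr //= expRD.
apply: le_trans (fabs_mul_le _ _ _ (ltW r0)) _; apply: ler_pM => //.
- by rewrite horner_coef sumr_ge0 // => k _; rewrite mulr_ge0 ?exprn_ge0 ?jet_fabs_ge0 ?ltW.
- by rewrite horner_coef sumr_ge0 // => k _; rewrite mulr_ge0 ?exprn_ge0 ?jet_fabs_ge0 ?ltW.
apply: le_trans _ (expR_ge1Dx _).
have -> : 1 + r ^+ N.+1 = (1 + 'X^(N.+1)).[r] by rewrite !hornerE.
apply: horner_le => [|n]; first exact: ltW.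
rewrite coef_jet coefD coef1 coefXn /= coefs_Xn.
case: ifP => _; last by rewrite addr_ge0.
by apply: le_trans (ler_normB _ _) _; rewrite !ger0_norm.
Qed.

Lemma tame_euler : tame (euler R) eulerf.
Proof.
have jet_part N r : (jet N.+1 (fabs (euler R))).[r] = (jet N.+1 (fabs (euler_part R N))).[r].
  by rewrite !jet_horner; apply: eq_bigr => k _; congr (`|_| * _); apply: euler_part_eqt.
have bound r : 0 < r -> r < 1 -> exists M, forall N, (jet N (fabs (euler R))).[r] <= M.
  move=> r0 r1; exists (expR ((1 - r)^-1)) => -[|N]; last first.
    by rewrite jet_part; apply: euler_part_bound.
  by rewrite jet_horner big_ord0 expR_ge0.
split=> // x x0 x1.
pose r := (x + 1) / 2; have xr : x < r by rewrite /r; lra.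
have r0 : 0 < r by rewrite /r; lra. have r1 : r < 1 by rewrite /r; lra.
(* The shift matches the N-th partial product, which has the right coefficients up to q^N
   inclusive. *)
rewrite -cvg_shiftS.
apply: (@cvg_squeeze0 _ (fun N => \prod_(1 <= n < N.+1) (1 - x ^+ n))
  (fun N => (x / r) ^+ N * expR ((1 - r)^-1))).
- move=> N /=.
  have -> : (jet N.+1 (euler R)).[x] = (jet N.+1 (euler_part R N)).[x].
    by rewrite !jet_horner; apply: eq_bigr => k _; congr (_ * _); apply: euler_part_eqt.
  have [_ /(_ x x0 x1) /cvgrPdist_lt h] := tame_euler_part N.
  have q0 : 0 <= x / r by rewrite divr_ge0 ?ltW.
  have q1 : x / r <= 1 by rewrite ler_pdivrMr // mul1r ltW.
  apply/ler_addgt0Pr => e e0; have [K _ HK] := h e e0.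
  (* The full polynomial [euler_part N] is reached through a longer truncation L, within e of its
     value. The coefficients between N.+1 and L are then estimated by [horner_tail]. *)
  pose L := (N.+1 + K)%N; have := HK L (leq_addl _ _).
  set p := \prod_(1 <= n < N.+1) _ => le_e.
  rewrite -(subrK (jet L (euler_part R N)).[x] (jet N.+1 (euler_part R N)).[x]) -addrA.
  apply: le_trans (ler_normD _ _) _; apply: lerD; last by rewrite distrC ltW.
  rewrite -hornerN -hornerD.
  apply: le_trans (@horner_tail _ _ (jet L (fabs (euler_part R N))) N x r (ltW x0) xr _ _) _.
  - by move=> n lt_nN; rewrite coefB !coef_jet ltnS (ltnW lt_nN) /L ltn_addr ?subrr // ltnS ltnW.
  - move=> n; rewrite coefB !coef_jet; case: (ltnP n N.+1) => [lt|le].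
      by rewrite /L ltn_addr // subrr normr0 /= normr_ge0.
    by case: ifP => _; rewrite sub0r normrN ?normr0.
  - by apply: ler_wpM2l; [apply: exprn_ge0 | apply: euler_part_bound].
- by apply: cvg_geometric0; [rewrite divr_ge0 ?ltW | rewrite ltr_pdivrMr ?mul1r].
- exact: prod_cvg.
Qed.

End Tame.

(** * A real power series is determined by its sum *)

Section Uniqueness.
Local Open Scope classical_set_scope.
Variable R : realType.
Implicit Types (f : fps R) (x r : R).

(** Convergence at 1/2 bounds the terms there, each being a difference of two consecutive partial
    sums; a geometric series of ratio 1/2 then bounds the absolute sums at 1/4. *)
Lemma jet_abs_bound f : (fun N => (jet N f).[1 / 2]) @ \oo --> (0 : R) ->
  exists2 B, 0 <= B & forall N, (jet N (fabs f)).[1 / 4] <= B.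
Proof.
move=> /cvgrPdist_lt /(_ 1 ltr01)[K _ HK].
have half_ge0 : 0 <= 1 / 2 :> R by lra.
pose M : R := 2 + \sum_(i < K) `|f i|.
have M0 : 0 <= M by rewrite addr_ge0 // sumr_ge0.
have jS N x : (jet N.+1 f).[x] = (jet N f).[x] + f N * x ^+ N.
  by rewrite !jet_horner big_ord_recr.
have hM n : `|f n| * (1 / 2) ^+ n <= M.
  case: (ltnP n K) => [lt_nK|le_Kn].
    apply: le_trans (_ : `|f n| <= _).
      by rewrite ler_piMr // exprn_ile1 //; lra.
    by rewrite /M (bigD1 (Ordinal lt_nK)) //= addrCA lerDl addr_ge0 // sumr_ge0.
  have h1 := HK n le_Kn; have h2 := HK n.+1 (leqW le_Kn).
  rewrite /= sub0r normrN in h1; rewrite /= sub0r normrN jS in h2.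
  have -> : `|f n| * (1 / 2) ^+ n = `|f n * (1 / 2) ^+ n|.
    by rewrite normrM (ger0_norm (exprn_ge0 n half_ge0)).
  apply: le_trans (_ : 2 <= _); last by rewrite /M lerDl sumr_ge0.
  rewrite -[f n * _](addKr (jet n f).[1 / 2]).
  apply: le_trans (ler_normD _ _) _; rewrite normrN; lra.
exists (M * 2); first by rewrite mulr_ge0.
move=> N; rewrite jet_horner.
apply: le_trans (_ : \sum_(i < N) M * (1 / 2) ^+ i <= _).
  apply: ler_sum => k _ /=.
  have -> : (1 / 4 : R) = (1 / 2) * (1 / 2) by lra.
  by rewrite exprMn mulrA; apply: ler_wpM2r => //; apply: exprn_ge0.
rewrite -mulr_sumr; apply: ler_wpM2l => //.
have -> : \sum_(i < N) (1 / 2) ^+ i = 2 * (1 - (1 / 2) ^+ N) :> R.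
  have := subrX1 (1 / 2 : R) N; set S := bigop _ _ _; lra.
have := exprn_ge0 N half_ge0.
lra.
Qed.

(** At the first nonzero coefficient f_n, the sum being 0, |f_n| x^n is at most the tail, which is
    of order x^(n + 1); dividing by x^n gives a contradiction for small x. *)
Lemma power_series_eq0 f :
  (forall x, 0 < x -> x < 1 -> (fun N => (jet N f).[x]) @ \oo --> (0 : R)) -> f = 0.
Proof.
move=> cf; have [] := @jet_abs_bound f; first by apply: cf; lra.
move=> B B0 hB; apply: fpsP; elim/ltn_ind => n IHn; apply/eqP/negPn/negP => fn0.
have fn_gt0 : 0 < `|f n| by rewrite normr_gt0.
pose c := (4 ^+ n.+1 * B + 1) : R; have c1 : 1 <= c by rewrite lerDr mulr_ge0 // exprn_ge0.
have key x : 0 < x -> x < 1 / 4 -> `|f n| <= x * (4 ^+ n.+1 * B).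
  move=> x0 x4; have xn0 : 0 < x ^+ n by rewrite exprn_gt0.
  rewrite -(ler_pM2r xn0); apply/ler_addgt0Pr => e e0.
  have x1 : x < 1 by lra.
  move/cvgrPdist_lt: (cf x x0 x1) => /(_ e e0)[K _ HK].
  pose L := (n.+1 + K)%N; have := HK L (leq_addl _ _); rewrite /= sub0r normrN => hL.
  have -> : `|f n| * x ^+ n = `|f n * x ^+ n|.
    by rewrite normrM (@ger0_norm _ (x ^+ n)) ?ltW.
  rewrite -[f n * _](subKr (jet L f).[x]) [leRHS]addrC.
  apply: le_trans (ler_normB _ _) _; apply: lerD; first exact: ltW.
  have -> : (jet L f).[x] - f n * x ^+ n = (jet L f - f n *: 'X^n).[x] by rewrite !hornerE.
  have -> : x * (4 ^+ n.+1 * B) * x ^+ n = (x / (1 / 4)) ^+ n.+1 * B.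
    rewrite (_ : x / (1 / 4) = x * 4); last by lra.
    by rewrite exprMn [x ^+ n.+1]exprS; ring.
  apply: le_trans (@horner_tail _ _ (jet L (fabs f)) n.+1 x (1 / 4) (ltW x0) x4 _ _) _.
  - move=> k; rewrite ltnS => le_kn; rewrite coefB coefZ coefXn coef_jet.
    rewrite (leq_trans (_ : k < n.+1)%N (leq_addr _ _)) //.
    move: le_kn; rewrite leq_eqVlt => /orP[/eqP ->|lt]; first by rewrite eqxx mulr1 subrr.
    by rewrite (IHn _ lt) (ltn_eqF lt) mulr0 subr0.
  - move=> k; rewrite coefB coefZ coefXn !coef_jet /=.
    case: eqP => [->|_]; last by rewrite mulr0 subr0; case: ifP; rewrite ?normr0.
    by rewrite /L addSn ltnS leq_addr mulr1 subrr normr0.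
  - apply: ler_wpM2l => //; rewrite exprn_ge0 // divr_ge0 ?ltW //; lra.
(* Small enough for x < 1/4 and for x c <= |f_n| / 2, against the bound |f_n| <= x c given by
   [key]. *)
pose x := Num.min (1 / 8) (`|f n| / (2 * c)).
have c0 : 0 < c by lra.
have x0 : 0 < x by rewrite lt_min divr_gt0 // ?divr_gt0 ?mulr_gt0.
have x8 : x <= 1 / 8 by rewrite ge_min lexx.
have xc : x * c <= `|f n| / 2.
  have : x <= `|f n| / (2 * c) by rewrite ge_min lexx orbT.
  by rewrite ler_pdivlMr ?mulr_gt0 //; lra.
have := key x x0; rewrite /c in xc; have : x < 1 / 4 by lra.
move=> h /(_ h); lra.
Qed.

End Uniqueness.

(** * Fourier expansions *)

Section Bridge.
Local Open Scope complex_scope.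
Local Open Scope classical_set_scope.
Variable R : realType.
Implicit Types (x y : R) (u : nat -> cplx R).

Lemma normc_ge_Im (w : cplx R) : `|complex.Im w|%:C <= `|w|.
Proof. by rewrite normc_def lecR -sqrtr_sqr ler_wsqrtr // lerDr sqr_ge0. Qed.

Lemma norm_real_complex x : `|(x%:C : cplx R)| = `|x|%:C.
Proof. by rewrite normc_def /= expr0n addr0 sqrtr_sqr. Qed.

Lemma cvg_ReIm u (l : cplx R) : u @ \oo --> l ->
  (fun N => complex.Re (u N)) @ \oo --> complex.Re l /\
  (fun N => complex.Im (u N)) @ \oo --> complex.Im l.
Proof.
move=> /cvgrPdist_lt h; split; apply/cvgrPdist_lt => e e0;
  have e0' : 0 < e%:C :> cplx R by rewrite ltcR.
- have [K _ HK] := h _ e0'; exists K => // N /HK /=; rewrite -ltcR; apply: le_lt_trans.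
  have -> : complex.Re l - complex.Re (u N) = complex.Re (l - u N) by case: (l) (u N) => [? ?] [? ?].
  exact: normc_ge_Re.
- have [K _ HK] := h _ e0'; exists K => // N /HK /=; rewrite -ltcR; apply: le_lt_trans.
  have -> : complex.Im l - complex.Im (u N) = complex.Im (l - u N) by case: (l) (u N) => [? ?] [? ?].
  exact: normc_ge_Im.
Qed.

Lemma cvg_real_complex (v : nat -> R) (l : R) :
  v @ \oo --> l -> (fun N => (v N)%:C : cplx R) @ \oo --> (l%:C : cplx R).
Proof.
move=> /cvgrPdist_lt h; apply/cvgrPdist_lt => e e0.
(* A positive element in the order on complex numbers is real. *)
have eE : e = (complex.Re e)%:C by rewrite RRe_real // gtr0_real.
have e0' : 0 < complex.Re e by rewrite -ltcR -eE.
have [K _ HK] := h _ e0'; exists K => // N /HK /=.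
by rewrite -raddfB norm_real_complex eE ltcR.
Qed.

Lemma qpow_im (c y : R) : qpow c (0 +i* y : cplx R) = (expR (- (2 * pi * c * y)))%:C.
Proof.
rewrite /qpow /cexp.
have -> : (2%:R * pi * c)%:C * 'i%C * (0 +i* y) = (- (2 * pi * c * y))%:C :> cplx R.
  by apply/eqP; rewrite eq_complex /=; apply/andP; split; apply/eqP; ring.
by rewrite /= cos0 sin0 mulr1 mulr0.
Qed.

Definition nome y : R := expR (- (2 * pi * y)).

Lemma nome_gt0 y : 0 < nome y. Proof. exact: expR_gt0. Qed.

Lemma nome_lt1 y : 0 < y -> nome y < 1.
Proof. by move=> y0; rewrite expR_lt1 oppr_lt0 !mulr_gt0 // pi_gt0. Qed.

Lemma nome_natM m y : nome (m%:R * y) = nome y ^+ m.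
Proof. by rewrite /nome -expRM_natl; congr expR; ring. Qed.

Lemma nome_surj x : 0 < x -> x < 1 -> exists2 y, 0 < y & nome y = x.
Proof.
move=> x0 x1; have p0 : 0 < 2 * pi :> R by rewrite mulr_gt0 // pi_gt0.
exists (- ln x / (2 * pi)); first by rewrite divr_gt0 // oppr_gt0 ln_lt0 // x0.
by rewrite /nome mulrC divfK ?gt_eqF // opprK lnK.
Qed.

Lemma eta_im y : 0 < y ->
  eta (0 +i* y : cplx R) = (expR (- (2 * pi * 24%:R^-1 * y)) * eulerf (nome y))%:C.
Proof.
move=> y0; rewrite /eta qpow_im rmorphM; congr (_ * _).
apply: cvg_lim; first exact: norm_hausdorff.
have q1 : qpow 1 (0 +i* y : cplx R) = (nome y)%:C by rewrite qpow_im mulr1.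
have -> : (fun N : nat => \prod_(1 <= n < N.+1) (1 - qpow 1 (0 +i* y : cplx R) ^+ n))
    = (fun N => (\prod_(1 <= n < N.+1) (1 - nome y ^+ n))%:C).
  apply/funext => N; rewrite q1 rmorph_prod; apply: eq_bigr => n _.
  by rewrite rmorphB rmorph1 rmorphXn.
apply: cvg_real_complex; apply: prod_cvg; [exact: nome_gt0 | exact: nome_lt1].
Qed.

Lemma qpow24 y m : expR (- (2 * pi * 24%:R^-1 * (m%:R * y))) ^+ 24 = nome y ^+ m :> R.
Proof. by rewrite -nome_natM -expRM_natl /nome; congr expR; field. Qed.

Lemma mulr_im m y : m%:R * (0 +i* y : cplx R) = 0 +i* (m%:R * y).
Proof.
have -> : (m%:R : cplx R) = (m%:R)%:C by rewrite rmorph_nat.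
by apply/eqP; rewrite eq_complex /=; apply/andP; split; apply/eqP; ring.
Qed.

(** On the imaginary axis q and the sum are real, so the series of the real parts of a has sum v and
    that of the imaginary parts has sum 0; [power_series_eq0] applies to each, every q in ]0, 1[
    being reached. *)
Lemma qexp_coefs (F : fps R) (v : R -> R) (a : nat -> cplx R) (f : cplx R -> cplx R) :
  tame F v -> F 0%N = 0 -> q_expansion a f ->
  (forall y, 0 < y -> f (0 +i* y) = (v (nome y))%:C) ->
  forall n, (0 < n)%N -> a n = (F n)%:C.
Proof.
move=> [_ cF] F0 ha hf.
have h y : 0 < y -> 
    (fun N => \sum_(1 <= n < N.+1) complex.Re (a n) * nome y ^+ n) @ \oo --> v (nome y) /\
    (fun N => \sum_(1 <= n < N.+1) complex.Im (a n) * nome y ^+ n) @ \oo --> (0 : R).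
  move=> y0; have := ha (0 +i* y) y0; rewrite hf // => /cvg_ReIm /= [].
  have q1 n : qpow 1 (0 +i* y : cplx R) ^+ n = (nome y ^+ n)%:C by rewrite qpow_im mulr1 rmorphXn.
  have e N : \sum_(1 <= n < N.+1) a n * qpow 1 (0 +i* y : cplx R) ^+ n
    = (\sum_(1 <= n < N.+1) complex.Re (a n) * nome y ^+ n) +i*
      (\sum_(1 <= n < N.+1) complex.Im (a n) * nome y ^+ n).
    elim: N => [|N IHN]; first by rewrite !big_geq.
    have S (V : nmodType) (g : nat -> V) :
        \sum_(1 <= n < N.+2) g n = \sum_(1 <= n < N.+1) g n + g N.+1.
      by rewrite big_nat_recr.
    rewrite !S IHN q1; case: (a N.+1) => u w.
    by apply/eqP; rewrite eq_complex /=; apply/andP; split; apply/eqP; ring.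
  set uR := (fun _ => complex.Re _); set uI := (fun _ => complex.Im _).
  have -> : uR = fun N => \sum_(1 <= n < N.+1) complex.Re (a n) * nome y ^+ n.
    by apply/funext => N; rewrite /uR e.
  have -> // : uI = fun N => \sum_(1 <= n < N.+1) complex.Im (a n) * nome y ^+ n.
  by apply/funext => N; rewrite /uI e.
have jE (g : fps R) x : g 0%N = 0 -> (fun N => \sum_(1 <= n < N.+1) g n * x ^+ n) =
    (fun N => (jet N.+1 g).[x]).
  move=> g0; apply/funext => N.
  by rewrite jet_horner -(big_mkord xpredT (fun k => g k * x ^+ k)) [RHS]big_ltn // g0 mul0r add0r.
(* The coefficient at 0 is forced to 0, since [q_expansion] says nothing about a 0. *)
pose G1 : fps R := Fps (fun n => if n == 0%N then 0 else complex.Re (a n) - F n).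
pose G2 : fps R := Fps (fun n => if n == 0%N then 0 else complex.Im (a n)).
have G10 : G1 = 0.
  apply: power_series_eq0 => x x0 x1; have [y y0 yx] := nome_surj x0 x1.
  have [hR _] := h y y0; rewrite yx in hR.
  have cF' : (fun N => (jet N.+1 F).[x]) @ \oo --> v x.
    by have := cF x x0 x1; rewrite -cvg_shiftS.
  have c0 := cvgB hR cF'; rewrite subrr in c0.
  rewrite -cvg_shiftS; apply: cvg_trans (c0 _).
  rewrite -(jE F) // -jE //; apply: near_eq_cvg; near=> N; rewrite !fctE /= -sumrB.
  by apply: eq_big_nat => n /andP[n0 _]; rewrite eqn0Ngt n0 mulrBl.
have G20 : G2 = 0.
  apply: power_series_eq0 => x x0 x1; have [y y0 yx] := nome_surj x0 x1.
  have [_ hI] := h y y0; rewrite yx in hI.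
  rewrite -cvg_shiftS; apply: cvg_trans hI.
  rewrite -jE //; apply: near_eq_cvg; near=> N.
  by apply: eq_big_nat => n /andP[n0 _]; rewrite /= eqn0Ngt n0.
move=> n n0; have e1 : G1 n = 0 by rewrite G10. have e2 : G2 n = 0 by rewrite G20.
move: e1 e2; rewrite /= eqn0Ngt n0 /=; case: (a n) => u w /= /subr0_eq -> ->.
by [].
Unshelve. all: by end_near.
Qed.

End Bridge.

(** * The two identities *)

Section Main.
Variable K : numFieldType.
Local Notation sig := (@sig K).
Local Notation sig' k := (dilate 3 (sig k)).
Local Notation A := (borA K).
Local Notation B := (borB K).
Local Notation C := (borC K).
Local Notation Q := (eisQ K).
Local Notation R := (eisR K).
Local Notation e1 := (fps_eta K 1).
Local Notation e3 := (fps_eta K 3).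
Local Notation e9 := (fps_eta K 9).

(** In this series and the next two, the power of q gathers the leading factors: a product of eta(m
    z)^k starts at q to the sum of the k m, divided by 24. For the third this gives 1, 3 and 2. *)
Definition ser_tau : fps K := fpsX * e1 ^+ 24.
Definition ser_tau63 : fps K := fpsX * e1 ^+ 6 * e3 ^+ 6.
Definition ser_tau83 : fps K :=
  fpsX * e1 ^+ 12 * e3 ^+ 4 + 81%:R * fpsX ^+ 3 * e1 ^+ 6 * e3 ^+ 4 * e9 ^+ 6
  + 18%:R * fpsX ^+ 2 * e1 ^+ 9 * e3 ^+ 4 * e9 ^+ 3.

Lemma lin4 (c1 c2 c3 c4 l r u1 v1 u2 v2 u3 v3 u4 v4 : fps K) :
  u1 = v1 -> u2 = v2 -> u3 = v3 -> u4 = v4 ->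
  l - r = c1 * (u1 - v1) + c2 * (u2 - v2) + c3 * (u3 - v3) + c4 * (u4 - v4) -> l = r.
Proof. by move=> -> -> -> ->; rewrite !subrr !mulr0 !addr0 => /subr0_eq. Qed.

Lemma eta_exp0 m k : (fps_eta K m ^+ k) 0%N != 0.
Proof. by rewrite coefsX0 coefs_eta0 expr1n oner_neq0. Qed.

Lemma ser_tau63E : 27%:R * ser_tau63 = C * B.
Proof.
apply: (fps_cancel (eta_exp0 3 3)); apply: (fps_cancel (eta_exp0 1 3)).
apply: (lin2 (c := - e3 ^+ 3 * B) (c' := - (27%:R * fpsX * e3 ^+ 9)) (borC_eta K) (borB_eta K)).
by rewrite /ser_tau63; ring.
Qed.

Lemma ser_tauE : 27%:R * ser_tau = C * B ^+ 3.
Proof.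
apply: (fps_cancel (eta_exp0 3 9)); apply: (fps_cancel (eta_exp0 1 3)).
have e : (B * e3 ^+ 3) ^+ 3 = (e1 ^+ 9) ^+ 3 by rewrite borB_eta.
apply: (lin2 (c := - e3 ^+ 9 * B ^+ 3) (c' := - (27%:R * fpsX * e3 ^+ 9)) (borC_eta K) e).
by rewrite /ser_tau; ring.
Qed.

(** Up to the factor q e1^6 e3^4, the three eta products are the terms of the square of e1^3 + 9 q
    e9^3, that is of A e3. *)
Lemma ser_tau83E : ser_tau83 = A ^+ 2 * ser_tau63.
Proof.
have [e _] := cubic_eta K.
have {}e : (A * e3) ^+ 2 = (e1 ^+ 3 + 9%:R * fpsX * e9 ^+ 3) ^+ 2 by rewrite e.
apply: (fps_cancel (eta_exp0 3 2)).
apply: (lin1 (c := - ser_tau63) e).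
by rewrite /ser_tau83 /ser_tau63; ring.
Qed.

Lemma dilateD m (f g : fps K) : dilate m (f + g) = dilate m f + dilate m g.
Proof. exact: raddfD. Qed.

Lemma identity24 : 50443%:R * A ^+ 12 = 50443%:R
  + 6552%:R * (sig 11 + 729%:R * sig' 11) + 2177152%:R * ser_tau
  + 1186848%:R * (Q * ser_tau83) + 261344%:R * (R * ser_tau63).
Proof.
have E12 := eis12 K.
have E12' := congr1 (dilate 3) E12.
rewrite (dilateD 3 691%:R) (dilateD 3 (441%:R * Q ^+ 3)) in E12'.
rewrite (@dilate_nat K 3 isT 691) (@dilate_natM K 3 isT 65520) (@dilate_natM K 3 isT 441) in E12'.
rewrite (@dilate_natM K 3 isT 250) (@dilateX K 3 isT Q) (@dilateX K 3 isT R) in E12'.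
have q3 := dilate_eisQE K; have r3 := dilate_eisRE K.
have {}E12' : 729%:R * (691%:R + 65520%:R * sig' 11)
    = 441%:R * (9%:R * A ^+ 4 - 8%:R * A * C) ^+ 3
      + 250%:R * (27%:R * A ^+ 6 - 36%:R * A ^+ 3 * C + 8%:R * C ^+ 2) ^+ 2.
  by rewrite -q3 -r3; apply: (lin1 (c := 729%:R) E12'); ring.
rewrite ser_tau83E eisQE eisRE in E12 *.
(* The multiplier is 270 = 27 * 10: 27 matches the cusp forms given as multiples of [ser_tau] and
   [ser_tau63], and 10 comes from 65520 = 10 * 6552. *)
apply: (@fps_nat_cancel _ 269).
have t6 := ser_tau63E; have t24 := ser_tauE.
apply: (lin4 (c1 := - 27%:R) (c2 := - 27%:R) (c3 := - 21771520%:R)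
  (c4 := - (11868480%:R * ((A ^+ 4 + 8%:R * A * C) * A ^+ 2)
  + 2613440%:R * (A ^+ 6 - 20%:R * A ^+ 3 * C - 8%:R * C ^+ 2))) E12 E12' t24 t6).
by rewrite /borC; ring.
Qed.

Lemma identity28 : 1093%:R * A ^+ 14 = 1093%:R
  + 12%:R * (sig 13 - 2187%:R * sig' 13) + 107264%:R * ser_tau
  + 1287168%:R * (sig 1 * ser_tau - 3%:R * (sig' 1 * ser_tau))
  - 12448%:R * (R * ser_tau83) - 3016%:R * (Q ^+ 2 * ser_tau63).
Proof.
have E14 := eis14 K.
have E14' := congr1 (dilate 3) E14.
rewrite (dilate_additive 3 1) (@dilate1 K 3 isT) (@dilate_natM K 3 isT 24) in E14'.
rewrite (@dilateM K 3 isT (Q ^+ 2)) (@dilateX K 3 isT Q) in E14'.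
have q3 := dilate_eisQE K; have r3 := dilate_eisRE K.
have {}E14' : 2187%:R * (1 - 24%:R * sig' 13)
    = (9%:R * A ^+ 4 - 8%:R * A * C) ^+ 2
      * (27%:R * A ^+ 6 - 36%:R * A ^+ 3 * C + 8%:R * C ^+ 2).
  by rewrite -q3 -r3; apply: (lin1 (c := 2187%:R) E14'); ring.
have a2 := borA_sqr K.
rewrite ser_tau83E eisQE eisRE in E14 *.
(* Here 54 = 27 * 2, with 2 coming from 24 = 2 * 12. *)
apply: (@fps_nat_cancel _ 53).
have t6 := ser_tau63E; have t24 := ser_tauE.
(* The products of [sig 1] and its dilation with [ser_tau] enter only through A^2 [ser_tau]. *)
have {}t24 : 27%:R * ((1 + 12%:R * sig 1 - 36%:R * sig' 1) * ser_tau) = A ^+ 2 * (C * B ^+ 3).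
  by rewrite -t24 -a2; ring.
apply: (lin4 (c1 := 27%:R) (c2 := - 27%:R) (c3 := - 214528%:R)
  (c4 := 24896%:R * ((A ^+ 6 - 20%:R * A ^+ 3 * C - 8%:R * C ^+ 2) * A ^+ 2)
     + 6032%:R * (A ^+ 4 + 8%:R * A * C) ^+ 2) E14 E14' t24 t6).
by rewrite /borC; ring.
Qed.

End Main.

(** * From identities of power series to formulas for coefficients *)

Section Coefficients.
Variable K : numFieldType.
Local Notation sig := (@sig K).
Local Notation sig' k := (dilate 3 (sig k)).

Lemma sigma_sig r n : (0 < n)%N -> sigma K r n = sig r n.
Proof. by move=> n0; rewrite /sigma eqn0Ngt n0 coefs_lam. Qed.

Lemma sigma_star_sig l n : (0 < n)%N ->
  sigma_star K l n = sig l n + (- 3%:R) ^+ (l.+1 %/ 2) * sig' l n.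
Proof.
move=> n0; rewrite /sigma_star sigma_sig // coefs_dilate; case: ifP => // n3.
by rewrite sigma_sig // divn_gt0 // dvdn_leq.
Qed.

Lemma sum_convolution (f g : fps K) n :
  \sum_(0 <= a < n.+1) \sum_(0 <= b < n.+1 | (a + b)%N == n) f a * g b = (f * g) n.
Proof.
rewrite coefsM big_mkord; apply: eq_bigr => k _.
have le_kn : (k <= n)%N by rewrite -ltnS.
rewrite (eq_bigl (fun b => b == n - k)%N) => [|b]; last by rewrite eq_sym -(eqn_add2l k b) subnKC // eq_sym.
by rewrite big_nat1_eq /= ltnS leq_subr.
Qed.

(** The vanishing constant terms let the sums start at 1; the coefficient m gives both convolutions
    of sigma with tau, for m = 1 and m = 3. *)
Lemma sum_convolution_pos (f g : fps K) m n : (0 < m)%N -> f 0%N = 0 -> g 0%N = 0 ->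
  \sum_(1 <= a < n.+1) \sum_(1 <= b < n.+1 | (m * a + b)%N == n) f a * g b
  = (dilate m f * g) n.
Proof.
move=> m0 f0 g0; rewrite coefsM -(big_mkord xpredT (fun k => dilate m f k * g (n - k)%N)).
have dE k : (0 <= k < n.+1)%N -> dilate m f k * g (n - k)%N
    = \sum_(1 <= a < n.+1) (if (m * a == k)%N then f a * g (n - k)%N else 0).
  move=> lt_kn; rewrite coefs_dilate; case: ifP => [/dvdnP[j kE]|mk]; last first.
    rewrite mul0r big1 // => a _; case: eqP => // e; by rewrite -e dvdn_mulr in mk.
  rewrite kE in lt_kn *; rewrite mulnK // -big_mkcond.
  rewrite (eq_bigl (fun a => a == j)) => [|a]; last by rewrite mulnC eqn_pmul2r.
  rewrite big_nat1_eq; case: ifP => // /negbT; rewrite negb_and -leqNgt -leqNgt.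
  by case: j {kE} lt_kn => [|j] lt_kn h; [rewrite f0 mul0r | have := leq_pmulr j.+1 m0; lia].
rewrite (eq_big_nat _ _ dE) exchange_big /=; apply: eq_big_nat => a _.
rewrite -[RHS]big_mkcond.
rewrite [RHS](eq_bigl (fun k => k == m * a)%N) => [|k]; last by rewrite eq_sym.
rewrite [RHS]big_nat1_eq /= ltnS; case: leqP => h; last first.
  rewrite big1 // => b /eqP e; move: h; rewrite -e; lia.
rewrite (eq_bigl (fun b => b == n - m * a)%N) => [|b]; last first.
  by rewrite eq_sym -(eqn_add2l (m * a) b) subnKC // eq_sym.
rewrite big_nat1_eq; case: ifP => // /negbT; rewrite negb_and -leqNgt -leqNgt.
case/orP => [|h']; last by exfalso; lia.
by case: (n - m * a)%N => // _; rewrite g0 mulr0.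
Qed.

Definition ser_sigma r : fps K := Fps (sigma K r).

Lemma sigma3_0 : sigma K 3 0 = 240%:R^-1. Proof. by []. Qed.
Lemma sigma5_0 : sigma K 5 0 = - 504%:R^-1. Proof. by []. Qed.
Lemma sigma7_0 : sigma K 7 0 = 480%:R^-1. Proof. by []. Qed.

Lemma ser_sigmaE r n : ser_sigma r n = sigma K r n. Proof. by []. Qed.

(** The values of [sigma] at 0 are those that make c times the series an Eisenstein series with
    constant term eps, equal to 1 or -1. *)
Lemma ser_sigma_affine r (c : nat) (eps : K) : c != 0%N -> sigma K r 0 = eps / c%:R ->
  c%:R * ser_sigma r = fpsC eps + c%:R * sig r.
Proof.
move=> c0 e; apply: fpsP => -[|n]; rewrite coefsD !coefs_natM.
  rewrite ser_sigmaE e mulrC divfK ?pnatr_eq0 //.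
  by rewrite [sig r 0%N]/(0) mulr0 addr0 [RHS]mulr1.
by rewrite ser_sigmaE sigma_sig // [fpsC eps n.+1]mulr0 add0r.
Qed.

Lemma ser_sigma3 : 240%:R * ser_sigma 3 = eisQ K.
Proof. by rewrite (@ser_sigma_affine 3 240 1) ?fpsC1 // sigma3_0 div1r. Qed.

Lemma ser_sigma5 : 504%:R * ser_sigma 5 = - eisR K.
Proof.
rewrite (@ser_sigma_affine 5 504 (-1)) //; last by rewrite sigma5_0 mulN1r.
have -> : fpsC (- 1) = - 1 :> fps K by rewrite -fpsC1; apply: fpsP => n; rewrite coefsN /= mulNr.
by rewrite /eisR; ring.
Qed.

Lemma ser_sigma7 : 480%:R * ser_sigma 7 = eisQ K ^+ 2.
Proof. by rewrite (@ser_sigma_affine 7 480 1) ?fpsC1 ?eis8 // sigma7_0 div1r. Qed.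

Lemma coefs_comb24 (c0 c c1 c2 c3 c4 c5 : nat) (F s s' t u v : fps K) n : (0 < n)%N ->
  c0%:R * F = c%:R + c1%:R * (s + c2%:R * s') + c3%:R * t + c4%:R * u + c5%:R * v ->
  c0%:R * F n = c1%:R * (s n + c2%:R * s' n) + c3%:R * t n + c4%:R * u n + c5%:R * v n.
Proof.
move=> n0 e; rewrite -coefs_natM e 4!coefsD 4!coefs_natM coefsD coefs_natM.
by rewrite coefs_nat eqn0Ngt n0 mulr0 add0r.
Qed.

Lemma coefs_comb28 (c0 c c1 c2 c3 c4 c5 c6 c7 : nat) (F s s' t p q u v : fps K) n : (0 < n)%N ->
  c0%:R * F = c%:R + c1%:R * (s - c2%:R * s') + c3%:R * t + c4%:R * (p - c5%:R * q)
              - c6%:R * u - c7%:R * v ->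
  c0%:R * F n = c1%:R * (s n - c2%:R * s' n) + c3%:R * t n + c4%:R * (p n - c5%:R * q n)
              - c6%:R * u n - c7%:R * v n.
Proof.
move=> n0 e; rewrite -coefs_natM e 2!coefsB 3!coefsD 5!coefs_natM 2!coefsB 2!coefs_natM.
by rewrite coefs_nat eqn0Ngt n0 mulr0 add0r.
Qed.

Lemma solve24 (F x y z u v : K) :
  50443%:R * F = 6552%:R * (x + 729%:R * y) + 2177152%:R * z
    + 1186848%:R * (240%:R * u) + 261344%:R * (- (504%:R * v)) ->
  F = 6552%:R / (73%:R * 691%:R) * (x + (- 3%:R) ^+ (12 %/ 2) * y)
      + 29824%:R / 691%:R * z + 240%:R * 1186848%:R / 50443%:R * u
      - 504%:R * 261344%:R / 50443%:R * v.
Proof.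
have -> : (- 3%:R) ^+ (12 %/ 2) = 729%:R :> K by rewrite (_ : (12 %/ 2)%N = 6) //; ring.
move=> h; have c0 : 50443%:R != 0 :> K by rewrite pnatr_eq0.
by apply: (mulfI c0); apply: etrans h _; field.
Qed.

Lemma solve28 (F x y z p q u v : K) :
  1093%:R * F = 12%:R * (x - 2187%:R * y) + 107264%:R * z + 1287168%:R * (p - 3%:R * q)
    - 12448%:R * (- (504%:R * u)) - 3016%:R * (480%:R * v) ->
  F = 12%:R / 1093%:R * (x + (- 3%:R) ^+ (14 %/ 2) * y)
      + 107264%:R / 1093%:R * z + 107264%:R * 12%:R / 1093%:R * (p - 3%:R * q)
      + 12448%:R * 504%:R / 1093%:R * u - 3016%:R * 480%:R / 1093%:R * v.
Proof.
have -> : (- 3%:R) ^+ (14 %/ 2) = - 2187%:R :> K by rewrite (_ : (14 %/ 2)%N = 7) //; ring.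
move=> h; have c0 : 1093%:R != 0 :> K by rewrite pnatr_eq0.
by apply: (mulfI c0); apply: etrans h _; field.
Qed.

Variable w : K.
Hypothesis w_root : w ^+ 2 + w + 1 = 0.
Variables tau tau63 tau83 : nat -> K.
Hypothesis tauE : forall n, (0 < n)%N -> tau n = ser_tau K n.
Hypothesis tau63E : forall n, tau63 n = ser_tau63 K n.
Hypothesis tau83E : forall n, tau83 n = ser_tau83 K n.
Variable n : nat.
Hypothesis n_gt0 : (0 < n)%N.

Lemma rep_count_theta k : (rep_count k n)%:R = (borA K ^+ k) n.
Proof. by rewrite rep_countE (size_qreps K) (lorenz w_root). Qed.

Lemma rep_count24 : (rep_count 12 n)%:R =
      6552%:R / (73%:R * 691%:R) * sigma_star K 11 n
      + 29824%:R / 691%:R * tau n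
      + 240%:R * 1186848%:R / 50443%:R *
          (\sum_(0 <= a < n.+1) \sum_(0 <= b < n.+1 | (a + b)%N == n)
              sigma K 3 a * tau83 b)
      - 504%:R * 261344%:R / 50443%:R *
          (\sum_(0 <= a < n.+1) \sum_(0 <= b < n.+1 | (a + b)%N == n)
              sigma K 5 a * tau63 b).
Proof.
have s3 : \sum_(0 <= a < n.+1) \sum_(0 <= b < n.+1 | (a + b)%N == n) sigma K 3 a * tau83 b
    = (ser_sigma 3 * ser_tau83 K) n.
  rewrite -sum_convolution; apply: eq_bigr => a _; apply: eq_bigr => b _.
  by rewrite tau83E.
have s5 : \sum_(0 <= a < n.+1) \sum_(0 <= b < n.+1 | (a + b)%N == n) sigma K 5 a * tau63 b
    = (ser_sigma 5 * ser_tau63 K) n.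
  rewrite -sum_convolution; apply: eq_bigr => a _; apply: eq_bigr => b _.
  by rewrite tau63E.
rewrite s3 s5 rep_count_theta (sigma_star_sig 11 n_gt0) (tauE n_gt0).
have h3 : (eisQ K * ser_tau83 K) n = 240%:R * (ser_sigma 3 * ser_tau83 K) n.
  by rewrite -ser_sigma3 -mulrA coefs_natM.
have h5 : (eisR K * ser_tau63 K) n = - (504%:R * (ser_sigma 5 * ser_tau63 K) n).
  by rewrite -[eisR K]opprK -ser_sigma5 mulNr coefsN -mulrA coefs_natM.
have h := coefs_comb24 n_gt0 (identity24 K).
rewrite h3 h5 in h.
exact: solve24 h.
Qed.

Lemma rep_count28 : (rep_count 14 n)%:R =
      12%:R / 1093%:R * sigma_star K 13 n
      + 107264%:R / 1093%:R * tau n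
      + 107264%:R * 12%:R / 1093%:R *
          ((\sum_(1 <= a < n.+1) \sum_(1 <= b < n.+1 | (a + b)%N == n)
              sigma K 1 a * tau b)
           - 3%:R *
             (\sum_(1 <= a < n.+1) \sum_(1 <= b < n.+1 | (3 * a + b)%N == n)
                 sigma K 1 a * tau b))
      + 12448%:R * 504%:R / 1093%:R *
          (\sum_(0 <= a < n.+1) \sum_(0 <= b < n.+1 | (a + b)%N == n)
              sigma K 5 a * tau83 b)
      - 3016%:R * 480%:R / 1093%:R *
          (\sum_(0 <= a < n.+1) \sum_(0 <= b < n.+1 | (a + b)%N == n)
              sigma K 7 a * tau63 b).
Proof.
have s5 : \sum_(0 <= a < n.+1) \sum_(0 <= b < n.+1 | (a + b)%N == n) sigma K 5 a * tau83 b
    = (ser_sigma 5 * ser_tau83 K) n.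
  rewrite -sum_convolution; apply: eq_bigr => a _; apply: eq_bigr => b _.
  by rewrite tau83E.
have s7 : \sum_(0 <= a < n.+1) \sum_(0 <= b < n.+1 | (a + b)%N == n) sigma K 7 a * tau63 b
    = (ser_sigma 7 * ser_tau63 K) n.
  rewrite -sum_convolution; apply: eq_bigr => a _; apply: eq_bigr => b _.
  by rewrite tau63E.
have t0 : ser_tau K 0%N = 0 by rewrite coefsM0 mul0r.
have pos_sum m : (0 < m)%N ->
    \sum_(1 <= a < n.+1) \sum_(1 <= b < n.+1 | (m * a + b)%N == n) sigma K 1 a * tau b
    = (dilate m (sig 1) * ser_tau K) n.
  move=> m0; rewrite -(sum_convolution_pos n m0 (erefl : sig 1 0%N = 0) t0).
  apply: eq_big_nat => a /andP[a0 _]; rewrite big_seq_cond [RHS]big_seq_cond.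
  apply: eq_bigr => b /andP[]; rewrite mem_index_iota => /andP[b0 _] _.
  by rewrite sigma_sig // tauE.
have p1 : \sum_(1 <= a < n.+1) \sum_(1 <= b < n.+1 | (a + b)%N == n) sigma K 1 a * tau b
    = (sig 1 * ser_tau K) n.
  rewrite -[sig 1]dilate_1 -pos_sum //; apply: eq_bigr => a _.
  by apply: eq_bigl => b; rewrite mul1n.
rewrite p1 (pos_sum 3%N isT) s5 s7 rep_count_theta (sigma_star_sig 13 n_gt0) (tauE n_gt0).
have h5 : (eisR K * ser_tau83 K) n = - (504%:R * (ser_sigma 5 * ser_tau83 K) n).
  by rewrite -[eisR K]opprK -ser_sigma5 mulNr coefsN -mulrA coefs_natM.
have h7 : (eisQ K ^+ 2 * ser_tau63 K) n = 480%:R * (ser_sigma 7 * ser_tau63 K) n.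
  by rewrite -ser_sigma7 -mulrA coefs_natM.
have h := coefs_comb28 n_gt0 (identity28 K).
rewrite h5 h7 in h.
exact: solve28 h.
Qed.

End Coefficients.

Lemma ser_tau83_0 (L : numFieldType) : ser_tau83 L 0%N = 0.
Proof.
have D (f g : fps L) : f 0%N = 0 -> g 0%N = 0 -> (f + g : fps L) 0%N = 0.
  by rewrite coefsD => -> ->; rewrite addr0.
have Ml (f g : fps L) : f 0%N = 0 -> (f * g : fps L) 0%N = 0.
  by rewrite coefsM0 => ->; rewrite mul0r.
have Mr (f g : fps L) : g 0%N = 0 -> (f * g : fps L) 0%N = 0.
  by rewrite coefsM0 => ->; rewrite mulr0.
have X k : ((fpsX : fps L) ^+ k.+1) 0%N = 0 by rewrite coefsX0 expr0n.
apply: (D); first apply: (D).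
- by apply: (Ml); apply: (Ml); apply: (X 0%N).
- by apply: (Ml); apply: (Ml); apply: (Ml); apply: (Mr); apply: (X 2%N).
- by apply: (Ml); apply: (Ml); apply: (Ml); apply: (Mr); apply: (X 1%N).
Qed.

(** * Transfer from real to complex coefficients *)

Section Complexify.
Local Open Scope complex_scope.
Variable R : realType.
Local Notation K := (cplx R).
Implicit Types f g : fps R.

(** Sums of series are studied over R, whereas the Fourier coefficients are complex. *)
Definition fpsmap f : fps K := Fps (fun n => (f n)%:C).

Lemma fpsmapE f n : fpsmap f n = (f n)%:C. Proof. by []. Qed.

Lemma fpsmapM f g : fpsmap (f * g) = fpsmap f * fpsmap g.
Proof.
apply: fpsP => n; rewrite fpsmapE !coefsM rmorph_sum.
by apply: eq_bigr => k _; rewrite rmorphM.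
Qed.

Lemma fpsmapD f g : fpsmap (f + g) = fpsmap f + fpsmap g.
Proof. by apply: fpsP => n; rewrite fpsmapE !coefsD rmorphD. Qed.

Lemma fpsmap_nat k : fpsmap k%:R = k%:R.
Proof. by apply: fpsP => n; rewrite fpsmapE !coefs_nat rmorphM !rmorph_nat. Qed.

Lemma fpsmapX f k : fpsmap (f ^+ k) = fpsmap f ^+ k.
Proof. by elim: k => [|k IHk]; rewrite ?(fpsmap_nat 1) // !exprS fpsmapM IHk. Qed.

Lemma fpsmapXf : fpsmap fpsX = fpsX.
Proof. by apply: fpsP => n; rewrite /= rmorph_nat. Qed.

Lemma fpsmap_eta m : fpsmap (fps_eta R m) = fps_eta K m.
Proof.
have part N : fpsmap (euler_part R N) = euler_part K N.
  elim: N => [|N IHN]; first by rewrite /euler_part !big_geq // (fpsmap_nat 1).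
  rewrite !euler_partS fpsmapM IHN; congr (_ * _).
  apply: fpsP => n; rewrite fpsmapE !coefsB rmorphB.
  by rewrite !coefs1 !coefs_Xn !rmorph_nat.
apply: fpsP => n; rewrite fpsmapE !coefs_dilate; case: ifP => // _.
by rewrite -[LHS]fpsmapE; change (fpsmap (euler_part R (n %/ m)) (n %/ m)%N = euler K (n %/ m)%N); rewrite part.
Qed.

Lemma tame_eta m : (0 < m)%N -> tame (fps_eta R m) (fun x => eulerf (x ^+ m)).
Proof. by move=> m0; apply: tame_dilate => //; apply: tame_euler. Qed.

Lemma cubic_root_exists : exists w : K, w ^+ 2 + w + 1 = 0.
Proof.
exists ((- 2%:R^-1) +i* (Num.sqrt 3%:R / 2%:R)).
have s3 : Num.sqrt 3 * Num.sqrt 3 = 3 :> R by rewrite -expr2 sqr_sqrtr.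
apply/eqP; rewrite eq_complex /=; apply/andP; split; apply/eqP.
  transitivity ((3 - Num.sqrt 3 * Num.sqrt 3) / 4 : R); first by field.
  by rewrite s3 subrr mul0r.
by field.
Qed.

Local Notation nome24 y := (expR (- (2 * pi * 24%:R^-1 * y))).

Lemma nome24X (y : R) : nome24 y ^+ 24 = nome y.
Proof. by have := @qpow24 R y 1; rewrite mul1r expr1. Qed.

Lemma eta_im_natM m (y : R) : (0 < m)%N -> 0 < y ->
  eta (0 +i* (m%:R * y) : K) = (nome24 y ^+ m * eulerf (nome y ^+ m))%:C.
Proof.
move=> m0 y0; rewrite eta_im ?mulr_gt0 ?ltr0n // nome_natM -expRM_natl.
by congr ((expR _ * _)%:C); ring.
Qed.

Lemma eta_im1 (y : R) : 0 < y -> eta (0 +i* y : K) = (nome24 y * eulerf (nome y))%:C.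
Proof. exact: eta_im. Qed.

Lemma tau_coefs (tau : nat -> K) : q_expansion tau (fun z => eta z ^+ 24) ->
  forall n, (0 < n)%N -> tau n = ser_tau K n.
Proof.
move=> tauP n n0.
have <- : fpsmap (ser_tau R) = ser_tau K.
  by rewrite fpsmapM fpsmapX fpsmapXf fpsmap_eta.
apply: (@qexp_coefs R (ser_tau R) _ tau _ _ _ tauP _ n n0).
- apply: tame_mul (tame_Xn R 1) (tame_exp 24 (tame_eta _)); exact: isT.
- by rewrite coefsM0 mul0r.
move=> y y0; rewrite eta_im1 // -rmorphXn /= exprMn nome24X !expr1.
by [].
Qed.

Lemma tau63_coefs (tau63 : nat -> K) : q_expansion tau63 (@delta_6_3 R) ->
  tau63 0%N = 0 -> forall n, tau63 n = ser_tau63 K n.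
Proof.
move=> tauP tau0 [|n]; first by rewrite tau0 !coefsM0 !mul0r.
have <- : fpsmap (ser_tau63 R) = ser_tau63 K.
  by rewrite /ser_tau63 !(fpsmapX, fpsmapM) fpsmapXf !fpsmap_eta.
apply: (@qexp_coefs R (ser_tau63 R) _ tau63 _ _ _ tauP _ n.+1 isT).
- by apply: tame_mul (tame_mul (tame_Xn R 1) (tame_exp 6 (tame_eta _)))
    (tame_exp 6 (tame_eta _)).
- by rewrite !coefsM0 !mul0r.
move=> y y0; rewrite /delta_6_3 mulr_im eta_im1 // eta_im_natM //.
rewrite -!rmorphXn -rmorphM /=; congr (_%:C).
(* The leading factors of eta are powers of a 24th root of the nome. Once the nome is written as its
   24th power, the exponents match as polynomials; the same is done for [tau83_coefs]. *)
by rewrite -nome24X; ring.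
Qed.

Lemma tau83_coefs (tau83 : nat -> K) : q_expansion tau83 (@delta_8_3 R) ->
  tau83 0%N = 0 -> forall n, tau83 n = ser_tau83 K n.
Proof.
move=> tauP tau0.
case=> [|n]; first by rewrite tau0 ser_tau83_0.
have <- : fpsmap (ser_tau83 R) = ser_tau83 K.
  by rewrite /ser_tau83 2!fpsmapD !(fpsmap_nat, fpsmapX, fpsmapM) fpsmapXf !fpsmap_eta.
apply: (@qexp_coefs R (ser_tau83 R) _ tau83 _ _ _ tauP _ n.+1 isT).
- pose E m k m0 := tame_exp k (@tame_eta m m0).
  have t1 := tame_mul (tame_mul (tame_Xn R 1) (E 1%N 12 isT)) (E 3%N 4 isT).
  have t2 := tame_mul (tame_mul (tame_mul (tame_mul (tame_nat R 81) (tame_Xn R 3))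
    (E 1%N 6 isT)) (E 3%N 4 isT)) (E 9%N 6 isT).
  have t3 := tame_mul (tame_mul (tame_mul (tame_mul (tame_nat R 18) (tame_Xn R 2))
    (E 1%N 9 isT)) (E 3%N 4 isT)) (E 9%N 3 isT).
  exact: tame_add (tame_add t1 t2) t3.
- exact: ser_tau83_0.
move=> y y0; rewrite /delta_8_3 !mulr_im eta_im1 // !eta_im_natM //.
rewrite -[81%:R](rmorph_nat (real_complex R)) -[18%:R](rmorph_nat (real_complex R)).
rewrite -!rmorphXn -!rmorphM -!rmorphD /=; congr (_%:C).
by rewrite -nome24X; ring.
Qed.

End Complexify.

Theorem theorem2p3 (R : realType) (tau tau63 tau83 : nat -> cplx R)
    (tauP : q_expansion tau (fun z => eta z ^+ 24))
    (tau63P : q_expansion tau63 (@delta_6_3 R))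
    (tau83P : q_expansion tau83 (@delta_8_3 R))
    (tau63_0 : tau63 0%N = 0) (tau83_0 : tau83 0%N = 0)
    (n : nat) (n_gt0 : (0 < n)%N) :
  (rep_count 12 n)%:R =
      6552%:R / (73%:R * 691%:R) * sigma_star (cplx R) 11 n
      + 29824%:R / 691%:R * tau n
      + 240%:R * 1186848%:R / 50443%:R *
          (\sum_(0 <= a < n.+1) \sum_(0 <= b < n.+1 | (a + b)%N == n)
              sigma (cplx R) 3 a * tau83 b)
      - 504%:R * 261344%:R / 50443%:R *
          (\sum_(0 <= a < n.+1) \sum_(0 <= b < n.+1 | (a + b)%N == n)
              sigma (cplx R) 5 a * tau63 b)
  /\
  (rep_count 14 n)%:R =
      12%:R / 1093%:R * sigma_star (cplx R) 13 n
      + 107264%:R / 1093%:R * tau n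
      + 107264%:R * 12%:R / 1093%:R *
          ((\sum_(1 <= a < n.+1) \sum_(1 <= b < n.+1 | (a + b)%N == n)
              sigma (cplx R) 1 a * tau b)
           - 3%:R *
             (\sum_(1 <= a < n.+1) \sum_(1 <= b < n.+1 | (3 * a + b)%N == n)
                 sigma (cplx R) 1 a * tau b))
      + 12448%:R * 504%:R / 1093%:R *
          (\sum_(0 <= a < n.+1) \sum_(0 <= b < n.+1 | (a + b)%N == n)
              sigma (cplx R) 5 a * tau83 b)
      - 3016%:R * 480%:R / 1093%:R *
          (\sum_(0 <= a < n.+1) \sum_(0 <= b < n.+1 | (a + b)%N == n)
              sigma (cplx R) 7 a * tau63 b).
Proof.
have [w w_root] := cubic_root_exists R.
have tauE := tau_coefs tauP.
have tau63E := tau63_coefs tau63P tau63_0.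
have tau83E := tau83_coefs tau83P tau83_0.
split.
- exact: (rep_count24 w_root tauE tau63E tau83E n_gt0).
- exact: (rep_count28 w_root tauE tau63E tau83E n_gt0).
Qed.
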